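(* Let $A = \varinjlim A_n$ be the simple unital separable AH algebra (of Villadsen's second type) constructed in the context from a compact orientable differentiable manifold $M$ of dimension $d \geq 2$ and a sequence of points $(y_n)_{n \ge 0}$. Then for every $g \in A$, one has $\mathrm{C}^*(1, g) \neq A$. In fact, there is a finite set $\mathcal E \subseteq A$ such that for every $g \in A$, the sub-C*-algebra $\mathrm{C}^*(1, g)$ does not contain $\mathcal E$.
   Context: For a unital C*-algebra $A$ and $g\in A$, $\mathrm{C}^*(1,g)$ denotes the sub-C*-algebra of $A$ generated by $1$ and $g$. $\mathcal K$ denotes the algebra of compact operators on a separable infinite-dimensional Hilbert space. For a compact metrizable space $Y$, projections in $\mathrm{C}(Y)\otimes\mathcal K$ are identified with complex vector bundles over $Y$. Generalized diagonal maps: if $X, Y$ are compact metrizable spaces, $\lambda_1,\dots,\lambda_k: Y\to X$ are continuous maps and $q_1,\dots,q_k\in \mathrm{C}(Y)\otimes\mathcal K$ are mutually orthogonal projections, the map $\mathrm{C}(X)\to \mathrm{C}(Y)\otimes\mathcal K$ with spectral data $(\lambda_i,q_i)_{1\le i\le k}$ is $f\mapsto \left(y\mapsto \sum_{i=1}^k f(\lambda_i(y))q_i(y)\right)$. More generally, for a projection (vector bundle) $p\in \mathrm{C}(X)\otimes\mathcal K$, it induces the map on $p(\mathrm{C}(X)\otimes\mathcal K)p$ given by $a\mapsto \bigoplus_i (a\circ\lambda_i)\otimes q_i$, a unital map onto its image's corner $p'(\mathrm{C}(Y)\otimes\mathcal K)p'$, where $p'$ is the projection of the bundle $\bigoplus_i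 \lambda_i^*(p)\otimes q_i$. Construction of $A$: Let $M$ be a compact orientable differentiable manifold (without boundary) with $d=\dim(M)\geq 2$. Let $X_0=M$ and $X_n=X_{n-1}\times \mathbb{C}\mathrm{P}^{2^n}$ for $n\ge 1$, so that $X_n=M\times\mathbb{C}\mathrm{P}^{2}\times\cdots\times\mathbb{C}\mathrm{P}^{2^i}\times\cdots\times\mathbb{C}\mathrm{P}^{2^n}$. Here $\mathbb{C}\mathrm{P}^m$ is $m$-dimensional complex projective space (of real dimension $2m$) and $\xi_m$ is its canonical line bundle. Let $\pi_n^{(1)}:X_n\to X_{n-1}$ and $\pi_n^{(2)}:X_n\to\mathbb{C}\mathrm{P}^{2^n}$ be the coordinate projections of $X_n=X_{n-1}\times\mathbb{C}\mathrm{P}^{2^n}$. Choose points $y_n\in X_n$, $n\ge 0$, such that for every $n\geq 0$ the sequence $y_n,\ \pi_{n+1}^{(1)}(y_{n+1}),\ \dots,\ (\pi_{n+1}^{(1)}\circ\cdots\circ\pi_{n+k}^{(1)})(y_{n+k}),\dots$ is dense in $X_n$. Let $A_0=\mathrm{C}(X_0)=\mathrm{C}(M)$ and, inductively, $A_n=p_n(\mathrm{C}(X_n)\otimes\mathcal K)p_n$, where the unital connecting map $A_{n-1}\to A_n$ is induced by the spectral data $(\pi_n^{(1)},\theta)$ and $(y_{n-1},(\pi_n^{(2)})^*(\xi_{2^n}))$; here $\theta$ is the trivial (constant) line bundle over $X_n$, $y_{n-1}$ stands for the constant map $X_n\to X_{n-1}$ with value $y_{n-1}$, and $p_n$ is the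 image of the unit of $A_{n-1}$. The vector bundle over $X_n$ associated with $p_n$ is $\theta\oplus\bigoplus_{i=1}^n \eta_{2^i}^{\oplus 2^{i-1}}$, of rank $2^n$, where $\eta_{2^i}$ is the pullback of $\xi_{2^i}$ along the projection $X_n\to\mathbb{C}\mathrm{P}^{2^i}$. The C*-algebra $A=\varinjlim A_n$ is a simple unital separable AH algebra. *)

(* Defs.v *)
From HB Require Import structures.
From mathcomp Require Import all_boot all_order all_algebra.
From mathcomp Require Import all_classical all_reals all_analysis.
From mathcomp Require Import generic_quotient spectral complex mxtens.

Set Implicit Arguments.
Unset Strict Implicit.
Unset Printing Implicit Defensive.

Import Order.TTheory GRing.Theory Num.Theory numFieldNormedType.Exports.

Local Open Scope classical_set_scope.
Local Open Scope sesquilinear_scope.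
Local Open Scope ring_scope.

(* The product is a field of the mixin, not the one of GRing.Algebra: a
   structure joining GRing.PzSemiRing with a norm would have to be declared
   before Num.NumDomain. *)
HB.mixin Record Lmodule_isStarAlgebra (C : numClosedFieldType) A
    of GRing.Lmodule C A := {
  smul : A -> A -> A;
  sone : A;
  star : A -> A;
  smulA : associative smul;
  smul1l : left_id sone smul;
  smul1r : right_id sone smul;
  smulDl : left_distributive smul +%R;
  smulDr : right_distributive smul +%R;
  smulZl : forall (c : C) x y, smul (c *: x) y = c *: smul x y;
  smulZr : forall (c : C) x y, smul x (c *: y) = c *: smul x y;
  starK : involutive star;
  starD : {morph star : x y / x + y};
  starZ : forall (c : C) x, star (c *: x) = c^* *: star x;
  starM : forall x y, star (smul x y) = smul (star y) (star x)
}.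

#[short(type="starAlgType")]
HB.structure Definition StarAlgebra (C : numClosedFieldType) :=
  {A of GRing.Lmodule C A & Lmodule_isStarAlgebra C A}.

HB.mixin Record StarAlgebra_isCStarAlgebra (C : numClosedFieldType) A
    of StarAlgebra C A & CompleteNormedModule C A := {
  normr_smul_le : forall x y : A, `|smul x y| <= `|x| * `|y|;
  normr_star_smul : forall x : A, `|smul (star x) x| = `|x| ^+ 2
}.

#[short(type="cstarAlgType")]
HB.structure Definition CStarAlgebra (C : numClosedFieldType) :=
  {A of StarAlgebra C A & CompleteNormedModule C A
      & StarAlgebra_isCStarAlgebra C A}.

Section CStar.
Context {C : numClosedFieldType}.

Definition star_morphism (A B : starAlgType C) (f : A -> B) : Prop :=
  [/\ linear f, {morph f : x y / smul x y}, f sone = sone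
    & {morph f : x / star x}].

Definition sub_cstar_algebra (A : cstarAlgType C) (B : set A) : Prop :=
  [/\ closed B, B 0,
      (forall x y, B x -> B y -> B (x + y)),
      (forall (c : C) x, B x -> B (c *: x))
    & (forall x y, B x -> B y -> B (smul x y)) /\
      (forall x, B x -> B (star x))].

Definition cstar_generated (A : cstarAlgType C) (S : set A) : set A :=
  smallest (@sub_cstar_algebra A) S.

(* The universal property defining the inductive limit of a sequence of unital
   C*-algebras and unital *-homomorphisms. The norms of the [A_ n] play no role
   in it: *-homomorphisms between C*-algebras are automatically contractive. *)
Definition is_inductive_limit (A_ : nat -> starAlgType C)
    (phi : forall n, A_ n -> A_ n.+1)
    (A : cstarAlgType C) (mu : forall n, A_ n -> A) : Prop :=
  [/\ forall n, star_morphism (mu n),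
      forall n a, mu n.+1 (phi n a) = mu n a
    & forall (B : cstarAlgType C) (nu : forall n, A_ n -> B),
        (forall n, star_morphism (nu n)) ->
        (forall n a, nu n.+1 (phi n a) = nu n a) ->
        exists! f : A -> B,
          star_morphism f /\ forall n a, f (mu n a) = nu n a].

End CStar.

Section ContinuousMatrix.
Context {C : numClosedFieldType} {T : topologicalType}.

Lemma continuous_mx m n (f : T -> 'M[C]_(m, n)) :
  (forall i j, continuous (fun x => f x i j)) -> continuous f.
Proof.
move=> fc x A [P fxP sPA].
have : \forall t \near x, forall i j, P i j (f t i j).
  apply: filter_forall => i; apply: filter_forall => j.
  exact: fc (fxP i j).
by apply: filterS => t Pt; exact: sPA.
Qed.

Lemma continuous_entry m n (f : T -> 'M[C]_(m, n)) i j :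
  continuous f -> continuous (fun x => f x i j).
Proof.
move=> fc x; apply: (@continuous_comp _ _ _ f (fun M : 'M[C]_(m, n) => M i j)).
  exact: fc.
exact: coord_continuous.
Qed.

Lemma continuous_conjC : continuous (fun z : C => z^*).
Proof.
move=> z A /nbhs_ballP[e e0 sA]; apply/nbhs_ballP; exists e => // w zw.
by apply: sA; move: zw; rewrite -!ball_normE /ball_/= -rmorphB norm_conjC.
Qed.

Lemma continuous_trmxC m n (f : T -> 'M[C]_(m, n)) :
  continuous f -> continuous (fun x => (f x)^t*).
Proof.
move=> fc; apply: continuous_mx => i j x.
under eq_fun do rewrite !mxE.
apply: (@continuous_comp _ _ _ (fun x => f x j i) (fun z : C => z^*)).
  exact: continuous_entry.
exact: continuous_conjC.
Qed.

Lemma continuous_mulmx m n p (f : T -> 'M[C]_(m, n)) (g : T -> 'M[C]_(n, p)) :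
  continuous f -> continuous g -> continuous (fun x => f x *m g x).
Proof.
move=> fc gc; apply: continuous_mx => i j x.
rewrite (_ : (fun _ => _) = fun x => \sum_k f x i k * g x k j); last first.
  by apply/funext => t; rewrite mxE.
apply: (@cvg_big _ _ +%R) => [|k _].
  exact: add_continuous.
by apply: cvgM; apply: continuous_entry.
Qed.

Lemma continuous_tensmx m n p q
    (f : T -> 'M[C]_(m, n)) (g : T -> 'M[C]_(p, q)) :
  continuous f -> continuous g -> continuous (fun x => tensmx (f x) (g x)).
Proof.
move=> fc gc; apply: continuous_mx => i j x.
rewrite (_ : (fun _ => _) = fun x =>
    f x (mxtens_unindex i).1 (mxtens_unindex j).1 *
    g x (mxtens_unindex i).2 (mxtens_unindex j).2); last first.
  by apply/funext => t; rewrite mxE.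
by apply: cvgM; apply: continuous_entry.
Qed.

Lemma continuous_block_diag m n p q
    (f : T -> 'M[C]_(m, n)) (g : T -> 'M[C]_(p, q)) :
  continuous f -> continuous g ->
  continuous (fun x => block_mx (f x) 0 0 (g x)).
Proof.
move=> fc gc; apply: continuous_mx => i j.
case: (split_ordP i) => i' ->; case: (split_ordP j) => j' ->.
- by under eq_fun do rewrite block_mxEul; apply: continuous_entry.
- by under eq_fun do rewrite block_mxEur mxE; apply: cst_continuous.
- by under eq_fun do rewrite block_mxEdl mxE; apply: cst_continuous.
- by under eq_fun do rewrite block_mxEdr; apply: continuous_entry.
Qed.

End ContinuousMatrix.

Section TensorAdjoint.
Context {C : numClosedFieldType}.

Lemma trmxC_mul m n p (A : 'M[C]_(m, n)) (B : 'M[C]_(n, p)) :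
  (A *m B)^t* = B^t* *m A^t*.
Proof. by rewrite trmx_mul map_mxM. Qed.

Lemma trmxC_tens m n p q (A : 'M[C]_(m, n)) (B : 'M[C]_(p, q)) :
  (tensmx A B)^t* = tensmx (A^t*) (B^t*).
Proof. by apply/matrixP => i j; rewrite !mxE rmorphM. Qed.

Lemma trmxC_block m n p q (A : 'M[C]_(m, n)) (B : 'M[C]_(p, q)) :
  (block_mx A 0 0 B)^t* = block_mx (A^t*) 0 0 (B^t*).
Proof. by rewrite tr_block_mx map_block_mx !trmx0 !map_mx0. Qed.

Lemma mulmx_block_diag m1 n1 p1 m2 n2 p2
    (A : 'M[C]_(m1, n1)) (A' : 'M[C]_(n1, p1))
    (B : 'M[C]_(m2, n2)) (B' : 'M[C]_(n2, p2)) :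
  block_mx A 0 0 B *m block_mx A' 0 0 B' = block_mx (A *m A') 0 0 (B *m B').
Proof. by rewrite mulmx_block !mul0mx !mulmx0 !addr0 !add0r. Qed.

End TensorAdjoint.

(* A projection p of C(T) (x) M_N is the vector bundle over T whose fibre at x
   is the range of p x, a subbundle of the trivial bundle T * C^N. The algebra
   M_N is seen as the upper left corner of the compact operators K, so that
   p (C(T) (x) K) p = p (C(T) (x) M_N) p. *)
Record projection (C : numClosedFieldType) (T : topologicalType) (N : nat) :=
  Projection {
    proj_fun :> T -> 'M[C]_N;
    proj_continuous : continuous proj_fun;
    proj_idem : forall x, proj_fun x *m proj_fun x = proj_fun x;
    proj_adj : forall x, (proj_fun x)^t* = proj_fun x
  }.

Arguments proj_continuous {C T N} _ _ _ _.
Arguments proj_idem {C T N} _ _.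
Arguments proj_adj {C T N} _ _.

Section Corner.
Context {C : numClosedFieldType} {T : topologicalType} {N : nat}.
Variable p : projection C T N.

Definition in_corner : {pred T -> 'M[C]_N} := fun a =>
  `[< continuous a /\ forall x, p x *m a x *m p x = a x >].

Record corner := Corner {
  corner_fun :> T -> 'M[C]_N;
  corner_funP : corner_fun \in in_corner
}.

HB.instance Definition _ := [isSub for corner_fun].
HB.instance Definition _ := [Choice of corner by <:].

Lemma in_cornerP (a : T -> 'M[C]_N) :
  reflect (continuous a /\ forall x, p x *m a x *m p x = a x)
          (a \in in_corner).
Proof. exact: asboolP. Qed.

Lemma corner_continuous (a : corner) : continuous a.
Proof. by have /in_cornerP[] := corner_funP a. Qed.

Arguments corner_continuous a : clear implicits.

Lemma cornerE (a : corner) x : p x *m a x *m p x = a x.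
Proof. by have /in_cornerP[] := corner_funP a. Qed.

Lemma corner_mulr (a : corner) x : a x *m p x = a x.
Proof. by rewrite -cornerE -!mulmxA proj_idem. Qed.

Lemma corner_mull (a : corner) x : p x *m a x = a x.
Proof. by rewrite -cornerE !mulmxA proj_idem. Qed.

Lemma corner_ext (a b : corner) : (forall x, a x = b x) -> a = b.
Proof. by move=> ab; apply/val_inj/funext. Qed.

Lemma corner_submod_closed : submod_closed in_corner.
Proof.
split.
  apply/in_cornerP; split=> [|x]; first exact: cst_continuous.
  by rewrite mulmx0 mul0mx.
move=> c a b /in_cornerP[ac aE] /in_cornerP[bc bE].
apply/in_cornerP; split=> [x|x].
  by apply: cvgD; [apply: cvgZr; exact: ac|exact: bc].
by rewrite mulmxDr mulmxDl -scalemxAr -scalemxAl aE bE.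
Qed.

HB.instance Definition _ :=
  GRing.isSubmodClosed.Build C (T -> 'M[C]_N) in_corner corner_submod_closed.
HB.instance Definition _ :=
  [SubChoice_isSubLmodule of corner by <:].

Lemma corner_mul_subproof (a b : corner) :
  (fun x => a x *m b x) \in in_corner.
Proof.
apply/in_cornerP; split=> [|x].
  by apply: continuous_mulmx; exact: corner_continuous.
by rewrite mulmxA corner_mull -mulmxA corner_mulr.
Qed.

Lemma corner_one_subproof : proj_fun p \in in_corner.
Proof.
apply/in_cornerP; split=> [|x]; first exact: proj_continuous.
by rewrite !proj_idem.
Qed.

Lemma corner_star_subproof (a : corner) : (fun x => (a x)^t*) \in in_corner.
Proof.
apply/in_cornerP; split=> [|x].
  exact/continuous_trmxC/corner_continuous.
by rewrite -[in RHS](cornerE a x) !trmxC_mul proj_adj mulmxA.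
Qed.

Definition corner_mul a b := Corner (corner_mul_subproof a b).
Definition corner_one := Corner corner_one_subproof.
Definition corner_star a := Corner (corner_star_subproof a).

Lemma corner_mulA : associative corner_mul.
Proof. by move=> a b c; apply: corner_ext => x /=; rewrite mulmxA. Qed.

Lemma corner_mul1l : left_id corner_one corner_mul.
Proof. by move=> a; apply: corner_ext => x /=; rewrite corner_mull. Qed.

Lemma corner_mul1r : right_id corner_one corner_mul.
Proof. by move=> a; apply: corner_ext => x /=; rewrite corner_mulr. Qed.

Lemma corner_mulDl : left_distributive corner_mul +%R.
Proof. by move=> a b c; apply: corner_ext => x /=; rewrite mulmxDl. Qed.

Lemma corner_mulDr : right_distributive corner_mul +%R.
Proof. by move=> a b c; apply: corner_ext => x /=; rewrite mulmxDr. Qed.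

Lemma corner_mulZl (c : C) a b : corner_mul (c *: a) b = c *: corner_mul a b.
Proof. by apply: corner_ext => x /=; rewrite -scalemxAl. Qed.

Lemma corner_mulZr (c : C) a b : corner_mul a (c *: b) = c *: corner_mul a b.
Proof. by apply: corner_ext => x /=; rewrite -scalemxAr. Qed.

Lemma corner_starK : involutive corner_star.
Proof. by move=> a; apply: corner_ext => x /=; rewrite trmxCK. Qed.

Lemma corner_starD : {morph corner_star : a b / a + b}.
Proof. by move=> a b; apply: corner_ext => x /=; rewrite linearD map_mxD. Qed.

Lemma corner_starZ (c : C) a : corner_star (c *: a) = c^* *: corner_star a.
Proof. by apply: corner_ext => x /=; rewrite linearZ map_mxZ. Qed.

Lemma corner_starM a b :
  corner_star (corner_mul a b) = corner_mul (corner_star b) (corner_star a).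
Proof. by apply: corner_ext => x /=; rewrite trmxC_mul. Qed.

HB.instance Definition _ := Lmodule_isStarAlgebra.Build C corner
  corner_mulA corner_mul1l corner_mul1r corner_mulDl corner_mulDr
  corner_mulZl corner_mulZr corner_starK corner_starD corner_starZ corner_starM.

End Corner.

(* The generalized diagonal map with spectral data (l1, q1), (l2, q2). The direct
   sum of the (a \o l_i) (x) q_i is formed blockwise; placing q1 and q2 in
   different blocks makes them orthogonal. *)
Section DiagonalMap.
Context {C : numClosedFieldType} {X Y : topologicalType} {N k1 k2 : nat}.
Variables (l1 l2 : Y -> X).
Hypotheses (l1c : continuous l1) (l2c : continuous l2).
Variables (q1 : projection C Y k1) (q2 : projection C Y k2).

Definition diag_fun (a : X -> 'M[C]_N) : Y -> 'M[C]_(N * k1 + N * k2) :=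
  fun y => block_mx (tensmx (a (l1 y)) (q1 y)) 0
                    0 (tensmx (a (l2 y)) (q2 y)).

Lemma diag_fun_continuous a : continuous a -> continuous (diag_fun a).
Proof.
move=> ac; apply: continuous_block_diag; apply: continuous_tensmx;
  try exact: proj_continuous.
- by move=> y; apply: continuous_comp; [exact: l1c|exact: ac].
- by move=> y; apply: continuous_comp; [exact: l2c|exact: ac].
Qed.

Lemma diag_funM a b y :
  diag_fun (fun x => a x *m b x) y = diag_fun a y *m diag_fun b y.
Proof. by rewrite /diag_fun mulmx_block_diag !tensmx_mul !proj_idem. Qed.

Lemma diag_fun_linear (c : C) a b y :
  diag_fun (fun x => c *: a x + b x) y = c *: diag_fun a y + diag_fun b y.
Proof.
rewrite /diag_fun scale_block_mx add_block_mx !scaler0 !addr0.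
by congr block_mx; apply/matrixP => i j; rewrite !mxE mulrDl mulrA.
Qed.

Lemma diag_fun_adj a y : diag_fun (fun x => (a x)^t*) y = (diag_fun a y)^t*.
Proof. by rewrite /diag_fun trmxC_block !trmxC_tens !proj_adj. Qed.

Lemma diag_proj_idem (p : projection C X N) y :
  diag_fun p y *m diag_fun p y = diag_fun p y.
Proof. by rewrite -diag_funM /diag_fun !proj_idem. Qed.

Lemma diag_proj_adj (p : projection C X N) y :
  (diag_fun p y)^t* = diag_fun p y.
Proof. by rewrite -diag_fun_adj /diag_fun !proj_adj. Qed.

Definition diag_proj (p : projection C X N) : projection C Y (N * k1 + N * k2) :=
  Projection (diag_fun_continuous (@proj_continuous _ _ _ p))
             (diag_proj_idem p) (diag_proj_adj p).

Lemma diag_map_subproof (p : projection C X N) (a : corner p) :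
  diag_fun a \in in_corner (diag_proj p).
Proof.
apply/in_cornerP; split=> [|y].
  exact/diag_fun_continuous/corner_continuous.
by rewrite /= -!diag_funM /diag_fun !cornerE.
Qed.

Definition diag_map (p : projection C X N) (a : corner p) :
  corner (diag_proj p) := Corner (diag_map_subproof a).

Lemma diag_map_morphism (p : projection C X N) : star_morphism (@diag_map p).
Proof.
split=> [c a b|a b||a].
- by apply: corner_ext => y; exact: diag_fun_linear.
- by apply: corner_ext => y /=; rewrite -diag_funM.
- exact: corner_ext.
- by apply: corner_ext => y /=; rewrite -diag_fun_adj.
Qed.

End DiagonalMap.

Arguments diag_proj {C X Y N k1 k2 l1 l2} l1c l2c q1 q2 p.
Arguments diag_map {C X Y N k1 k2 l1 l2} l1c l2c q1 q2 p a.

Section ConstantProjection.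
Variables (C : numClosedFieldType) (T : topologicalType) (N : nat).

Lemma proj1_continuous : continuous (fun _ : T => 1%:M : 'M[C]_N).
Proof. exact: cst_continuous. Qed.

Lemma proj1_idem (x : T) : 1%:M *m 1%:M = 1%:M :> 'M[C]_N.
Proof. exact: mulmx1. Qed.

Lemma proj1_adj (x : T) : (1%:M)^t* = 1%:M :> 'M[C]_N.
Proof. by rewrite trmx1 map_mx1. Qed.

Definition proj1 : projection C T N :=
  Projection proj1_continuous proj1_idem proj1_adj.

End ConstantProjection.

Section PullbackProjection.
Context {C : numClosedFieldType} {X Y : topologicalType} {N : nat}.
Context {l : Y -> X} (lc : continuous l).
Variable q : projection C X N.

Lemma pullback_continuous : continuous (q \o l).
Proof.
by move=> y; apply: continuous_comp; [exact: lc|exact: proj_continuous].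
Qed.

Definition pullback : projection C Y N :=
  Projection pullback_continuous
    (fun y => proj_idem q (l y)) (fun y => proj_adj q (l y)).

End PullbackProjection.

(* Complex projective space is the quotient of the nonzero vectors by the
   relation of spanning the same line. Its tautological line bundle has the line
   x itself as fibre at x; as a projection, it maps x to the orthogonal
   projection [line_proj] onto that line. Matrices act on column vectors. *)
Section ProjectiveSpace.
Variables (C : numClosedFieldType) (m : nat).

Definition nonzero_vec : topologicalType :=
  set_type [set z : 'cV[C]_m.+1 | z != 0].

Definition same_line : rel nonzero_vec := fun z w =>
  `[< exists2 c : C, c != 0 & set_val w = c *: set_val z >].

Lemma same_line_refl : reflexive same_line.
Proof. by move=> z; apply/asboolP; exists 1; rewrite ?oner_eq0 ?scale1r. Qed.

Lemma same_line_sym : symmetric same_line.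
Proof.
move=> z w; apply/asboolP/asboolP => -[c c0 E];
  by exists c^-1; rewrite ?invr_eq0// E scalerK.
Qed.

Lemma same_line_trans : transitive same_line.
Proof.
move=> w z v /asboolP[c c0 E] /asboolP[e e0 F]; apply/asboolP.
by exists (e * c); rewrite ?mulf_neq0// F E scalerA.
Qed.

Definition same_line_equiv :=
  EquivRel same_line same_line_refl same_line_sym same_line_trans.

Definition CP : topologicalType :=
  quotient_topology {eq_quot same_line_equiv}%qT.

Definition line_proj (z : 'cV[C]_m.+1) : 'M[C]_m.+1 :=
  ((z^t* *m z) 0 0)^-1 *: (z *m z^t*).

Lemma sqnorm_neq0 (z : 'cV[C]_m.+1) : z != 0 -> (z^t* *m z) 0 0 != 0.
Proof.
apply: contraNneq; rewrite mxE => /eqP.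
under eq_bigr do rewrite !mxE mulrC -normCK.
rewrite psumr_eq0 => [/allP z0|i _]; last by rewrite exprn_ge0.
apply/eqP/matrixP => i j; rewrite ord1 mxE.
by have := z0 i (mem_index_enum i); rewrite expf_eq0/= normr_eq0 => /eqP.
Qed.

Lemma sqnorm_conj (z : 'cV[C]_m.+1) :
  ((z^t* *m z) 0 0)^* = (z^t* *m z) 0 0.
Proof.
rewrite !mxE rmorph_sum; apply: eq_bigr => i _.
by rewrite !mxE rmorphM /= conjCK mulrC.
Qed.

Lemma line_proj_idem (z : 'cV[C]_m.+1) :
  z != 0 -> line_proj z *m line_proj z = line_proj z.
Proof.
move=> z0; have s0 := sqnorm_neq0 z0; rewrite /line_proj.
have /= := mx11_scalar (z^t* *m z); move: (_ 0 0) s0 => s s0 zz.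
rewrite -scalemxAl -scalemxAr mulmxA -(mulmxA z) zz mul_mx_scalar -scalemxAl.
by rewrite [X in _ *: X]scalerA mulVf// scale1r.
Qed.

Lemma line_proj_adj (z : 'cV[C]_m.+1) : (line_proj z)^t* = line_proj z.
Proof.
by rewrite /line_proj linearZ/= map_mxZ fmorphV/= sqnorm_conj trmxC_mul trmxCK.
Qed.

Lemma line_projZ (c : C) (z : 'cV[C]_m.+1) :
  c != 0 -> line_proj (c *: z) = line_proj z.
Proof.
move=> c0; rewrite /line_proj [(c *: z)^T]linearZ/= map_mxZ.
rewrite -!scalemxAl -!scalemxAr !scalerA.
move: (z^t* *m z) (z *m z^t*) => u v; rewrite [_ 0 0]mxE; congr (_ *: _).
by rewrite -mulrA [c * _]mulrC invfM mulrAC mulVf ?mul1r// mulf_neq0// conjC_eq0.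
Qed.

Lemma line_proj_continuous (T : topologicalType) (f : T -> 'cV[C]_m.+1) :
  continuous f -> (forall x, f x != 0) -> continuous (fun x => line_proj (f x)).
Proof.
move=> fc f0 x; have fsc := continuous_trmxC fc.
have sc := continuous_entry (i := 0) (j := 0) (continuous_mulmx fsc fc).
apply: cvgZ; last exact: (continuous_mulmx fc fsc).
exact: (cvgV (sqnorm_neq0 (f0 x)) (sc x)).
Qed.

Definition taut_fun : CP -> 'M[C]_m.+1 :=
  (fun z : nonzero_vec => line_proj (set_val z)) \o
  (repr : quotient_topology {eq_quot same_line_equiv}%qT -> nonzero_vec).

Lemma taut_continuous : continuous taut_fun.
Proof.
apply: repr_comp_continuous.
  apply: line_proj_continuous => [|z]; first exact: initial_continuous.
  exact: (set_valP z).
move=> z w /eqP zw; have /asboolP[c c0 E] : same_line z w.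
  exact/(@eqmodP _ same_line_equiv).
by apply/eqP; rewrite E line_projZ.
Qed.

Lemma taut_idem x : taut_fun x *m taut_fun x = taut_fun x.
Proof. exact: (line_proj_idem (set_valP (repr x))). Qed.

Lemma taut_adj x : (taut_fun x)^t* = taut_fun x.
Proof. exact: line_proj_adj. Qed.

Definition taut : projection C CP m.+1 :=
  Projection taut_continuous taut_idem taut_adj.

End ProjectiveSpace.

Section ProdContinuous.
Context {S T : topologicalType}.

Lemma fst_continuous : continuous (@fst S T).
Proof. by move=> x; exact: cvg_fst. Qed.

Lemma snd_continuous : continuous (@snd S T).
Proof. by move=> x; exact: cvg_snd. Qed.

End ProdContinuous.

Section Villadsen.
Variables (C : numClosedFieldType) (M : topologicalType).

Fixpoint vspace (n : nat) : topologicalType :=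
  if n is n'.+1 then (vspace n' * CP C (2 ^ n'.+1))%type else M.

Fixpoint tower_proj (k n : nat) : vspace (k + n) -> vspace n :=
  if k is k'.+1 then fun x => tower_proj x.1 else id.

Definition tower_dense (y : forall n, vspace n) : Prop :=
  forall n, dense (range (fun k => tower_proj (y (k + n)%N))).

Fixpoint vdim (n : nat) : nat :=
  if n is n'.+1 then vdim n' * 1 + vdim n' * (2 ^ n'.+1).+1 else 1.

Definition xi_bundle n : projection C (vspace n.+1) (2 ^ n.+1).+1 :=
  pullback snd_continuous (taut C (2 ^ n.+1)).

Variable y : forall n, vspace n.

Fixpoint unit_proj (n : nat) : projection C (vspace n) (vdim n) :=
  match n return projection C (vspace n) (vdim n) with
  | 0 => proj1 C M 1
  | n'.+1 =>
    diag_proj fst_continuous (@cst_continuous _ _ (y n'))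
      (proj1 C (vspace n'.+1) 1) (xi_bundle n') (unit_proj n')
  end.

Definition villadsen_alg (n : nat) : starAlgType C := corner (unit_proj n).

Definition villadsen_map (n : nat) : villadsen_alg n -> villadsen_alg n.+1 :=
  diag_map fst_continuous (@cst_continuous _ _ (y n))
    (proj1 C (vspace n.+1) 1) (xi_bundle n) (unit_proj n).

Lemma villadsen_map_morphism n : star_morphism (@villadsen_map n).
Proof. exact: diag_map_morphism. Qed.

End Villadsen.

Arguments villadsen_map {C M} y n a.

Section SmoothMap.
Context {R : realType} {m n : nat}.
Implicit Types (k : nat) (U : set 'rV[R]_m) (f : 'rV[R]_m -> 'rV[R]_n).

(* only meaningful for open U *)
Fixpoint Ck_on k U f : Prop :=
  if k is k'.+1 then
    forall i : 'I_m,
      (forall u, U u -> derivable f u (delta_mx 0 i)) /\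
      Ck_on k' U (fun u => 'D_(delta_mx 0 i) f u)
  else forall u, U u -> {for u, continuous f}.

Definition smooth_on U f : Prop := forall k, Ck_on k U f.

End SmoothMap.

Section Manifold.
Variables (R : realType) (M : topologicalType) (d : nat).

(* [chart_fun] and [chart_inv] carry junk values outside [chart_dom] and its
   image. *)
Record chart := Chart {
  chart_dom : set M;
  chart_fun : M -> 'rV[R]_d;
  chart_inv : 'rV[R]_d -> M;
  chart_dom_open : open chart_dom;
  chart_im_open : open (chart_fun @` chart_dom);
  chart_fun_continuous : {within chart_dom, continuous chart_fun};
  chart_inv_continuous :
    {within chart_fun @` chart_dom, continuous chart_inv};
  chart_funK : forall x, chart_dom x -> chart_inv (chart_fun x) = x
}.

Definition transition (c c' : chart) : 'rV[R]_d -> 'rV[R]_d :=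
  chart_fun c' \o chart_inv c.

Definition transition_dom (c c' : chart) : set 'rV[R]_d :=
  chart_fun c @` (chart_dom c `&` chart_dom c').

Definition smooth_atlas (At : set chart) : Prop :=
  (forall x, exists2 c, At c & chart_dom c x) /\
  (forall c c', At c -> At c' ->
    smooth_on (transition_dom c c') (transition c c')).

Definition oriented_atlas (At : set chart) : Prop :=
  smooth_atlas At /\
  forall c c' u, At c -> At c' -> transition_dom c c' u ->
    0 < \det ('J (transition c c') u).

(* The smooth structure given by At admits an oriented atlas. *)
Definition orientable (At : set chart) : Prop :=
  exists2 Bt, oriented_atlas Bt & smooth_atlas (At `|` Bt).

Definition smooth_manifold (At : set chart) : Prop :=
  [/\ hausdorff_space M, @second_countable M & smooth_atlas At].

End Manifold.

(* Main.v *)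
Require Import Defs.
From HB Require Import structures.
From mathcomp Require Import all_boot all_order all_algebra.
From mathcomp Require Import zify ring lra.

Set Implicit Arguments.
Unset Strict Implicit.
Unset Printing Implicit Defensive.

Import Order.TTheory GRing.Theory Num.Theory.

Local Open Scope ring_scope.

(** Why no element generates A. Let e be the vector of the trivial summand of
    the bundle of p_n. Given g in A_n, consider the points of X_n where e spans a
    subspace that reduces g: there e g = lambda e and e g^* = conj(lambda) e for
    a complex number lambda. The space X_n is the image of M times a cube which
    has one block of coordinates for each projective space; the block of
    CP^(2^i) parametrizes the lines of C^(2^i + 1), and opposite points of its
    boundary give the same line. Expressed in these coordinates ([obstr]),
    reducing points are the zeros of a map s from M times the cube to R^N, where
    N is the dimension of the cube, and s is odd on the boundary of each block,
    because the other summands of p_n are tautological bundles, in which the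
    coordinate of a vector changes its sign with the generator of the line. As
    in the Borsuk-Ulam theorem, s has an odd number of zeros over each point of
    M, when they are counted properly: the zeros carry the fundamental class mod
    2 of M. The eigenvalue lambda maps them to the plane.

    Suppose that the C*-algebra generated by g contains enough functions on M,
    seen as elements of A_0. A function h on M multiplies e by its value, so
    elements of C*(1,g) act on e, at a reducing point, by a continuous function
    of lambda up to a small error ([governed_generated]): lambda determines the
    point of M up to a small error. A map to R^d, d >= 2, with this property
    on the zeros of s would be a local embedding of M up to small perturbations.
    It has nonzero local degree at some value w ([local_zero]); the points with
    value w are close together, hence inside one coordinate cube, so
    that the degree is the same at all values close to w, at which the points
    are close together again. Thus all values are attained, but lambda is
    bounded ([no_separating_family]). Finitely many coordinate functions on M
    suffice for this argument, with a precision that does not depend on n; they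
    form the finite set.

    Degrees are replaced by the property, called [essential], that a map has a
    zero and keeps it under all equivariant modifications over a part of M. It
    is established with a combinatorial degree mod 2 of families of sign
    functions on fine grids ([degree_homotopy], [degree_fibre]).

    The algebra A is known by its universal property only. The bounded sequences
    of elements a_n of A_n, modulo the null sequences, form a C*-algebra
    ([limit_alg]), and the universal property maps A to it, so that elements of
    A have representing sequences; the elements that are functions of lambda at
    the reducing points of g are closed under limits because morphisms of
    C*-algebras are contractive ([star_morphism_contractive]). *)

(** * Parity of flags of grid cubes *)

(** A vector of integers stands for a cell of a grid of cubes: its odd
    coordinates range over the interval between the neighbouring even numbers,
    the even ones are fixed. The booleans are the field with two elements, with
    the exclusive or as [+]. *)
Definition oddz (z : int) : bool := odd `|z|%N.

Lemma oddzD1 (z : int) (b : bool) :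
  oddz (z + (if b then 1 else -1)) = ~~ oddz z.
Proof. by case: b; rewrite /oddz; lia. Qed.

Lemma sum_sym_char2 (V : nmodType) (T : finType) (G : T -> T -> V) (P : rel T) :
  (forall x : V, x + x = 0) ->
  symmetric P -> irreflexive P -> (forall x y, G x y = G y x) ->
  \sum_x \sum_(y | P x y) G x y = 0.
Proof.
move=> V2 Ps Pi Gs.
rewrite (eq_bigr (fun x => \sum_(y | P x y && (enum_rank x < enum_rank y)%N) G x y
   + \sum_(y | P x y && ~~ (enum_rank x < enum_rank y)%N) G x y)); last first.
  by move=> x _; rewrite -bigID.
have E : \sum_x \sum_(y | P x y && ~~ (enum_rank x < enum_rank y)%N) G x y =
    \sum_x \sum_(y | P x y && (enum_rank x < enum_rank y)%N) G x y.
  rewrite (exchange_big_dep xpredT) //=; apply: eq_bigr => y _.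
  apply: eq_big => [x|x _]; last exact: Gs.
  rewrite Ps; case: (eqVneq x y) (Pi x) => [->|xy _]; first by rewrite Pi.
  rewrite -leqNgt leq_eqVlt (inj_eq val_inj) (inj_eq enum_rank_inj) eq_sym.
  by rewrite (negPf xy).
by rewrite big_split /= E V2.
Qed.

Section Flags.
Variable K : nat.
Local Notation point := 'rV[int]_K.
Implicit Types (v u : point) (e : point -> bool) (es : seq (point -> bool)).

Definition step v (j : 'I_K) (b : bool) : point :=
  \row_i (v 0 i + (if i == j then if b then 1 else -1 else 0)).

(** The coboundary mod 2: [step v j b] runs over the facets of [v]. *)
Definition bdry (G : point -> bool) v : bool :=
  \sum_(j | oddz (v 0 j)) \sum_b G (step v j b).

(** The signs [es] are 0-cochains on the barycentric subdivision of the grid, and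
    this is the cup product of their coboundaries, evaluated on the sum of the
    flags of cells that start at [v]. *)
Fixpoint flagsum es v : bool :=
  if es is e :: es' then bdry (fun u => (e v + e u) * flagsum es' u) v else 1.

(** The same product with [eta] itself between [es] and [es'], in the place of
    its coboundary. *)
Fixpoint vflagsum es (eta : point -> bool) es' v : bool :=
  if es is e :: es1 then
    bdry (fun u => (e v + e u) * vflagsum es1 eta es' u) v
  else eta v * flagsum es' v.

Lemma stepE v j b i :
  step v j b 0 i = v 0 i + (if i == j then if b then 1 else -1 else 0).
Proof. by rewrite mxE. Qed.

Lemma step_neq v j b i : i != j -> step v j b 0 i = v 0 i.
Proof. by move=> ij; rewrite stepE (negPf ij) addr0. Qed.

Lemma oddz_step v j b i : oddz (v 0 j) ->
  oddz (step v j b 0 i) = (i != j) && oddz (v 0 i).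
Proof.
move=> ov; rewrite stepE; case: eqVneq => [->|_] /=; last by rewrite addr0.
by rewrite oddzD1 ov.
Qed.

Lemma stepC v j b j' b' : step (step v j b) j' b' = step (step v j' b') j b.
Proof. by apply/rowP => i; rewrite !stepE -!addrA [X in _ + X]addrC. Qed.

Lemma eq_bdry G1 G2 v : G1 =1 G2 -> bdry G1 v = bdry G2 v.
Proof. by move=> G12; apply: eq_bigr => j _; apply: eq_bigr => b _. Qed.

Lemma bdryD G1 G2 v : bdry (fun u => G1 u + G2 u) v = bdry G1 v + bdry G2 v.
Proof. by rewrite /bdry -big_split; apply: eq_bigr => j _; rewrite -big_split. Qed.

Lemma bdryZ c G v : bdry (fun u => c * G u) v = c * bdry G v.
Proof. by rewrite /bdry mulr_sumr; apply: eq_bigr => j _; rewrite mulr_sumr. Qed.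

(** Every face of codimension two lies in exactly two facets. *)
Lemma bdry_bdry G v : bdry (bdry G) v = 0.
Proof.
rewrite /bdry.
pose P (p q : 'I_K * bool) := [&& p.1 != q.1, oddz (v 0 p.1) & oddz (v 0 q.1)].
rewrite -[RHS](@sum_sym_char2 _ _ (fun p q => G (step (step v p.1 p.2) q.1 q.2)) P).
- rewrite pair_big_dep /= [RHS](bigID (fun p => oddz (v 0 p.1)))/=.
  rewrite [X in _ = _ + X]big1 ?addr0; last first.
    by move=> p op; rewrite big_pred0 // => q; rewrite /P (negPf op) andbF.
  apply: eq_big => [[j b]|[j b]] /=; first by rewrite andbT.
  rewrite andbT => oj; rewrite pair_big_dep /=; apply: eq_big => [[i c]|[i c]] //=.
  by rewrite andbT oddz_step // /P /= oj eq_sym.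
- exact: addbb.
- by move=> p q; rewrite /P eq_sym [oddz _ && _]andbC.
- by move=> p; rewrite /P eqxx.
- by move=> p q; rewrite stepC.
Qed.

Lemma bdry1 v : bdry (fun=> 1) v = 0.
Proof. by apply: big1 => j _; rewrite big_bool. Qed.

(** A product of coboundaries is a cocycle. *)
Lemma bdry_flagsum es v : bdry (flagsum es) v = 0.
Proof.
case: es => [|e es]; first exact: bdry1.
elim: es e v => [|e' es IH] e v.
  rewrite (@eq_bdry _ (bdry e)) ?bdry_bdry // => u.
  rewrite [LHS](@eq_bdry _ (fun w => e u * 1 + e w)) => [|w].
    by rewrite bdryD bdryZ bdry1 mulr0 add0r.
  by rewrite /=; case: (e u); case: (e w).
pose G u := e u * flagsum (e' :: es) u.
rewrite (@eq_bdry _ (bdry G)) ?bdry_bdry // => u.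
rewrite [LHS](@eq_bdry _ (fun w => e u * flagsum (e' :: es) w + G w)) => [|w].
  by rewrite bdryD bdryZ IH mulr0 add0r.
by rewrite mulrDl.
Qed.

(** Leibniz rule: since the other factors are cocycles, a product with the
    coboundary of [eta] as a factor is the coboundary of the product with
    [eta] in its place. *)
Lemma flagsum_cat es eta es' v :
  flagsum (es ++ eta :: es') v = bdry (vflagsum es eta es') v.
Proof.
elim: es v => [|e es IH] v.
  rewrite [LHS](@eq_bdry _ (fun w => eta v * flagsum es' w + vflagsum [::] eta es' w)) => [|w].
    by rewrite bdryD bdryZ bdry_flagsum mulr0 add0r.
  by rewrite mulrDl.
pose G := vflagsum es eta es'.
rewrite [LHS](@eq_bdry _ (fun u => (e v + e u) * bdry G u)); last by move=> u; rewrite -IH.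
have E u : vflagsum (e :: es) eta es' u =
    (e v + e u) * bdry G u + bdry (fun w => (e v + e w) * G w) u.
  rewrite -bdryZ -bdryD; apply: eq_bdry => w.
  rewrite -mulrDl; congr (_ * _).
  by rewrite addrACA [e v + e v]addbb add0r.
rewrite [RHS](eq_bdry _ E) bdryD bdry_bdry.
by rewrite [RHS]addr0.
Qed.

Lemma flagsumD es e e' es' v :
  flagsum (es ++ (fun u => e u + e' u) :: es') v =
  flagsum (es ++ e :: es') v + flagsum (es ++ e' :: es') v.
Proof.
elim: es v => [|e0 es IH] v; rewrite -bdryD; apply: eq_bdry => u.
  by rewrite -mulrDl addrACA.
by rewrite -mulrDr -IH.
Qed.

(** [u] is a face of the cube [v]. *)
Definition in_cell v u := [forall i, (`|u 0 i - v 0 i| <= 1) &&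
  (~~ oddz (v 0 i) ==> (u 0 i == v 0 i))].

Lemma in_cell_refl v : in_cell v v.
Proof. by apply/forallP => i; rewrite subrr normr0 ler01 eqxx implybT. Qed.

Lemma in_cell_step v j b : oddz (v 0 j) -> in_cell v (step v j b).
Proof.
move=> oj; apply/forallP => i; rewrite stepE addrAC subrr add0r.
case: eqVneq => [->|_]; first by rewrite oj; case: b.
by rewrite normr0 ler01 addr0 eqxx implybT.
Qed.

Lemma in_cell_trans v j b u : oddz (v 0 j) -> in_cell (step v j b) u -> in_cell v u.
Proof.
move=> oj /forallP nu; apply/forallP => i; have := nu i.
rewrite oddz_step // stepE; case: eqVneq => [->|_] /=; last by rewrite addr0.
by rewrite oj /= andbT => /andP[_ /eqP ->]; rewrite addrAC subrr add0r; case: b nu.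
Qed.

Lemma bdry_neq0 G v : bdry G v != 0 ->
  exists j b, oddz (v 0 j) /\ G (step v j b) != 0.
Proof.
move=> h; have [/existsP[j /andP[oj /existsP[b Gb]]]|] :=
  boolP [exists j, oddz (v 0 j) && [exists b, G (step v j b) != 0]].
  by exists j, b.
rewrite negb_exists => /forallP n; case/negP: h; apply/eqP/big1 => j oj.
apply/big1 => b _; have := n j; rewrite oj /= negb_exists => /forallP/(_ b).
by rewrite negbK => /eqP.
Qed.

Lemma mulb_neq0 (x y : bool) : x * y != 0 -> (x != 0) /\ (y != 0).
Proof. by case: x; case: y. Qed.

Lemma addb_neq0 (x y : bool) : x + y != 0 -> x != y.
Proof. by case: x; case: y. Qed.

Definition flips v e := exists p q, [/\ in_cell v p, in_cell v q & e p != e q].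

Lemma flips_step v j b e : oddz (v 0 j) -> flips (step v j b) e -> flips v e.
Proof.
by move=> oj [p [q [np nq epq]]]; exists p, q; split=> //; [exact: in_cell_trans oj np|exact: in_cell_trans oj nq].
Qed.

Lemma flagsum_flips es v : flagsum es v != 0 ->
  forall k, (k < size es)%N -> flips v (nth (fun=> false) es k).
Proof.
elim: es v => [|e es IH] v //= /bdry_neq0[j [b [oj /mulb_neq0[e1 e2]]]] [|k] /= kes.
  exists v, (step v j b); split; [exact: in_cell_refl|exact: in_cell_step|].
  exact: addb_neq0 e1.
exact: (flips_step oj (IH _ e2 _ _)).
Qed.

Lemma vflagsum_flips es eta es' v : vflagsum es eta es' v != 0 ->
  (exists2 p, in_cell v p & eta p) /\
  forall k, k != size es -> (k < (size es + size es').+1)%N ->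
    flips v (nth (fun=> false) (es ++ eta :: es') k).
Proof.
elim: es v => [|e es IH] v /=.
  move=> /mulb_neq0[ev h]; split; first by exists v; [exact: in_cell_refl|case: (eta v) ev].
  by case=> [|k] // _ ks; exact: (flagsum_flips h ks).
move=> /bdry_neq0[j [b [oj /mulb_neq0[e1 /IH[[p np ep] h]]]]]; split.
  by exists p => //; exact: (in_cell_trans oj np).
case=> [|k] /= kes ks; last exact: (flips_step oj (h _ _ _)).
exists v, (step v j b); split; [exact: in_cell_refl|exact: in_cell_step|].
exact: addb_neq0 e1.
Qed.

End Flags.

(** * Degree of a family of sign functions on a grid *)

Lemma sum_invol (T : finType) (f : T -> T) (G : T -> bool) :
  involutive f -> (forall x, f x != x) -> (forall x, G (f x) = G x) ->
  \sum_x G x = 0.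
Proof.
move=> fK fN Gf.
pose H x y : bool := if y == f x then G x else 0.
rewrite -[RHS](@sum_sym_char2 _ _ H [rel x y | y == f x] addbb) /=.
- by apply: eq_bigr => x _; rewrite big_pred1_eq /H eqxx.
- by move=> x y; rewrite /= -(inj_eq (inv_inj fK)) fK eq_sym.
- by move=> x; rewrite /= eq_sym (negPf (fN x)).
- move=> x y; rewrite /H.
  have -> : (x == f y) = (y == f x) by rewrite -(inj_eq (inv_inj fK)) fK eq_sym.
  by case: eqP => // ->; rewrite Gf.
Qed.

Section Degree.
Variables (K n : nat).
Local Notation point := 'rV[int]_K.
Implicit Types (t : 'rV['I_(n.*2)]_K) (v u : point).
Implicit Types (es : seq (point -> bool)) (A : {set 'I_K}).

Definition cell t : point := \row_i ((t 0 i : nat).*2.+1%:Z - n.*2%:Z).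

(** If the signs are those of the components of a map from a cube to R^K without
    zeros on the boundary, this is the degree mod 2 of the map. *)
Definition degree es : bool := \sum_t flagsum es (cell t).

Lemma oddz_cell t i : oddz (cell t 0 i).
Proof. by rewrite mxE /oddz; lia. Qed.

Lemma cell_le t i : `|cell t 0 i| <= n.*2%:Z.
Proof. by rewrite mxE; have := ltn_ord (t 0 i); lia. Qed.

Lemma cell_lt t i : `|cell t 0 i| < n.*2%:Z.
Proof. by rewrite mxE; have := ltn_ord (t 0 i); lia. Qed.

Definition flip A v : point := \row_i (if i \in A then - v 0 i else v 0 i).

Lemma flipE A v i : flip A v 0 i = if i \in A then - v 0 i else v 0 i.
Proof. by rewrite mxE. Qed.

Lemma step_flip A v j b :
  step (flip A v) j b = flip A (step v j (b (+) (j \in A))).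
Proof.
apply/rowP => i; rewrite !(mxE, stepE); case: eqVneq => [->|_] /=.
  by case: (j \in A); case: b; rewrite ?opprD ?opprK.
by rewrite !addr0.
Qed.

Definition on_side (j : 'I_K) v : Prop :=
  `|v 0 j| = n.*2%:Z /\ forall i, `|v 0 i| <= n.*2%:Z.

Lemma even_side v : forall i, `|v 0 i| = n.*2%:Z -> ~~ oddz (v 0 i).
Proof. by move=> i; rewrite /oddz; lia. Qed.

Lemma step_side j v i b : on_side j v -> oddz (v 0 i) -> on_side j (step v i b).
Proof.
move=> [vj vle] oi; split=> [|k].
  rewrite step_neq //; apply: contraTneq oi => <-; exact: even_side.
rewrite stepE; case: eqVneq => [->|_]; last by rewrite addr0.
by move: (vle i) oi; rewrite /oddz; case: b; lia.
Qed.

Lemma flip_side A j v : on_side j v -> on_side j (flip A v).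
Proof.
by move=> [vj vle]; split=> [|i]; rewrite flipE; case: ifP; rewrite ?normrN.
Qed.

Definition shift_ord (b : bool) (i : 'I_(n.*2)) : 'I_(n.*2) :=
  insubd i (if b then i.+1 else i.-1).

(** The other cube that has the facet [(t, j, b)], and this facet; when the facet
    is on the boundary of the grid, its image under the symmetry [fl j]. *)
Definition mirror (fl : 'I_K -> {set 'I_K}) (x : 'rV['I_(n.*2)]_K * ('I_K * bool)) :=
  let: (t, (j, b)) := x in
  (if (if b then (t 0 j).+1 == n.*2 else t 0 j == 0%N :> nat)
   then \row_i (if i \in fl j then rev_ord (t 0 i) else t 0 i)
   else \row_i (if i == j then shift_ord b (t 0 i) else t 0 i), (j, ~~ b)).

Lemma mirrorK (fl : 'I_K -> {set 'I_K}) : (forall j, j \in fl j) -> involutive (mirror fl).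
Proof.
move=> jfl [t [j b]]; rewrite /mirror negbK.
have tj := ltn_ord (t 0 j).
case: (boolP (if b then _ else _)) => h; rewrite !mxE ?jfl ?eqxx /=.
  rewrite (_ : (if ~~ b then _ else _) = true); last by case: b h => /=; lia.
  congr (_, _); apply/rowP => i; rewrite !mxE.
  by case: (i \in fl j) => //; rewrite rev_ordK.
rewrite (_ : (if ~~ b then _ else _) = false); last first.
  by rewrite /shift_ord val_insubd; case: b h => /=; case: ifP; lia.
congr (_, _); apply/rowP => i; rewrite !mxE.
case: eqVneq => [->|//]; apply: val_inj.
by rewrite /shift_ord !val_insubd; case: b h => /= h; rewrite ?val_insubd; do ?case: ifP; lia.
Qed.

(** Facets inside the grid are counted twice, so that only the boundary of the
    grid contributes; there the symmetry of [G] pairs the facets off. *)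
Lemma box_bdry0 (G : point -> bool) (fl : 'I_K -> {set 'I_K}) :
  (forall j, j \in fl j) ->
  (forall j u, on_side j u -> G (flip (fl j) u) = G u) ->
  \sum_t bdry G (cell t) = 0.
Proof.
move=> jfl Gfl.
transitivity (\sum_(x : 'rV['I_(n.*2)]_K * ('I_K * bool))
    G (step (cell x.1) x.2.1 x.2.2)).
  under eq_bigr => t _.
    rewrite /bdry (eq_bigl xpredT) => [|j]; last by rewrite oddz_cell.
    rewrite pair_big; over.
  by rewrite pair_big.
apply: (sum_invol (mirrorK jfl)) => [[t [j b]]|[t [j b]]].
  by apply/eqP => -[_] /eqP; case: b.
rewrite /mirror /=; have tj := ltn_ord (t 0 j).
case: ifPn => h.
  rewrite -[RHS](Gfl j).
    congr G; apply/rowP => i; rewrite !(mxE, stepE).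
    case: eqVneq => [->|ij]; first by rewrite jfl /=; case: b h => /=; lia.
    rewrite !addr0; case: ifP => // _ /=; have := ltn_ord (t 0 i).
    by move: (nat_of_ord (t 0 i)) => x; lia.
  split=> [|i]; rewrite stepE !mxE; first by rewrite eqxx; case: b h; lia.
  case: eqVneq => [->|_]; first by case: b h; lia.
  by have := ltn_ord (t 0 i); move: (nat_of_ord (t 0 i)) => x; lia.
congr G; apply/rowP => i; rewrite !(mxE, stepE).
case: eqVneq => [->|//].
rewrite /shift_ord val_insubd; move: (nat_of_ord (t 0 j)) tj h => x xn.
by case: (b : bool) => /=; case: ifP; lia.
Qed.

(** On [Q] the sign [e] is even or odd under the symmetry [A], according to [c]. *)
Definition par A (Q : point -> Prop) e c :=
  forall u, Q u -> e (flip A u) = e u + c :> bool.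

Lemma flip_bdry A G1 G2 v (Q : point -> Prop) :
  (forall u i b, Q u -> oddz (u 0 i) -> Q (step u i b)) ->
  (forall u, Q u -> G1 (flip A u) = G2 u) -> Q v -> bdry G1 (flip A v) = bdry G2 v.
Proof.
move=> Qs Gf Qv; apply: eq_big => [j|j].
  by rewrite flipE; case: ifP => // _; rewrite /oddz abszN.
rewrite flipE => oj; have {}oj : oddz (v 0 j).
  by move: oj; case: ifP => // _; rewrite /oddz abszN.
have E b : G1 (step (flip A v) j b) = G2 (step v j (b (+) (j \in A))).
  by rewrite step_flip Gf //; exact: Qs.
by rewrite !big_bool !E; case: (j \in A) => //; exact: addrC.
Qed.

Lemma flagsum_flip A es v (Q : point -> Prop) :
  (forall u i b, Q u -> oddz (u 0 i) -> Q (step u i b)) ->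
  (forall k, (k < size es)%N -> exists c, par A Q (nth (fun=> false) es k) c) ->
  Q v -> flagsum es (flip A v) = flagsum es v.
Proof.
move=> Qs; elim: es v => [//|e es IH] v h Qv.
have [c ec] : exists c, par A Q e c := h 0%N erefl.
apply: (@flip_bdry A (fun u => (e (flip A v) + e u) * flagsum es u)
  (fun u => (e v + e u) * flagsum es u) v Q) => // u Qu.
rewrite (IH u) // => [|k ks]; last exact: (h k.+1).
by rewrite (ec u) // (ec v) //; case: (e v); case: (e u); case: c {ec}.
Qed.

Lemma vflagsum_flip A es eta es' v (Q : point -> Prop) :
  (forall u i b, Q u -> oddz (u 0 i) -> Q (step u i b)) ->
  (forall k, (k < size es)%N -> exists c, par A Q (nth (fun=> false) es k) c) ->
  (forall k, (k < size es')%N -> exists c, par A Q (nth (fun=> false) es' k) c) ->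
  par A Q eta false ->
  Q v -> vflagsum es eta es' (flip A v) = vflagsum es eta es' v.
Proof.
move=> Qs + h' etaA; elim: es v => [|e es IH] v h Qv.
  rewrite [LHS](_ : _ = eta (flip A v) * flagsum es' (flip A v)) //.
  by rewrite etaA // (flagsum_flip Qs h' Qv) addr0.
have [c ec] : exists c, par A Q e c := h 0%N erefl.
apply: (@flip_bdry A (fun u => (e (flip A v) + e u) * vflagsum es eta es' u)
  (fun u => (e v + e u) * vflagsum es eta es' u) v Q) => // u Qu.
rewrite (IH u) // => [|k ks]; last exact: (h k.+1).
by rewrite (ec u) // (ec v) //; case: (e v); case: (e u); case: c {ec}.
Qed.

(** The negation says that [e] and [e'] are constant and equal on [v]. *)
Definition touched v (e e' : point -> bool) :=
  [\/ flips v e, flips v e' | exists2 p, in_cell v p & e p != e' p].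

Local Notation nthf := (nth (fun=> false)).

(** The combinatorial form of the invariance of the degree under a linear
    homotopy: replacing the functions one at a time changes the degree by the sum
    of a coboundary, so by a contribution of the boundary of the grid. It
    vanishes on a side where some pair of corresponding functions has a common
    constant sign, and cancels on opposite sides where the functions are even or
    odd. *)
Lemma degree_homotopy (fl : 'I_K -> {set 'I_K}) es es' :
  (forall j, j \in fl j) -> size es = size es' ->
  (forall j,
    (forall k, (k < size es)%N -> exists c,
       par (fl j) (on_side j) (nthf es k) c /\
       par (fl j) (on_side j) (nthf es' k) c) \/
    (forall u, on_side j u ->
       exists2 k, (k < size es)%N & ~ touched u (nthf es k) (nthf es' k))) ->
  degree es = degree es'.
Proof.
move=> jfl ss H; pose mix i := take i es' ++ drop i es.
suff mixS i : (i < size es)%N -> degree (mix i) = degree (mix i.+1).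
  have E i : (i <= size es)%N -> degree (mix 0) = degree (mix i).
    elim: i => [//|i IH ilt]; exact: etrans (IH (ltnW ilt)) (mixS i ilt).
  have := E _ (leqnn (size es)).
  by rewrite /mix take0 drop0 drop_size cats0 ss take_size.
move=> ilt; have ilt' : (i < size es')%N by rewrite -ss.
pose es1 := take i es'; pose es2 := drop i.+1 es.
pose e := nthf es i; pose e' := nthf es' i.
have -> : mix i = es1 ++ e :: es2 by rewrite /mix (drop_nth (fun=> false)).
have -> : mix i.+1 = es1 ++ e' :: es2.
  by rewrite /mix (take_nth (fun=> false)) // cat_rcons.
suff : degree (es1 ++ (fun u => e u + e' u) :: es2) = 0.
  rewrite /degree; under eq_bigr do rewrite flagsumD.
  by rewrite big_split => /eqP; rewrite addr_eq0 => /eqP ->; case: (\sum_t _).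
rewrite /degree; under eq_bigr do rewrite flagsum_cat.
have size1 : size es1 = i by rewrite size_take ilt'.
have nth1 k : (k < i)%N -> nthf es1 k = nthf es' k by move=> ki; rewrite nth_take.
have nth2 k : nthf es2 k = nthf es (i.+1 + k) by rewrite nth_drop.
apply: (box_bdry0 jfl) => j u uj.
have [Hp|Hz] := H j.
  apply: (@vflagsum_flip _ _ _ _ _ (on_side j)) => //.
  - by move=> w k b; exact: step_side.
  - move=> k; rewrite size1 => ki; have [|c [_ pc]] := Hp k.
      exact: ltn_trans ilt.
    by exists c; rewrite nth1.
  - move=> k; rewrite size_drop => ki; have [|c [pc _]] := Hp (i.+1 + k)%N.
      by rewrite -ltn_subRL.
    by exists c; rewrite nth2.
  - move=> w wj; have [c [pc pc']] := Hp i ilt.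
    by rewrite /e /e' pc // pc' //; case: (nthf es i w); case: (nthf es' i w); case: c {pc pc'}.
suff E w : on_side j w -> vflagsum es1 (fun u => e u + e' u) es2 w = 0.
  by rewrite !E //; exact: flip_side.
move=> wj; apply/eqP; apply/negPn/negP => h.
have [[p np ep] fp] := vflagsum_flips h.
have [k ks []] := Hz _ wj.
have [ki|ik] := eqVneq k i.
  rewrite ki; apply: Or33; exists p => //.
  by apply: addb_neq0; move: ep; case: (_ + _).
have := fp k; rewrite size1 => /(_ ik).
have -> : (i + size es2).+1 = size es by rewrite size_drop -addSn subnKC.
move=> /(_ ks); rewrite nth_cat size1.
have [ki|ki] := ltnP k i; first by rewrite nth1 // => ?; exact: Or32.
have -> : (k - i = (k - i.+1).+1)%N by lia.
rewrite /= nth2 subnKC; first by move=> ?; exact: Or31.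
by rewrite ltn_neqAle eq_sym ik.
Qed.

End Degree.

Lemma addbbR (x : bool) : x + x = 0. Proof. exact: addbb. Qed.

Lemma bdry_single K (G : 'rV[int]_K -> bool) (v : 'rV[int]_K) j0 : oddz (v 0 j0) ->
  (forall j b, oddz (v 0 j) -> j != j0 -> G (step v j b) = 0) ->
  bdry G v = \sum_b G (step v j0 b).
Proof.
move=> oj0 Gj; rewrite /bdry (bigD1 j0) //.
rewrite -[RHS]addr0; congr (_ + _).
by apply: big1 => j /andP[oj jj0]; apply: big1 => b _; rewrite Gj.
Qed.

(** A cell of a smaller grid has the same flags in a larger grid in which the
    other coordinates are even, that is fixed. *)
Lemma flagsum_embed (K1 K : nat) (h : 'rV[int]_K1 -> 'rV[int]_K)
    (s : 'I_K1 -> 'I_K) es v :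
  injective s ->
  (forall v j, oddz (h v 0 (s j)) = oddz (v 0 j)) ->
  (forall v j, oddz (h v 0 j) -> exists i, j = s i) ->
  (forall v j b, h (step v j b) = step (h v) (s j) b) ->
  flagsum es (h v) = flagsum [seq e \o h | e <- es] v.
Proof.
move=> sI hs hN hst; elim: es v => [//|e es IH] v /=; rewrite /bdry.
rewrite (eq_bigl (mem (s @: [set i | oddz (v 0 i)]))) => [|j].
  rewrite big_imset => [|i i' _ _]; last exact: sI.
  apply: eq_big => [i|i _]; first by rewrite inE.
  by apply: eq_bigr => b _; rewrite -IH hst.
apply/idP/imsetP => [jo|[i]]; last by rewrite inE => oi ->; rewrite hs.
by have [i ji] := hN _ _ jo; exists i => //; rewrite inE -hs -ji.
Qed.

Lemma flagsum_frozenl K0 K1 (w : 'rV[int]_K0) es (v : 'rV[int]_K1) :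
  (forall i, ~~ oddz (w 0 i)) ->
  flagsum es (row_mx w v) = flagsum [seq e \o row_mx w | e <- es] v.
Proof.
move=> we; apply: (flagsum_embed (s := @rshift K0 K1)).
- exact: rshift_inj.
- by move=> u j; rewrite row_mxEr.
- move=> u j; case: (split_ordP j) => i ->; last by exists i.
  by rewrite row_mxEl (negPf (we i)).
- move=> u j b; apply/rowP => i; case: (split_ordP i) => k ->.
    by rewrite stepE !row_mxEl eq_lrshift addr0.
  by rewrite stepE !row_mxEr stepE eq_rshift.
Qed.

Lemma flagsum_frozenr K0 K1 (w : 'rV[int]_K1) es (v : 'rV[int]_K0) :
  (forall i, ~~ oddz (w 0 i)) ->
  flagsum es (row_mx v w) = flagsum [seq e \o (row_mx^~ w) | e <- es] v.
Proof.
move=> we; apply: (flagsum_embed (h := row_mx^~ w) (s := @lshift K0 K1)).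
- exact: lshift_inj.
- by move=> u j; rewrite row_mxEl.
- move=> u j; case: (split_ordP j) => i ->; first by exists i.
  by rewrite row_mxEr (negPf (we i)).
- move=> u j b; apply/rowP => i; case: (split_ordP i) => k ->.
    by rewrite stepE !row_mxEl stepE eq_lshift.
  by rewrite stepE !row_mxEr eq_rlshift addr0.
Qed.

Lemma sum_row_mx (T : finType) (K1 K2 : nat) (F : 'rV[T]_(K1 + K2) -> bool) :
  \sum_t F t = \sum_(t2 : 'rV[T]_K2) \sum_(t1 : 'rV[T]_K1) F (row_mx t1 t2).
Proof.
rewrite pair_big /= (reindex (fun p : 'rV[T]_K2 * 'rV[T]_K1 => row_mx p.2 p.1)) //.
exists (fun t : 'rV[T]_(K1 + K2) => (rsubmx t, lsubmx t)) => [[t2 t1]|t] _ /=.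
  by rewrite row_mxKl row_mxKr.
exact: hsubmxK.
Qed.

Lemma cell_row_mx n K1 K2 (t1 : 'rV['I_(n.*2)]_K1) (t2 : 'rV['I_(n.*2)]_K2) :
  cell (row_mx t1 t2) = row_mx (cell t1) (cell t2).
Proof.
apply/rowP => i; rewrite mxE; case: (split_ordP i) => k ->.
  by rewrite !row_mxEl mxE.
by rewrite !row_mxEr mxE.
Qed.

Lemma sum_rV1 (T : finType) (F : 'rV[T]_1 -> bool) :
  \sum_t F t = \sum_a F (\row_i a).
Proof.
rewrite (reindex (fun a : T => \row_(i < 1) a)) //.
exists (fun t : 'rV[T]_1 => t 0 0) => [a _|t _]; first by rewrite mxE.
by apply/rowP => i; rewrite mxE ord1.
Qed.

Lemma sum_delta (T : finType) (i0 : T) (x : bool) :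
  \sum_a (a == i0) * x = x.
Proof.
rewrite (bigD1 i0) // eqxx mul1r big1 => [|a /negPf ->]; last exact: mul0r.
exact: addr0.
Qed.

(** By induction on the dimension: only the cubes next to the hyperplane where
    the first coordinate vanishes contribute, and one of the two does, depending
    on the sign that is given to zero. *)
Lemma degree_coord K n (e : 'I_K -> 'rV[int]_K -> bool) : (0 < n)%N ->
  (forall j (v : 'rV[int]_K), v 0 j != 0 -> e j v = (v 0 j < 0)) ->
  degree n [seq e j | j <- enum 'I_K] = 1.
Proof.
move=> n0; elim: K e => [|K IH] e eE.
  have -> : enum 'I_0 = [::] by apply/eqP; rewrite -size_eq0 size_enum_ord.
  by rewrite /degree sumr_const card_mx.
rewrite enum_ordSl /= -map_comp.
pose f j (v : 'rV[int]_K) := e (lift ord0 j) (row_mx (0 : 'rV_1) v).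
rewrite -(IH f) => [|j v vj]; last first.
  have liftE : lift ord0 j = rshift 1 j by apply: val_inj.
  have rE : (row_mx (0 : 'rV[int]_1) v : 'rV[int]_K.+1) 0 (rshift 1 j) = v 0 j.
    exact: row_mxEr.
  by rewrite /f liftE eE rE.
rewrite /degree (@sum_row_mx _ 1); apply: eq_bigr => t2 _.
have -> : [seq f j | j <- enum 'I_K] = [seq g \o row_mx (0 : 'rV[int]_1)
    | g <- [seq (e \o lift ord0) j | j <- enum 'I_K]].
  by rewrite -[RHS]map_comp; apply: eq_map => j.
rewrite -flagsum_frozenl => [|i]; last by rewrite mxE.
set es := map _ _; rewrite sum_rV1.
pose z : 'rV[int]_(1 + K) := row_mx 0 (cell t2).
pose x (c : int) : 'rV[int]_(1 + K) := row_mx (\row_i c) (cell t2).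
pose i0 : 'I_(1 + K) := lshift K 0.
have i0E : ord0 = i0 :> 'I_K.+1 by apply: val_inj.
rewrite i0E; have xE c : x c 0 i0 = c by rewrite row_mxEl mxE.
have stx c b : step (x c) i0 b = x (c + if b then 1 else -1).
  apply/rowP => i; rewrite stepE; case: (split_ordP i) => k -> {i}.
    by rewrite !row_mxEl !mxE eq_lshift ord1.
  by rewrite !row_mxEr eq_rlshift addr0.
have e0 c : c != 0 -> e i0 (x c) = (c < 0) by move=> c0; rewrite eE xE.
have x0 : x 0 = z by congr row_mx; apply/rowP => i; rewrite !mxE.
have fE c : oddz c -> flagsum (e i0 :: es) (x c) =
    (c == -1) * ((1 + e i0 z) * flagsum es z) + (c == 1) * (e i0 z * flagsum es z).
  move=> oc; have c0 : c != 0 by apply: contraTneq oc => ->.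
  transitivity (\sum_b (e i0 (x c) + e i0 (x (c + if b then 1 else -1)))
      * flagsum es (x (c + if b then 1 else -1))).
    rewrite -[LHS]/(bdry (fun u => (e i0 (x c) + e i0 u) * flagsum es u) (x c)).
    rewrite (bdry_single (j0 := i0)) ?xE // => [|j b _ j0].
      by apply: eq_bigr => b _; rewrite stx.
    have j0s : i0 != j by rewrite eq_sym.
    by rewrite !eE ?step_neq ?xE // addbbR mul0r.
  rewrite big_bool e0 //.
  have [->|cN1] := eqVneq c (-1); first by rewrite subrr x0 e0 //; case: (e i0 z); case: (flagsum es z).
  have [->|c1] := eqVneq c 1; first by rewrite subrr x0 e0 //; case: (e i0 z); case: (flagsum es z).
  rewrite !e0 ?addr_eq0 ?opprK // (_ : (c + 1 < 0) = (c < 0)); last by lia.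
  by rewrite (_ : (c - 1 < 0) = (c < 0)) ?addbbR //; lia.
pose c (a : 'I_(n.*2)) : int := (a.*2.+1%:Z - n.*2%:Z).
transitivity (\sum_(a < n.*2) flagsum (e i0 :: es) (x (c a))).
  apply: eq_bigr => a _; suff xa : cell (row_mx (\row_i a) t2) = x (c a).
    by congr flagsum; exact: xa.
  by rewrite cell_row_mx; congr row_mx; apply/rowP => i; rewrite !mxE.
have n1 : (n.-1 < n.*2)%N by lia.
have n2 : (n < n.*2)%N by lia.
have cN1 a : (c a == -1) = (a == Ordinal n1).
  by rewrite /c -(inj_eq val_inj) /=; apply/eqP/eqP; lia.
have c1 a : (c a == 1) = (a == Ordinal n2).
  by rewrite /c -(inj_eq val_inj) /=; apply/eqP/eqP; lia.
under eq_bigr => a _.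
  rewrite fE ?cN1 ?c1; last by rewrite /oddz /c; lia.
  over.
rewrite big_split; set s1 := bigop _ _ _; set s2 := bigop _ _ _.
have -> : s1 = (1 + e i0 z) * flagsum es z by exact: sum_delta.
have -> : s2 = e i0 z * flagsum es z by exact: sum_delta.
by case: (e i0 z); case: (flagsum es z).
Qed.

Section Fibre.
Variables (n K1 K2 : nat) (es : seq ('rV[int]_(K1 + K2) -> bool)).
Implicit Types (w : 'rV[int]_K2) (ew : seq ('rV[int]_K2 -> bool)).

(** The sum over the cubes of the first factor, with the cell [w] of the second
    factor fixed; signs on the second factor come first. *)
Definition fibre_sum ew w : bool :=
  \sum_(t : 'rV['I_(n.*2)]_K1)
    flagsum ([seq e \o rsubmx | e <- ew] ++ es) (row_mx (cell t) w).

Lemma fibre_sum_cons e ew w : fibre_sum (e :: ew) w =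
  bdry (fun u => (e w + e u) * fibre_sum ew u) w.
Proof.
pose G (t : 'rV['I_(n.*2)]_K1) u := (e w + e u) *
  flagsum ([seq e \o rsubmx | e <- ew] ++ es) (row_mx (cell t) u).
transitivity (\sum_(t : 'rV['I_(n.*2)]_K1) bdry (G t) w).
  apply: eq_bigr => t _.
  rewrite -[LHS]/(bdry (fun u => (e (rsubmx (row_mx (cell t) w)) + e (rsubmx u)) *
    flagsum ([seq e \o rsubmx | e <- ew] ++ es) u) (row_mx (cell t) w)).
  rewrite /bdry big_split_ord -[RHS]add0r; congr (_ + _).
    apply: big1 => j _; apply: big1 => b _; rewrite row_mxKr.
    have -> : rsubmx (step (row_mx (cell t) w) (lshift K2 j) b) = w.
      by apply/rowP => i; rewrite mxE stepE row_mxEr eq_rlshift addr0.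
    by rewrite addbbR mul0r.
  apply: eq_big => [j|j _]; first by rewrite row_mxEr.
  apply: eq_bigr => b _.
  have -> : step (row_mx (cell t) w) (rshift K1 j) b = row_mx (cell t) (step w j b).
    apply/rowP => i; rewrite stepE; case: (split_ordP i) => k ->.
      by rewrite !row_mxEl eq_lrshift addr0.
    by rewrite !row_mxEr stepE eq_rshift.
  by rewrite /G /= !row_mxKr.
rewrite /bdry exchange_big; apply: eq_bigr => j _.
rewrite exchange_big; apply: eq_bigr => b _.
by rewrite -mulr_sumr.
Qed.

Lemma fibre_sum_neq0 ew w : fibre_sum ew w != 0 ->
    #|[pred j | oddz (w 0 j)]| = size ew ->
  exists w1, [/\ in_cell w w1, forall j, ~~ oddz (w1 0 j),
    forall k, (k < size ew)%N -> flips w (nth (fun=> false) ew k)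
    & fibre_sum [::] w1 != 0].
Proof.
elim: ew w => [|e ew IH] w.
  move=> h /card0_eq w0; exists w; split=> //; first exact: in_cell_refl.
  by move=> j; have := w0 j; rewrite !inE => ->.
rewrite fibre_sum_cons => /bdry_neq0[j [b [oj /mulb_neq0[e1 h]]]] cw.
have [|w1 [nw ew1 fw h1]] := IH _ h.
  rewrite (cardD1 j) inE oj in cw; case: cw => <-.
  by apply: eq_card => i; rewrite !inE oddz_step.
exists w1; split=> //; first exact: in_cell_trans oj nw.
case=> [|k] /= ks; last exact: flips_step oj (fw _ ks).
exists w, (step w j b); split; [exact: in_cell_refl|exact: in_cell_step|].
exact: addb_neq0 e1.
Qed.

(** Localization of the degree: it comes from cubes [w0] of the second factor in
    which all the signs [ew], which depend on this factor only, change. Descending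
    from [w0] to one of its vertices [w], one uses up a sign in each dimension;
    what is left is the degree of the other signs on the fibre over [w]. *)
Lemma degree_fibre ew : size ew = K2 ->
  degree n ([seq e \o rsubmx | e <- ew] ++ es) != 0 ->
  exists w0 w : 'rV[int]_K2, [/\ forall j, `|w 0 j| <= n.*2%:Z, in_cell w0 w,
    forall j, ~~ oddz (w 0 j),
    forall k, (k < size ew)%N -> flips w0 (nth (fun=> false) ew k)
    & degree n [seq e \o (row_mx^~ w) | e <- es] != 0].
Proof.
move=> sew h.
have [t ht] : exists t : 'rV['I_(n.*2)]_K2, fibre_sum ew (cell t) != 0.
  apply/existsP; apply: contraNT h; rewrite negb_exists => /forallP h.
  rewrite /degree sum_row_mx; apply/eqP/big1 => t _.
  have := h t; rewrite negbK => /eqP ht; rewrite -[RHS]ht.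
  by apply: eq_bigr => t1 _; rewrite cell_row_mx.
have [|w [nw we fw h1]] := fibre_sum_neq0 ht.
  by rewrite sew -[RHS]card_ord; apply: eq_card => j; rewrite !inE oddz_cell.
exists (cell t), w; split=> //.
  move=> j; have /forallP/(_ j)/andP[h2 _] := nw.
  by have := cell_lt t j; lia.
rewrite -(_ : fibre_sum [::] w = degree n _) //.
by rewrite /fibre_sum /degree; apply: eq_bigr => t1 _; exact: flagsum_frozenr.
Qed.

End Fibre.

From mathcomp Require Import all_classical all_reals all_analysis.
From mathcomp Require Import complex generic_quotient spectral mxtens.

Import numFieldNormedType.Exports.

Local Open Scope classical_set_scope.
Local Open Scope sesquilinear_scope.
Local Open Scope ring_scope.

(** * From sign functions to continuous functions *)

(** Points [b k] and [c k] that get close to [a k] have the same limit along a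
    subsequence, and closed conditions on the pair are preserved. *)
Lemma cluster_closed (R : realType) (V : pseudoMetricType R) (D : set V)
    (a : nat -> V) : compact D -> (forall k, D (a k)) ->
  exists2 p, D p & forall (g : V * V -> R) (b c : nat -> V), continuous g ->
    (forall k, ball (a k) k.+1%:R^-1 (b k)) ->
    (forall k, ball (a k) k.+1%:R^-1 (c k)) ->
    (forall k, g (b k, c k) <= 0) -> g (p, p) <= 0.
Proof.
move=> cD Da.
have [|p [Dp clp]] := cD (a @ \oo) _; first by exists 0%N => // k _; exact: Da.
exists p => // g b c gc ab ac g0; rewrite leNgt; apply/negP => gp.
have : nbhs (p, p) [set q | 0 < g q].
  apply: (gc (p, p) [set x | 0 < x]).
  by apply: open_nbhs_nbhs; split=> //; exact: open_gt.
move=> /nbhs_ballP[e /= e0 eg].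
have e2 : 0 < e / 2 by rewrite divr_gt0.
have [N _ Ne] := near_infty_natSinv_lt (PosNum e2).
have aN : (a @ \oo) [set x | exists2 k, (N <= k)%N & x = a k].
  by exists N => // k Nk; exists k.
have [_ [[k Nk ->] pk]] := clp _ _ aN (nbhsx_ballx p _ e2).
have bp x : ball (a k) k.+1%:R^-1 x -> ball p e x.
  move=> xk; rewrite (splitr e); apply: ball_triangle pk _.
  exact: le_ball (ltW (Ne k Nk)) _ xk.
have := g0 k; rewrite leNgt => /negP; apply; apply: eg.
by split; apply: bp.
Qed.

Section Signs.
Variable (R : realType).

(** True is negative; [tie] is the sign of zero. *)
Definition sgnb (x : R) (tie : bool) := if x == 0 then tie else x < 0.

Lemma sgnb_le0 x t : sgnb x t -> x <= 0.
Proof. by rewrite /sgnb; case: eqP => [->//|_ /ltW]. Qed.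

Lemma sgnb_ge0 x t : ~~ sgnb x t -> 0 <= x.
Proof. by rewrite /sgnb; case: eqP => [->//|_]; rewrite -leNgt. Qed.

Lemma sgnbN x t t' : t' = ~~ t -> sgnb (- x) t' = ~~ sgnb x t.
Proof.
rewrite /sgnb oppr_eq0 oppr_lt0 => ->; case: eqP => // /eqP x0.
by rewrite -leNgt lt_neqAle eq_sym x0.
Qed.

Definition scale (n K : nat) (v : 'rV[int]_K) : 'rV[R]_K :=
  \row_i ((v 0 i)%:~R / n.*2%:R).

Definition cube K : set 'rV[R]_K := [set p | forall i, `|p 0 i| <= 1].

Lemma compact_cube K : compact (@cube K).
Proof.
have := @rV_compact R K (fun=> `[-1, 1]%classic) (fun=> @segment_compact _ _ _).
congr compact; apply/seteqP; split=> p /= pK i; have := pK i.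
  by rewrite in_itv /= ler_norml.
by rewrite in_itv /= ler_norml.
Qed.

Lemma scale_cube n K (v : 'rV[int]_K) : (0 < n)%N ->
  (forall i, `|v 0 i| <= n.*2%:Z) -> cube (scale n v).
Proof.
move=> n0 vn i; have n20 : 0 < n.*2%:R :> R by rewrite ltr0n double_gt0.
rewrite mxE normrM normfV [`|n.*2%:R|]gtr0_norm // ler_pdivrMr // mul1r.
by rewrite -intr_norm -[n.*2%:R]/(n.*2%:Z%:~R) ler_int.
Qed.

Lemma scale_in_cell n K k (u v : 'rV[int]_K) : (k < n)%N -> in_cell u v ->
  ball (scale n u) k.+1%:R^-1 (scale n v).
Proof.
move=> kn /forallP uv; split=> [|i j]; first by rewrite invr_gt0.
rewrite ord1 !mxE -ball_normE /ball_ /=.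
have /andP[uvj _] := uv j.
have n20 : 0 < n.*2%:R :> R by rewrite ltr0n; lia.
rewrite -mulrBl normrM normfV [`|n.*2%:R|]gtr0_norm // ltr_pdivrMr //.
apply: (@le_lt_trans _ _ 1).
  by rewrite -intrB -intr_norm -[1]/(1%:~R) ler_int distrC.
by rewrite mulrC ltr_pdivlMr ?ltr0n // mul1r ltr_nat; lia.
Qed.

Lemma scaleN n K (A : {set 'I_K}) v i :
  scale n (flip A v) 0 i = if i \in A then - scale n v 0 i else scale n v 0 i.
Proof. by rewrite !mxE; case: ifP => // _; rewrite rmorphN mulNr. Qed.

Section Blocks.
Variables (K : nat) (blk : 'I_K -> option nat).
Implicit Types v : 'rV[int]_K.

(** The side of the cube in direction [j] is glued to the opposite one: by the
    antipode of the block of [j], if [j] has one. *)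
Definition flip_set (j : 'I_K) : {set 'I_K} :=
  if blk j is Some i then [set q | blk q == Some i] else [set j].

(** A sign of zero that is odd under the antipode of the block [o]: the sign of
    some nonzero coordinate of the block, if there is one. *)
Definition tie (o : option nat) v : bool :=
  if o is Some i then
    if [pick q | (blk q == Some i) && (v 0 q != 0)] is Some q then v 0 q < 0
    else false
  else false.

Lemma flip_set_id j : j \in flip_set j.
Proof. by rewrite /flip_set; case E: (blk j) => [i|]; rewrite inE ?E. Qed.

Lemma tie_flip n i j v o : (0 < n)%N -> blk j = Some i -> on_side n j v ->
  tie o (flip (flip_set j) v) = tie o v (+) (o == Some i).
Proof.
move=> n0 bj [vj vn]; rewrite /tie; case: o => [i'|//].
rewrite (@eq_pick _ _ [pred q | (blk q == Some i') && (v 0 q != 0)]); last first.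
  move=> q; rewrite /= /flip mxE /flip_set bj inE.
  by case: (blk q == Some i); rewrite ?oppr_eq0.
case: pickP => [q /andP[/eqP bq vq]|/(_ j)].
  rewrite /flip mxE /flip_set bj inE bq; case: eqP => _; rewrite ?addbF //.
  by rewrite oppr_lt0 addbT -leNgt lt_neqAle eq_sym vq.
have [->|ne] := eqVneq i' i; last first.
  by move=> _; case: eqP => [[/eqP]|_]; rewrite ?(negPf ne) ?addbF.
by rewrite /= bj eqxx /= => /negbFE /eqP vj0; move: vj; rewrite vj0; lia.
Qed.

End Blocks.
End Signs.

Lemma nth_map_ord (A : Type) (x0 : A) T (F : 'I_T -> A) k (kT : (k < T)%N) :
  nth x0 [seq F t | t <- enum 'I_T] k = F (Ordinal kT).
Proof.
rewrite (nth_map (Ordinal kT)) ?size_enum_ord //; congr F.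
by apply: val_inj; rewrite /= nth_enum_ord.
Qed.

(** The dimension T of the target, that of the grid and the dimension of the
    space where the functions live may differ: on a slice of a grid, the
    functions depend on coordinates that are fixed there. [blk] gives the
    symmetry of each direction of the grid, [pr] the block whose antipode
    changes the sign of a component. *)
Section DegreeOfContinuous.
Variables (R : realType) (K L T : nat).
Variables (blk : 'I_K -> option nat) (pr : 'I_T -> option nat).
Variables (m : nat -> nat) (r : nat -> 'rV[int]_K -> 'rV[R]_L).
Variable D : set 'rV[R]_L.
Variable tie : nat -> option nat -> 'rV[int]_K -> bool.
Hypothesis cD : compact D.
Hypothesis rD : forall k (v : 'rV[int]_K), (forall i, `|v 0 i| <= (m k).*2%:Z) -> D (r k v).
Hypothesis r_near : forall k u v, in_cell u v -> ball (r k u) k.+1%:R^-1 (r k v).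
Hypothesis tie_flip : forall k j i v o, blk j = Some i -> on_side (m k) j v ->
  tie k o (flip (flip_set blk j) v) = tie k o v (+) (o == Some i).
Implicit Types (f g : 'rV[R]_L -> 'rV[R]_T) (h : 'rV[R]_L -> R).

Definition signs k f : seq ('rV[int]_K -> bool) :=
  [seq (fun v => sgnb (f (r k v) 0 t) (tie k (pr t) v)) | t <- enum 'I_T].

Definition flip_sym f := forall k j i v, blk j = Some i -> on_side (m k) j v ->
  forall t, f (r k (flip (flip_set blk j) v)) 0 t =
    if pr t == Some i then - f (r k v) 0 t else f (r k v) 0 t.

Lemma ball_invS (V : pseudoMetricType R) n k (a b : V) : (n <= k)%N ->
  ball a k.+1%:R^-1 b -> ball a n.+1%:R^-1 b.
Proof. by move=> nk; apply: le_ball; rewrite lef_pV2 ?posrE ?ltr0n ?ler_nat. Qed.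

Lemma touched_le0 k v (F G : 'rV[R]_L -> R) (t : 'rV[int]_K -> bool) :
  touched v (fun v => sgnb (F (r k v)) (t v)) (fun v => sgnb (G (r k v)) (t v)) ->
  exists b c, [/\ in_cell v b, in_cell v c & F (r k b) * G (r k c) <= 0].
Proof.
have sw (x y : bool) : x != y -> x /\ ~~ y \/ y /\ ~~ x by case: x; case: y; auto.
case=> [[p [q [np nq /sw]]]|[p [q [np nq /sw]]]|[p np /sw]].
- wlog [/sgnb_le0 Fp /sgnb_ge0 Fq] : p q np nq /
      sgnb (F (r k p)) (t p) /\ ~~ sgnb (F (r k q)) (t q).
    by move=> H []; [move=> ?; apply: (H p q) => //; left|move=> ?; apply: (H q p) => //; left].
  move=> _; have [G0|/ltW G0] := leP 0 (G (r k p)).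
    by exists p, p; split=> //; exact: mulr_le0_ge0.
  by exists q, p; split=> //; exact: mulr_ge0_le0.
- wlog [/sgnb_le0 Gp /sgnb_ge0 Gq] : p q np nq /
      sgnb (G (r k p)) (t p) /\ ~~ sgnb (G (r k q)) (t q).
    by move=> H []; [move=> ?; apply: (H p q) => //; left|move=> ?; apply: (H q p) => //; left].
  move=> _; have [F0|/ltW F0] := leP 0 (F (r k p)).
    by exists p, p; split=> //; exact: mulr_ge0_le0.
  by exists p, q; split=> //; exact: mulr_le0_ge0.
- case=> -[/sgnb_le0 h1 /sgnb_ge0 h2]; exists p, p; split=> //.
    exact: mulr_le0_ge0.
  exact: mulr_ge0_le0.
Qed.

Lemma signs_flip f k j i v (t : 'I_T) : flip_sym f -> blk j = Some i ->
  on_side (m k) j v ->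
  sgnb (f (r k (flip (flip_set blk j) v)) 0 t) (tie k (pr t) (flip (flip_set blk j) v))
  = sgnb (f (r k v) 0 t) (tie k (pr t) v) + (pr t == Some i).
Proof.
move=> fs bj vj; rewrite (fs _ _ _ _ bj vj) (tie_flip _ bj vj).
case: (pr t == Some i); last by rewrite addbF addr0.
by rewrite (@sgnbN _ _ (tie k (pr t) v)) ?addbT //; case: (sgnb _ _).
Qed.

Lemma pair_continuous f g (t : 'I_T) : continuous f -> continuous g ->
  continuous (fun q : 'rV[R]_L * 'rV[R]_L => f q.1 0 t * g q.2 0 t).
Proof.
move=> fc gc q; apply: cvgM.
  apply: (@continuous_comp _ _ _ (fun q => f q.1) (fun y : 'rV[R]_T => y 0 t)).
    by apply: continuous_comp; [exact: cvg_fst|exact: fc].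
  exact: coord_continuous.
apply: (@continuous_comp _ _ _ (fun q => g q.2) (fun y : 'rV[R]_T => y 0 t)).
  by apply: continuous_comp; [exact: cvg_snd|exact: gc].
exact: coord_continuous.
Qed.

Lemma fst_comp_continuous h : continuous h ->
  continuous (fun q : 'rV[R]_L * 'rV[R]_L => h q.1).
Proof. by move=> hc q; apply: continuous_comp; [exact: cvg_fst|exact: hc]. Qed.

(** On a grid where the degrees of [f] and [g] differ, [degree_homotopy] gives a
    boundary cell on which every component of [f] is touched by that of [g]; such
    cells have a limit point. There the segment from [f] to [g] may meet zero. *)
Lemma degree_neq f g h h' :
  continuous f -> continuous g -> continuous h -> continuous h' ->
  flip_sym f -> flip_sym g ->
  (forall k j v, blk j = None -> on_side (m k) j v -> h (r k v) <= 0) ->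
  (forall k (v : 'rV[int]_K), (forall i, `|v 0 i| <= (m k).*2%:Z) ->
    exists2 b, ball (r k v) k.+1%:R^-1 b & h' b <= 0) ->
  (forall n, exists2 k, (n <= k)%N & degree (m k) (signs k f) <> degree (m k) (signs k g)) ->
  exists p, [/\ D p, h p <= 0, h' p <= 0 & forall t, f p 0 t * g p 0 t <= 0].
Proof.
move=> fc gc hc h'c fs gs h0 h'0 dN.
have step n : exists kv : nat * 'rV[int]_K, let: (k, v) := kv in [/\ (n <= k)%N,
    (forall i, `|v 0 i| <= (m k).*2%:Z), h (r k v) <= 0 &
    forall t, touched v (fun v => sgnb (f (r k v) 0 t) (tie k (pr t) v))
                       (fun v => sgnb (g (r k v) 0 t) (tie k (pr t) v))].
  have [k nk dk] := dN n; apply: contrapT => nv; apply: dk.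
  apply: (@degree_homotopy _ _ (flip_set blk)).
  - exact: flip_set_id.
  - by rewrite !size_map.
  move=> j; case bj : (blk j) => [i|]; [left|right].
    move=> l; rewrite size_map size_enum_ord => lT; exists (pr (Ordinal lT) == Some i).
    by split=> u uj; rewrite !nth_map_ord; exact: signs_flip.
  move=> u uj; apply: contrapT => nl; apply: nv; exists (k, u); split=> //; first exact: uj.2.
    exact: h0 uj.
  move=> t.
  apply: contrapT => nt; apply: nl; exists (t : nat).
    by rewrite size_map size_enum_ord.
  by rewrite !(nth_map_ord _ _ (ltn_ord t)) (_ : Ordinal _ = t) //; exact: val_inj.
have [kv kvP] := choice step; pose a n := r (kv n).1 (kv n).2.
have vP n : [/\ (n <= (kv n).1)%N, (forall i, `|(kv n).2 0 i| <= (m (kv n).1).*2%:Z),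
    h (a n) <= 0 & forall t, touched (kv n).2
      (fun v => sgnb (f (r (kv n).1 v) 0 t) (tie (kv n).1 (pr t) v))
      (fun v => sgnb (g (r (kv n).1 v) 0 t) (tie (kv n).1 (pr t) v))].
  by have := kvP n; rewrite /a; case: (kv n).
have an n u : in_cell (kv n).2 u -> ball (a n) n.+1%:R^-1 (r (kv n).1 u).
  by move=> nu; have [nk _ _ _] := vP n; apply: ball_invS nk _; exact: r_near.
have aa n : ball (a n) n.+1%:R^-1 (a n) by apply: an; exact: in_cell_refl.
have [|p Dp clp] := cluster_closed cD (a := a).
  by move=> n; have [_ vn _ _] := vP n; exact: rD.
exists p; split=> //.
- apply: (clp (fun q => h q.1) a a) => //; first exact: fst_comp_continuous.
  by move=> n; have [] := vP n.
- have /choice[b bP] : forall n, exists b, ball (a n) n.+1%:R^-1 b /\ h' b <= 0.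
    move=> n; have [nk vn _ _] := vP n; have [b ab b0] := h'0 _ _ vn.
    by exists b; split=> //; exact: ball_invS ab.
  apply: (clp (fun q => h' q.1) b b).
  + exact: fst_comp_continuous.
  + by move=> n; exact: (bP n).1.
  + by move=> n; exact: (bP n).1.
  + by move=> n; exact: (bP n).2.
- move=> t.
  have /choice[b /choice[c bcP]] : forall n, exists b c, [/\ in_cell (kv n).2 b,
      in_cell (kv n).2 c & f (r (kv n).1 b) 0 t * g (r (kv n).1 c) 0 t <= 0].
    move=> n; have [_ _ _ tn] := vP n.
    exact: (touched_le0 (F := fun p => f p 0 t) (G := fun p => g p 0 t) (tn t)).
  apply: (clp (fun q => f q.1 0 t * g q.2 0 t) (fun n => r (kv n).1 (b n))
      (fun n => r (kv n).1 (c n))).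
  + exact: pair_continuous.
  + by move=> n; have [nb _ _] := bcP n; exact: an.
  + by move=> n; have [_ nc _] := bcP n; exact: an.
  + by move=> n; have [_ _] := bcP n.
Qed.

(** On a slice of a grid, [h'] prescribes the coordinates of the zero that are
    fixed there. *)
Lemma degree_zero f h' : continuous f -> continuous h' ->
  (forall k (v : 'rV[int]_K), (forall i, `|v 0 i| <= (m k).*2%:Z) ->
    exists2 b, ball (r k v) k.+1%:R^-1 b & h' b <= 0) ->
  (forall n, exists2 k, (n <= k)%N & degree (m k) (signs k f) <> 0) ->
  exists p, [/\ D p, h' p <= 0 & f p = 0].
Proof.
move=> fc h'c h'0 dN.
have step n : exists kv : nat * 'rV[int]_K, let: (k, v) := kv in [/\ (n <= k)%N,
    (forall i, `|v 0 i| <= (m k).*2%:Z) &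
    forall t, flips v (fun v => sgnb (f (r k v) 0 t) (tie k (pr t) v))].
  have [k nk dk] := dN n; apply: contrapT => nv; apply: dk; apply: big1 => t _.
  apply/eqP; apply/negPn/negP => /flagsum_flips; rewrite size_map size_enum_ord => h.
  apply: nv; exists (k, cell t); split=> //; first by move=> i; exact: cell_le.
  move=> l; have := h l (ltn_ord l).
  by rewrite (nth_map_ord _ _ (ltn_ord l)) (_ : Ordinal _ = l) //; exact: val_inj.
have [kv kvP] := choice step; pose a n := r (kv n).1 (kv n).2.
have vP n : [/\ (n <= (kv n).1)%N, (forall i, `|(kv n).2 0 i| <= (m (kv n).1).*2%:Z)
    & forall t, flips (kv n).2
      (fun v => sgnb (f (r (kv n).1 v) 0 t) (tie (kv n).1 (pr t) v))].
  by have := kvP n; rewrite /a; case: (kv n).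
have an n u : in_cell (kv n).2 u -> ball (a n) n.+1%:R^-1 (r (kv n).1 u).
  by move=> nu; have [nk _ _] := vP n; apply: ball_invS nk _; exact: r_near.
have [|p Dp clp] := cluster_closed cD (a := a).
  by move=> n; have [_ vn _] := vP n; exact: rD.
exists p; split=> //.
  have /choice[b bP] : forall n, exists b, ball (a n) n.+1%:R^-1 b /\ h' b <= 0.
    move=> n; have [nk vn _] := vP n; have [b ab b0] := h'0 _ _ vn.
    by exists b; split=> //; exact: ball_invS ab.
  apply: (clp (fun q => h' q.1) b b).
  + exact: fst_comp_continuous.
  + by move=> n; exact: (bP n).1.
  + by move=> n; exact: (bP n).1.
  + by move=> n; exact: (bP n).2.
have ftc t : continuous (fun q : 'rV[R]_L * 'rV[R]_L => f q.1 0 t).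
  apply: (fst_comp_continuous (h := fun p => f p 0 t)) => q.
  apply: (@continuous_comp _ _ _ f (fun y : 'rV[R]_T => y 0 t)); first exact: fc.
  exact: coord_continuous.
apply/rowP => t; rewrite mxE; apply/eqP; rewrite eq_le.
have /choice[b /choice[c bcP]] : forall n, exists b c, [/\ in_cell (kv n).2 b,
    in_cell (kv n).2 c, f (r (kv n).1 b) 0 t <= 0 & 0 <= f (r (kv n).1 c) 0 t].
  move=> n; have [_ _ /(_ t)[p1 [p2 [n1 n2]]]] := vP n.
  case E : (sgnb _ _) => /= ne.
    exists p1, p2; split=> //; first exact: sgnb_le0 E.
    by apply: (@sgnb_ge0 _ _ (tie (kv n).1 (pr t) p2)); case: sgnb ne.
  exists p2, p1; split=> //; last exact: (sgnb_ge0 (negbT E)).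
  by apply: (@sgnb_le0 _ _ (tie (kv n).1 (pr t) p2)); case: sgnb ne.
apply/andP; split.
  apply: (clp (fun q => f q.1 0 t) (fun n => r (kv n).1 (b n)) (fun n => r (kv n).1 (b n))) => //.
  + by move=> n; apply: an; have [] := bcP n.
  + by move=> n; apply: an; have [] := bcP n.
  + by move=> n; have [] := bcP n.
rewrite -oppr_le0.
apply: (clp (fun q => - f q.1 0 t) (fun n => r (kv n).1 (c n)) (fun n => r (kv n).1 (c n))).
+ by move=> q; apply: cvgN; exact: ftc.
+ by move=> n; apply: an; have [] := bcP n.
+ by move=> n; apply: an; have [] := bcP n.
+ by move=> n; rewrite oppr_le0; have [] := bcP n.
Qed.

End DegreeOfContinuous.

(** * A zero that cannot be removed *)

Lemma rV_continuous (R : numFieldType) (X : topologicalType) n (f : X -> 'rV[R]_n) :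
  (forall j, continuous (fun x => f x 0 j)) -> continuous f.
Proof.
move=> fc x A [P fxP sPA].
have : \forall t \near x, forall j, P 0 j (f t 0 j).
  by apply: filter_forall => j; exact: fc (fxP 0 j).
by apply: filterS => t Pt; apply: sPA => i j; rewrite ord1; exact: Pt.
Qed.

Lemma rV_coord_continuous (R : numFieldType) (X : topologicalType) n (f : X -> 'rV[R]_n) j :
  continuous f -> continuous (fun x => f x 0 j).
Proof.
move=> fc x; apply: (@continuous_comp _ _ _ f (fun y : 'rV[R]_n => y 0 j)).
  exact: fc.
exact: coord_continuous.
Qed.

Lemma pair_map_continuous (X Y Z : topologicalType) (f : X -> Y) (g : X -> Z) :
  continuous f -> continuous g -> continuous (fun x => (f x, g x)).
Proof.
move=> fc gc x A [[P Q] [/= fP gQ] PQA].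
have {}fP : nbhs x (f @^-1` P) := fc x P fP.
have {}gQ : nbhs x (g @^-1` Q) := gc x Q gQ.
by apply: filterS (filterI fP gQ) => t [Pt Qt]; exact: (PQA (f t, g t)).
Qed.

Lemma sub_map_continuous (K : numFieldType) (X : topologicalType) (V : normedModType K)
    (f g : X -> V) : continuous f -> continuous g -> continuous (fun x => f x - g x).
Proof. by move=> fc gc x; apply: cvgB; [exact: fc|exact: gc]. Qed.

Lemma add_map_continuous (K : numFieldType) (X : topologicalType) (V : normedModType K)
    (f g : X -> V) : continuous f -> continuous g -> continuous (fun x => f x + g x).
Proof. by move=> fc gc x; apply: cvgD; [exact: fc|exact: gc]. Qed.

Lemma mul_map_continuous (K : numFieldType) (X : topologicalType)
    (f g : X -> K) : continuous f -> continuous g -> continuous (fun x => f x * g x).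
Proof. by move=> fc gc x; apply: cvgM; [exact: fc|exact: gc]. Qed.

Lemma comp_map_continuous (X Y Z : topologicalType) (f : X -> Y) (g : Y -> Z) :
  continuous f -> continuous g -> continuous (fun x => g (f x)).
Proof. by move=> fc gc x; apply: continuous_comp; [exact: fc|exact: gc]. Qed.

Lemma map_enum_split (A : Type) m n (F : 'I_(m + n) -> A) :
  [seq F t | t <- enum 'I_(m + n)] =
  [seq F (lshift n i) | i <- enum 'I_m] ++ [seq F (rshift m i) | i <- enum 'I_n].
Proof.
have -> : enum 'I_(m + n) = [seq lshift n i | i <- enum 'I_m] ++ [seq rshift m i | i <- enum 'I_n].
  apply: (inj_map val_inj); rewrite val_enum_ord map_cat iotaD; congr (_ ++ _).
    by rewrite -map_comp -(val_enum_ord m); apply: eq_map.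
  rewrite -map_comp add0n -[in LHS](addn0 m) iotaDl -(val_enum_ord n) -map_comp.
  exact: eq_map.
by rewrite map_cat -!map_comp.
Qed.

Lemma prod_face (R : realType) n (p : 'rV[R]_n) : cube p ->
  \prod_j (1 - p 0 j ^+ 2) <= 0 -> exists j, `|p 0 j| = 1.
Proof.
move=> pc; apply: contraPP => np; apply/negP; rewrite -ltNge.
apply: prodr_gt0 => j _; rewrite subr_gt0 -[ltLHS]real_normK ?num_real //.
rewrite expr_lt1 // lt_neqAle pc andbT; apply/eqP => pj; apply: np.
by exists j.
Qed.

Lemma prod_face0 (R : realType) n (p : 'rV[R]_n) j : `|p 0 j| = 1 ->
  \prod_j (1 - p 0 j ^+ 2) = 0.
Proof.
move=> pj; rewrite (bigD1 j) //= -[p 0 j ^+ 2]real_normK ?num_real // pj.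
by rewrite expr1n subrr mul0r.
Qed.

Section Equivariance.
Variables (R : realType) (N : nat) (blk : 'I_N -> nat).

Definition antipode i (y : 'rV[R]_N) : 'rV[R]_N :=
  \row_q (if blk q == i then - y 0 q else y 0 q).

Definition block_bdry i (y : 'rV[R]_N) : Prop :=
  exists2 q, blk q = i & `|y 0 q| = 1.

Definition equivariant d (X : Type) (D : set X) (s : X * 'rV[R]_N -> 'rV[R]_N)
    (lam : X * 'rV[R]_N -> 'rV[R]_d) : Prop :=
  forall i x y, D x -> cube y -> block_bdry i y ->
    s (x, antipode i y) = antipode i (s (x, y)) /\
    lam (x, antipode i y) = lam (x, y).

End Equivariance.

(** On the cube with coordinates x, y and w of dimensions d, N and d, consider
    the map (F w, s, w - lam). It has degree one: where s and w - lam vanish,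
    F w is within 1/2 of x, so F w can be replaced with x; then (s, lam) are
    compared with (y, 0), which are equivariant too. Since F w depends on w only,
    some zero w of F has a fibre on which (s, w - lam) has nonzero degree. *)
Section Local.
Variables (R : realType) (d N : nat) (blkN : 'I_N -> nat).
Variables (s : 'rV[R]_d * 'rV[R]_N -> 'rV[R]_N).
Variables (lam : 'rV[R]_d * 'rV[R]_N -> 'rV[R]_d).
Variables (F : 'rV[R]_d -> 'rV[R]_d).
Hypotheses (sc : continuous s) (lamc : continuous lam) (Fc : continuous F).
Hypothesis equiv : equivariant blkN (@cube R d) s lam.
Hypothesis lam1 : forall x y, cube x -> cube y -> forall j, `|lam (x, y) 0 j| < 1.
Hypothesis Fx : forall x y, cube x -> cube y -> s (x, y) = 0 ->
  forall j, `|F (lam (x, y)) 0 j - x 0 j| <= 2^-1.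

Local Notation K := (d + N + d)%N.

Definition blk2 (k : 'I_(d + N)) : option nat :=
  if fintype.split k is inr q then Some (blkN q) else None.

Definition blk3 (k : 'I_K) : option nat :=
  if fintype.split k is inl k' then blk2 k' else None.

Definition xpart (z : 'rV[R]_K) : 'rV[R]_d := lsubmx (lsubmx z).
Definition ypart (z : 'rV[R]_K) : 'rV[R]_N := rsubmx (lsubmx z).
Definition wpart (z : 'rV[R]_K) : 'rV[R]_d := rsubmx z.
Definition xyw x y w : 'rV[R]_K := row_mx (row_mx x y) w.

Lemma xywE z : z = xyw (xpart z) (ypart z) (wpart z).
Proof. by rewrite /xyw !hsubmxK. Qed.

Lemma xpart_xyw x y w : xpart (xyw x y w) = x.
Proof. by rewrite /xpart /xyw row_mxKl row_mxKl. Qed.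
Lemma ypart_xyw x y w : ypart (xyw x y w) = y.
Proof. by rewrite /ypart /xyw row_mxKl row_mxKr. Qed.
Lemma wpart_xyw x y w : wpart (xyw x y w) = w.
Proof. by rewrite /wpart /xyw row_mxKr. Qed.

Lemma xpart_continuous : continuous xpart.
Proof.
apply: rV_continuous => j; rewrite (_ : (fun _ => _) = fun z : 'rV[R]_K => z 0 (lshift d (lshift N j))).
  exact: coord_continuous.
by apply/funext => z; rewrite !mxE.
Qed.

Lemma ypart_continuous : continuous ypart.
Proof.
apply: rV_continuous => j; rewrite (_ : (fun _ => _) = fun z : 'rV[R]_K => z 0 (lshift d (rshift d j))).
  exact: coord_continuous.
by apply/funext => z; rewrite !mxE.
Qed.

Lemma wpart_continuous : continuous wpart.
Proof.
apply: rV_continuous => j; rewrite (_ : (fun _ => _) = fun z : 'rV[R]_K => z 0 (rshift (d + N) j)).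
  exact: coord_continuous.
by apply/funext => z; rewrite !mxE.
Qed.

Lemma cube_xyw z : cube z <-> [/\ cube (xpart z), cube (ypart z) & cube (wpart z)].
Proof.
split=> [zc|[xc yc wc] i]; first by split=> j; rewrite !mxE.
rewrite (xywE z) /xyw; case: (split_ordP i) => k ->; last by rewrite row_mxEr.
by rewrite row_mxEl; case: (split_ordP k) => l ->; rewrite ?row_mxEl ?row_mxEr.
Qed.

Lemma blk3_flip i x y w t :
  xyw x (antipode blkN i y) w 0 t =
  if blk3 t == Some i then - xyw x y w 0 t else xyw x y w 0 t.
Proof.
rewrite /blk3 /xyw; case: (split_ordP t) => k -> {t} /=.
  rewrite !row_mxEl /blk2; case: (split_ordP k) => l -> {k} /=.
    by rewrite !row_mxEl.
  by rewrite !row_mxEr mxE.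
by rewrite !row_mxEr.
Qed.

Definition f0 z := xyw (F (wpart z)) (s (xpart z, ypart z)) (wpart z - lam (xpart z, ypart z)).
Definition f1 z := xyw (xpart z) (s (xpart z, ypart z)) (wpart z - lam (xpart z, ypart z)).

Lemma xy_continuous : continuous (fun z => (xpart z, ypart z)).
Proof. exact: pair_map_continuous xpart_continuous ypart_continuous. Qed.

Lemma sxy_continuous (X : topologicalType) (g : 'rV[R]_d * 'rV[R]_N -> X) :
  continuous g -> continuous (fun z => g (xpart z, ypart z)).
Proof.
exact: comp_map_continuous xy_continuous.
Qed.

Lemma xyw_continuous (X : topologicalType) (a c : X -> 'rV[R]_d) (b : X -> 'rV[R]_N) :
  continuous a -> continuous b -> continuous c ->
  continuous (fun z => xyw (a z) (b z) (c z)).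
Proof.
move=> ac bc cc; apply: rV_continuous => j; rewrite /xyw.
case: (split_ordP j) => k -> {j}.
  case: (split_ordP k) => l -> {k}.
    rewrite (_ : (fun _ => _) = fun z => a z 0 l); first exact: rV_coord_continuous.
    by apply/funext => z; rewrite !row_mxEl.
  rewrite (_ : (fun _ => _) = fun z => b z 0 l); first exact: rV_coord_continuous.
  by apply/funext => z; rewrite row_mxEl row_mxEr.
rewrite (_ : (fun _ => _) = fun z => c z 0 k); first exact: rV_coord_continuous.
by apply/funext => z; rewrite row_mxEr.
Qed.

Lemma w_lam_continuous : continuous (fun z => wpart z - lam (xpart z, ypart z)).
Proof.
exact: sub_map_continuous wpart_continuous (sxy_continuous lamc).
Qed.

Lemma f1_continuous : continuous f1.
Proof.
apply: xyw_continuous; [exact: xpart_continuous|exact: sxy_continuous|].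
exact: w_lam_continuous.
Qed.

Lemma f0_continuous : continuous f0.
Proof.
apply: xyw_continuous; [|exact: sxy_continuous|exact: w_lam_continuous].
exact: comp_map_continuous wpart_continuous Fc.
Qed.

Local Notation r1 := (fun k => @scale R k.+1 K).

Lemma scale_flip n i j (v : 'rV[int]_K) : blk3 j = Some i ->
  scale R n (flip (flip_set blk3 j) v) =
  xyw (xpart (scale R n v)) (antipode blkN i (ypart (scale R n v))) (wpart (scale R n v)).
Proof.
move=> bj; apply/rowP => t; rewrite blk3_flip -xywE scaleN /flip_set bj inE.
by [].
Qed.

Lemma side_block n i j (v : 'rV[int]_K) : (0 < n)%N -> blk3 j = Some i ->
  on_side n j v ->
  [/\ cube (xpart (scale R n v)), cube (ypart (scale R n v)) &
     block_bdry blkN i (ypart (scale R n v))].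
Proof.
move=> n0 bj [vj vn]; have /cube_xyw[xc yc _] := @scale_cube R _ _ _ n0 vn.
split=> //; move: bj vj; rewrite /blk3 /blk2; case: (split_ordP j) => k -> //=.
case: (split_ordP k) => q -> //= [bq] vq; exists q => //.
have n20 : 0 < n.*2%:R :> R by rewrite ltr0n; lia.
rewrite !mxE normrM normfV [`|n.*2%:R|]gtr0_norm // -intr_norm vq.
by rewrite divff // lt0r_neq0.
Qed.

Lemma flip_sym_xyw (f : 'rV[R]_K -> 'rV[R]_K)
    (a : 'rV[R]_d -> 'rV[R]_N -> 'rV[R]_d -> 'rV[R]_d)
    (b : 'rV[R]_d -> 'rV[R]_N -> 'rV[R]_N)
    (c : 'rV[R]_d -> 'rV[R]_N -> 'rV[R]_d -> 'rV[R]_d) :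
  (forall z, f z = xyw (a (xpart z) (ypart z) (wpart z)) (b (xpart z) (ypart z))
                       (c (xpart z) (ypart z) (wpart z))) ->
  (forall i x y w, cube x -> cube y -> block_bdry blkN i y ->
    [/\ a x (antipode blkN i y) w = a x y w,
        b x (antipode blkN i y) = antipode blkN i (b x y) &
        c x (antipode blkN i y) w = c x y w]) ->
  flip_sym blk3 blk3 (fun k => k.+1) r1 f.
Proof.
move=> fE abc k j i v bj vj t.
have [xc yc yb] := side_block (ltn0Sn k) bj vj.
rewrite (scale_flip _ _ bj) !fE !(xpart_xyw, ypart_xyw, wpart_xyw).
have [-> -> ->] := abc i _ _ (wpart (scale R k.+1 v)) xc yc yb.
exact: blk3_flip.
Qed.

Definition faces (z : 'rV[R]_K) : R :=
  (\prod_j (1 - xpart z 0 j ^+ 2)) * \prod_j (1 - wpart z 0 j ^+ 2).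

Lemma prod_face_continuous (X : topologicalType) n (g : X -> 'rV[R]_n) :
  continuous g -> continuous (fun z => \prod_j (1 - g z 0 j ^+ 2)).
Proof.
move=> gc; elim: (index_enum _) => [|j r IH].
  by under eq_fun do rewrite big_nil; exact: cst_continuous.
under eq_fun do rewrite big_cons.
apply: mul_map_continuous IH; apply: sub_map_continuous; first exact: cst_continuous.
by under eq_fun do rewrite expr2; apply: mul_map_continuous; exact: rV_coord_continuous.
Qed.

Lemma faces_continuous : continuous faces.
Proof.
apply: mul_map_continuous; apply: prod_face_continuous.
  exact: xpart_continuous.
exact: wpart_continuous.
Qed.

Lemma scale_side n L j (v : 'rV[int]_L) : (0 < n)%N -> on_side n j v ->
  `|scale R n v 0 j| = 1.
Proof.
move=> n0 [vj _]; have n20 : 0 < n.*2%:R :> R by rewrite ltr0n; lia.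
rewrite !mxE normrM normfV [`|n.*2%:R|]gtr0_norm // -intr_norm vj.
by rewrite divff // lt0r_neq0.
Qed.

Lemma faces_side k j v : blk3 j = None -> on_side k.+1 j v -> faces (r1 k v) <= 0.
Proof.
move=> bj vj; have := scale_side (ltn0Sn k) vj; move: bj {vj}.
rewrite /blk3 /blk2 /faces; case: (split_ordP j) => l -> /=.
  case: (split_ordP l) => q -> //= _ h.
  by rewrite (@prod_face0 _ _ _ q) ?mul0r // -h !mxE.
by move=> _ h; rewrite [X in _ * X](@prod_face0 _ _ _ l) ?mulr0 // -h !mxE.
Qed.

Lemma faces_le0 z : cube z -> faces z <= 0 ->
  (exists j, `|xpart z 0 j| = 1) \/ (exists j, `|wpart z 0 j| = 1).
Proof.
move=> /cube_xyw[xc _ wc] h.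
have [/(prod_face xc)|x0] := leP (\prod_j (1 - xpart z 0 j ^+ 2)) 0; first by left.
by right; apply: (prod_face wc); move: h; rewrite pmulr_rle0.
Qed.

Local Notation sgns := (signs blk3 r1 (fun=> tie blk3)).

Lemma near_r1 k u v : in_cell u v -> ball (r1 k u) k.+1%:R^-1 (r1 k v).
Proof. exact: scale_in_cell. Qed.

Lemma eventually_degree_eq f g :
  continuous f -> continuous g ->
  flip_sym blk3 blk3 (fun k => k.+1) r1 f -> flip_sym blk3 blk3 (fun k => k.+1) r1 g ->
  (forall z, cube z -> (exists j, `|xpart z 0 j| = 1) \/ (exists j, `|wpart z 0 j| = 1) ->
    ~ (forall t, f z 0 t * g z 0 t <= 0)) ->
  exists n, forall k, (n <= k)%N -> degree k.+1 (sgns k f) = degree k.+1 (sgns k g).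
Proof.
move=> fc gc fs gs fg; apply: contrapT => nn.
have [||z [zc zf _ zfg]] := @degree_neq R K K K blk3 blk3 (fun k => k.+1) r1 (@cube R K)
    (fun=> tie blk3) (compact_cube (K := K)) (fun k v => @scale_cube R k.+1 K v (ltn0Sn k)) near_r1
    (fun k j i v o => @tie_flip K blk3 k.+1 i j v o (ltn0Sn k))
    f g faces (fun=> 0) fc gc faces_continuous (@cst_continuous _ _ 0) fs gs faces_side.
- by move=> k v _; exists (r1 k v) => //; apply: ballxx; rewrite invr_gt0.
- move=> n; apply: contrapT => nk; apply: nn; exists n => k kn.
  by apply: contrapT => h; apply: nk; exists k.
exact: fg zc (faces_le0 zc zf) zfg.
Qed.

Lemma degree_id k : degree k.+1 (sgns k id) = 1.
Proof.
apply: degree_coord => // j v vj; have n20 : 0 < k.+1.*2%:R :> R by rewrite ltr0n.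
rewrite mxE /sgnb mulf_eq0 intr_eq0 (negPf vj) invr_eq0 (gt_eqF n20) /=.
by rewrite pmulr_llt0 ?invr_gt0 // ltrz0.
Qed.

Lemma sqr_le0 (a : R) : a * a <= 0 -> a = 0.
Proof. by rewrite -expr2 le_eqVlt ltNge sqr_ge0 orbF sqrf_eq0 => /eqP. Qed.

Lemma eventually_degree_f0 :
  exists n, forall k, (n <= k)%N -> degree k.+1 (sgns k f0) = 1.
Proof.
have f1s : flip_sym blk3 blk3 (fun k => k.+1) r1 f1.
  apply: (@flip_sym_xyw f1 (fun x y w => x) (fun x y => s (x, y)) (fun x y w => w - lam (x, y))) => //.
  by move=> i x y w xc yc yb; have [-> ->] := equiv xc yc yb.
have [||n1 h1] := eventually_degree_eq f0_continuous f1_continuous _ f1s _.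
- apply: (@flip_sym_xyw f0 (fun x y w => F w) (fun x y => s (x, y)) (fun x y w => w - lam (x, y))) => //.
  by move=> i x y w xc yc yb; have [-> ->] := equiv xc yc yb.
- move=> z /cube_xyw[xc yc wc] zf h.
  have wE : wpart z = lam (xpart z, ypart z).
    apply/rowP => j; have := h (rshift _ j); rewrite /f0 /f1 /xyw !row_mxEr.
    by move=> /sqr_le0/eqP; rewrite !mxE subr_eq0 => /eqP.
  have s0 : s (xpart z, ypart z) = 0.
    apply/rowP => j; have := h (lshift _ (rshift _ j)).
    by rewrite /f0 /f1 /xyw !row_mxEl !row_mxEr mxE => /sqr_le0.
  have Fj j : F (wpart z) 0 j * xpart z 0 j <= 0.
    by have := h (lshift _ (lshift _ j)); rewrite /f0 /f1 /xyw !row_mxEl.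
  case: zf => -[j]; last by rewrite wE => wj; have := lam1 xc yc j; rewrite wj ltxx.
  move=> xj; have := Fx xc yc s0 j; rewrite -wE => Fxj; have := Fj j; move: Fxj.
  by have [x0|x0] := ger0P (xpart z 0 j); rewrite ?(ger0_norm x0) ?(ltr0_norm x0) in xj *;
    rewrite ler_norml; nra.
have [|||n2 h2] := eventually_degree_eq (g := id) f1_continuous _ f1s _ _.
- by move=> z.
- apply: (@flip_sym_xyw id (fun x y w => x) (fun x y => y) (fun x y w => w)) => //.
  exact: xywE.
- move=> z /cube_xyw[xc yc wc] zf h.
  have x0 j : xpart z 0 j = 0.
    have := h (lshift _ (lshift _ j)); rewrite {2}(xywE z) /f1 /xyw !row_mxEl.
    exact: sqr_le0.
  case: zf => -[j]; first by rewrite x0 normr0 => /eqP; rewrite eq_sym oner_eq0.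
  move=> wj; have := h (rshift _ j); rewrite {2}(xywE z) /f1 /xyw !row_mxEr !mxE.
  have := lam1 xc yc j; move: wj; rewrite ltr_norml mxE => wj.
  by have [w0|w0] := ger0P (z 0 (rshift (d + N) j)); rewrite ?(ger0_norm w0) ?(ltr0_norm w0) in wj *; nra.
exists (maxn n1 n2) => k; rewrite geq_max => /andP[k1 k2].
by rewrite h1 // h2 // degree_id.
Qed.

Definition blk_sw (t : 'I_(N + d)) : option nat :=
  if fintype.split t is inl q then Some (blkN q) else None.

Definition f2 z : 'rV[R]_(N + d) :=
  row_mx (s (xpart z, ypart z)) (wpart z - lam (xpart z, ypart z)).

Definition r2 n (w : 'rV[int]_d) (v : 'rV[int]_(d + N)) : 'rV[R]_K :=
  scale R n (row_mx v w).

Definition tie2 (w : 'rV[int]_d) o (v : 'rV[int]_(d + N)) := tie blk3 o (row_mx v w).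

Definition sgns2 n w (f : 'rV[R]_K -> 'rV[R]_(N + d)) : seq ('rV[int]_(d + N) -> bool) :=
  [seq (fun v => sgnb (f (r2 n w v) 0 t) (tie2 w (blk_sw t) v)) | t <- enum 'I_(N + d)].

Lemma wpart_scale n v : wpart (scale R n v) = scale R n (rsubmx v : 'rV[int]_d).
Proof. by apply/rowP => i; rewrite !mxE. Qed.

Lemma xpart_scale n (v : 'rV[int]_K) : xpart (scale R n v) = scale R n (lsubmx (lsubmx v)).
Proof. by apply/rowP => i; rewrite !mxE. Qed.

Lemma xpart_r2 n w v : xpart (r2 n w v) = scale R n (lsubmx v : 'rV[int]_d).
Proof. by rewrite xpart_scale row_mxKl. Qed.

Lemma wpart_r2 n w v : wpart (r2 n w v) = scale R n w.
Proof. by rewrite wpart_scale row_mxKr. Qed.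

Lemma degree_slice k : degree k.+1 (sgns k f0) = 1 ->
  exists w0 w : 'rV[int]_d, [/\ forall j, `|w 0 j| <= k.+1.*2%:Z, in_cell w0 w,
    forall j, flips w0 (fun u => sgnb (F (scale R k.+1 u) 0 j) false)
    & degree k.+1 (sgns2 k.+1 w f2) != 0].
Proof.
pose G t v := sgnb (f0 (r1 k v) 0 t) (tie blk3 (blk3 t) v).
pose ew := [seq (fun u : 'rV[int]_d => sgnb (F (scale R k.+1 u) 0 j) false) | j <- enum 'I_d].
pose es := [seq G (lshift d (rshift d q)) | q <- enum 'I_N] ++
           [seq G (rshift (d + N) j) | j <- enum 'I_d].
have -> : sgns k f0 = [seq e \o rsubmx | e <- ew] ++ es.
  rewrite [LHS](map_enum_split G) (map_enum_split (fun i => G (lshift d i))) -catA.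
  congr (_ ++ _); rewrite -[RHS]map_comp; apply: eq_map => j; apply/funext => v /=.
  rewrite /G /f0 /xyw !row_mxEl wpart_scale; congr sgnb.
  rewrite /blk3; case: split_ordP => l /eqP; rewrite (eq_lshift, eq_lrshift) // => /eqP <-.
  by rewrite /blk2; case: split_ordP => q /eqP; rewrite (eq_lshift, eq_lrshift).
move=> h; have [|/=|w0 [w [wn w0w we fw dw]]] := @degree_fibre k.+1 (d + N) d es ew.
- by rewrite size_map size_enum_ord.
- by rewrite h.
exists w0, w; split=> // [j|].
  have := fw j; rewrite size_map size_enum_ord => /(_ (ltn_ord j)).
  by rewrite (nth_map_ord _ _ (ltn_ord j)) (_ : Ordinal _ = j) //; exact: val_inj.
suff <- : [seq e \o row_mx^~ w | e <- es] = sgns2 k.+1 w f2 by [].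
rewrite /sgns2 (map_enum_split (fun t v => sgnb (f2 (r2 k.+1 w v) 0 t) (tie2 w (blk_sw t) v))).
rewrite map_cat -!map_comp; congr (_ ++ _); apply: eq_map => j; apply/funext => v /=.
  rewrite /G /f0 /f2 /xyw !row_mxEl row_mxEr; congr sgnb; congr tie.
  rewrite /blk3; case: split_ordP => l /eqP; rewrite (eq_lshift, eq_lrshift) // => /eqP <-.
  rewrite /blk2; case: split_ordP => q /eqP; rewrite ?eq_rlshift // eq_rshift => /eqP <-.
  by rewrite /blk_sw; case: split_ordP => q' /eqP; rewrite (eq_lshift, eq_lrshift) // => /eqP <-.
rewrite /G /f0 /f2 /xyw !row_mxEr; congr sgnb; congr tie.
rewrite /blk3; case: split_ordP => l /eqP; rewrite ?eq_rlshift // => _.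
by rewrite /blk_sw; case: split_ordP => q' /eqP; rewrite ?eq_rlshift.
Qed.

Lemma row_mx_continuous (X : topologicalType) n1 n2 (f : X -> 'rV[R]_n1) (g : X -> 'rV[R]_n2) :
  continuous f -> continuous g -> continuous (fun x => row_mx (f x) (g x)).
Proof.
move=> fc gc; apply: rV_continuous => j; case: (split_ordP j) => k ->.
  rewrite (_ : (fun _ => _) = fun z => f z 0 k); first exact: rV_coord_continuous.
  by apply/funext => z; rewrite row_mxEl.
rewrite (_ : (fun _ => _) = fun z => g z 0 k); first exact: rV_coord_continuous.
by apply/funext => z; rewrite row_mxEr.
Qed.

Lemma cluster_point (V : pseudoMetricType R) (D : set V) (a : nat -> V) :
  compact D -> (forall k, D (a k)) ->
  exists2 p, D p & forall n, exists2 k, (n <= k)%N & ball p n.+1%:R^-1 (a k).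
Proof.
move=> cD Da.
have [|p [Dp clp]] := cD (a @ \oo) _; first by exists 0%N => // k _; exact: Da.
exists p => // n; have e0 : 0 < n.+1%:R^-1 :> R by rewrite invr_gt0.
have aN : (a @ \oo) [set x | exists2 k, (n <= k)%N & x = a k].
  by exists n => // k nk; exists k.
by have [_ [[k nk ->] pk]] := clp _ _ aN (nbhsx_ballx p _ e0); exists k.
Qed.

(** The zeros of F approximated on the grids converge to [w]. The degree of
    (s, w - lam) on the slices over the approximate zeros is nonzero, and it does
    not change under a modification away from the boundary of the cube of x,
    where (s, w - lam) has no zeros: there x is far from 0 = F w. *)
Lemma local_zero : exists w, F w = 0 /\
  forall s' lam', continuous s' -> continuous lam' ->
    equivariant blkN (@cube R d) s' lam' ->
    (forall x y, cube x -> cube y -> (exists j, `|x 0 j| = 1) ->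
       s' (x, y) = s (x, y) /\ lam' (x, y) = lam (x, y) - w) ->
    exists x y, [/\ cube x, cube y, s' (x, y) = 0 & lam' (x, y) = 0].
Proof.
have [n0 deg1] := eventually_degree_f0.
have /choice[w0 /choice[w wP]] : forall k, exists w0 w : 'rV[int]_d,
   [/\ forall j, `|w 0 j| <= (maxn n0 k.+1).+1.*2%:Z, in_cell w0 w,
    forall j, flips w0 (fun u => sgnb (F (scale R (maxn n0 k.+1).+1 u) 0 j) false)
    & degree (maxn n0 k.+1).+1 (sgns2 (maxn n0 k.+1).+1 w f2) != 0].
  by move=> k; apply: degree_slice; apply: deg1; rewrite leq_maxl.
pose ns k := (maxn n0 k.+1).+1; pose a k := scale R (ns k) (w k).
have ac k : cube (a k) by apply: scale_cube => //; have [] := wP k.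
have [ws wsc clw] := cluster_point (@compact_cube R d) ac.
have ltns k : (k.+1 < ns k)%N by rewrite ltnS leq_maxr.
have Fws : F ws = 0.
  apply/rowP => j; rewrite mxE.
  have sub (g : 'rV[R]_d -> R) : continuous g ->
      (forall k, exists2 b, ball (a k) k.+1%:R^-1 b & g b <= 0) -> g ws <= 0.
    move=> gc gb; rewrite leNgt; apply/negP => g0.
    have /nbhs_ballP[e /= e0 eg] : nbhs ws [set x | 0 < g x].
      by apply: (gc ws [set x | 0 < x]); apply: open_nbhs_nbhs; split=> //; exact: open_gt.
    have e2 : 0 < e / 2 by rewrite divr_gt0.
    have [n _ ne] := near_infty_natSinv_lt (PosNum e2).
    have [k nk wak] := clw n; have [b ab] := gb k.
    rewrite leNgt => /negP; apply; apply: eg; rewrite (splitr e).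
    apply: ball_triangle (le_ball (ltW (ne n (leqnn n))) wak) _.
    exact: le_ball (ltW (ne k nk)) _ ab.
  have nb k p : in_cell (w0 k) p -> ball (a k) k.+1%:R^-1 (scale R (ns k) p).
    have [_ nw _ _] := wP k; move=> np.
    split=> [|i0 i]; first by rewrite invr_gt0.
    have n20 : 0 < (ns k).*2%:R :> R by rewrite ltr0n double_gt0.
    rewrite ord1 !mxE -ball_normE /ball_ /= -mulrBl normrM normfV [`|(ns k).*2%:R|]gtr0_norm //.
    rewrite ltr_pdivrMr // -intrB -intr_norm.
    apply: (@le_lt_trans _ _ 2%:~R).
      move: nw np => /forallP/(_ i)/andP[nw _] /forallP/(_ i)/andP[np _].
      by rewrite ler_int; lia.
    rewrite mulrC ltr_pdivlMr ?ltr0n // -[2%:~R]/(2%:R) -natrM ltr_nat.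
    by have := ltns k; lia.
  have Fjc : continuous (fun u => F u 0 j) by exact: rV_coord_continuous.
  apply/eqP; rewrite eq_le -[X in _ && X]oppr_le0; apply/andP; split.
    apply: (sub (fun u => F u 0 j)) => // k; have [_ _ /(_ j)[p [q [np nq pq]]] _] := wP k.
    have [Fp|Fp] := boolP (sgnb (F (scale R (ns k) p) 0 j) false).
      by exists (scale R (ns k) p); [exact: nb|exact: sgnb_le0 Fp].
    exists (scale R (ns k) q); first exact: nb.
    by apply: (@sgnb_le0 _ _ false); move: pq Fp; rewrite /ns; do 2!case: sgnb.
  apply: (sub (fun u => - F u 0 j)) => [u|k].
    by apply: (@continuousN _ _ _ (fun u => F u 0 j)); exact: Fjc.
  have [_ _ /(_ j)[p [q [np nq pq]]] _] := wP k.
  have [Fp|Fp] := boolP (sgnb (F (scale R (ns k) p) 0 j) false).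
    exists (scale R (ns k) q); first exact: nb.
    rewrite oppr_le0; apply: (@sgnb_ge0 _ _ false).
    by move: pq Fp; rewrite /ns; do 2!case: sgnb.
  by exists (scale R (ns k) p); [exact: nb|rewrite oppr_le0; exact: sgnb_ge0 Fp].
exists ws; split=> // s' lam' s'c lam'c equiv' bd.
have /choice[j jP] : forall n, exists k, (n <= k)%N /\ ball ws n.+1%:R^-1 (a k).
  by move=> n; have [k nk wk] := clw n; exists k.
pose m n := ns (j n); pose r n := r2 (m n) (w (j n)); pose ti n := tie2 (w (j n)).
have mlt n : (n < m n)%N by apply: ltn_trans (ltns (j n)); rewrite ltnS (jP n).1.
have rle n (v : 'rV[int]_(d + N)) : (forall i, `|v 0 i| <= (m n).*2%:Z) ->
    forall i, `|row_mx v (w (j n)) 0 i| <= (m n).*2%:Z.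
  move=> vn i; case: (split_ordP i) => l ->; first by rewrite row_mxEl.
  by rewrite row_mxEr; have [] := wP (j n).
have rD n (v : 'rV[int]_(d + N)) : (forall i, `|v 0 i| <= (m n).*2%:Z) -> cube (r n v).
  by move=> vn; apply: scale_cube; [exact: leq_ltn_trans (mlt n)|exact: rle].
have r_near n (u v : 'rV[int]_(d + N)) : in_cell u v -> ball (r n u) n.+1%:R^-1 (r n v).
  move=> uv; apply: scale_in_cell; first exact: mlt.
  apply/forallP => i; case: (split_ordP i) => l ->.
    by rewrite !row_mxEl; move/forallP: uv.
  by rewrite !row_mxEr subrr normr0 ler01 eqxx implybT.
have blkl l : blk3 (lshift d l) = blk2 l.
  by rewrite /blk3; case: split_ordP => q /eqP; rewrite (eq_lshift, eq_lrshift) // => /eqP ->.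
have sidel n l (v : 'rV[int]_(d + N)) : on_side (m n) l v ->
    on_side (m n) (lshift d l) (row_mx v (w (j n))).
  by move=> [vl vn]; split; [rewrite row_mxEl|exact: rle].
have flipl n i l (v : 'rV[int]_(d + N)) : blk2 l = Some i ->
    row_mx (flip (flip_set blk2 l) v) (w (j n)) =
    flip (flip_set blk3 (lshift d l)) (row_mx v (w (j n))).
  move=> bl; apply/rowP => t; rewrite flipE /flip_set blkl bl; case: (split_ordP t) => q ->.
    by rewrite !row_mxEl flipE !inE blkl.
  rewrite !row_mxEr inE (_ : blk3 (rshift (d + N) q) = None) //.
  by rewrite /blk3; case: split_ordP => x /eqP; rewrite ?eq_rlshift.
have ti_flip n l i v o : blk2 l = Some i -> on_side (m n) l v ->
    ti n o (flip (flip_set blk2 l) v) = ti n o v (+) (o == Some i).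
  move=> bl vl; rewrite /ti /tie2 (flipl _ _ _ _ bl).
  by apply: (@tie_flip _ _ (m n)); [exact: leq_ltn_trans (mlt n)|rewrite blkl|exact: sidel].
pose g2 z : 'rV[R]_(N + d) := row_mx (s' (xpart z, ypart z)) (- lam' (xpart z, ypart z)).
have f2c : continuous f2.
  by apply: row_mx_continuous; [exact: sxy_continuous|exact: w_lam_continuous].
have g2c : continuous g2.
  apply: row_mx_continuous; first exact: sxy_continuous.
  move=> z; apply: (@continuousN _ _ _ (fun z => lam' (xpart z, ypart z))).
  exact: sxy_continuous.
have symm (b : 'rV[R]_d * 'rV[R]_N -> 'rV[R]_N) (c : 'rV[R]_d * 'rV[R]_N -> 'rV[R]_d -> 'rV[R]_d) f :
    (forall z, f z = row_mx (b (xpart z, ypart z)) (c (xpart z, ypart z) (wpart z))) ->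
    (forall i x y u, cube x -> cube y -> block_bdry blkN i y ->
      b (x, antipode blkN i y) = antipode blkN i (b (x, y)) /\
      c (x, antipode blkN i y) u = c (x, y) u) ->
    flip_sym blk2 blk_sw m r f.
  move=> fE bc n l i v bl vl t.
  have bl3 : blk3 (lshift d l) = Some i by rewrite blkl.
  have m0 : (0 < m n)%N by exact: leq_ltn_trans (mlt n).
  have [xc yc yb] := side_block m0 bl3 (sidel _ _ _ vl).
  rewrite /r /r2 (flipl _ _ _ _ bl) (scale_flip _ _ bl3) !fE.
  rewrite !(xpart_xyw, ypart_xyw, wpart_xyw).
  have [-> ->] := bc i _ _ (wpart (scale R (m n) (row_mx v (w (j n))))) xc yc yb.
  rewrite /blk_sw; case: split_ordP => q ->; last by rewrite !row_mxEr.
  by rewrite !row_mxEl mxE.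
have f2s : flip_sym blk2 blk_sw m r f2.
  apply: (@symm s (fun p u => u - lam p)) => // i x y u xc yc yb.
  by have [-> ->] := equiv xc yc yb.
have g2s : flip_sym blk2 blk_sw m r g2.
  apply: (@symm s' (fun p u => - lam' p)) => // i x y u xc yc yb.
  by have [-> ->] := equiv' _ _ _ xc yc yb.
pose h (z : 'rV[R]_K) := \prod_l (1 - xpart z 0 l ^+ 2).
have hc : continuous h by apply: prod_face_continuous; exact: xpart_continuous.
have h0 n l v : blk2 l = None -> on_side (m n) l v -> h (r n v) <= 0.
  rewrite /blk2; case: split_ordP => // q -> _ vl.
  have m0 : (0 < m n)%N by exact: leq_ltn_trans (mlt n).
  by rewrite /h (@prod_face0 _ _ _ q) // -(scale_side m0 vl) xpart_r2 !mxE.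
pose h' (z : 'rV[R]_K) := `|wpart z - ws|.
have h'c : continuous h'.
  move=> z; apply: (@continuous_comp _ _ _ (fun z => wpart z - ws) (fun u => `|u|)).
    exact: sub_map_continuous wpart_continuous (@cst_continuous _ _ ws) _.
  exact: norm_continuous.
have h'0 n (v : 'rV[int]_(d + N)) : (forall i, `|v 0 i| <= (m n).*2%:Z) ->
    exists2 b, ball (r n v) n.+1%:R^-1 b & h' b <= 0.
  move=> vn; exists (xyw (xpart (r n v)) (ypart (r n v)) ws); last first.
    by rewrite /h' wpart_xyw subrr normr0.
  split=> [|i0 i]; first by rewrite invr_gt0.
  rewrite ord1 {1}(xywE (r n v)) /xyw; case: (split_ordP i) => l ->.
    by rewrite !row_mxEl; apply: ballxx; rewrite invr_gt0.
  rewrite !row_mxEr wpart_r2; apply: ball_sym; have [_ ba] := (jP n).2.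
  exact: ba.
have degf n : degree (m n) (sgns2 (m n) (w (j n)) f2) != 0 by have [] := wP (j n).
have [n1 fg] : exists n1, forall n, (n1 <= n)%N ->
    degree (m n) (sgns2 (m n) (w (j n)) f2) = degree (m n) (sgns2 (m n) (w (j n)) g2).
  apply: contrapT => nn.
  have [|z [zc zh zh' zfg]] := @degree_neq R (d + N) K (N + d) blk2 blk_sw m r (@cube R K)
      ti (compact_cube (K := K)) rD r_near ti_flip f2 g2 h h' f2c g2c hc h'c f2s g2s h0 h'0.
    move=> n; apply: contrapT => nk; apply: nn; exists n => k kn.
    by apply: contrapT => ne; apply: nk; exists k.
  have /cube_xyw[xc yc _] := zc; have [l xl] := prod_face xc zh.
  have [s'E lam'E] := bd _ _ xc yc (ex_intro _ l xl).
  have wE : wpart z = ws.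
    by apply/eqP; rewrite -subr_eq0 -normr_le0.
  have s0 : s (xpart z, ypart z) = 0.
    apply/rowP => q; have := zfg (lshift d q).
    by rewrite /f2 /g2 !row_mxEl s'E mxE => /sqr_le0.
  have lamE : lam (xpart z, ypart z) = ws.
    apply/rowP => q; have := zfg (rshift N q).
    rewrite /f2 /g2 !row_mxEr lam'E wE opprB => /sqr_le0/eqP.
    by rewrite !mxE subr_eq0 => /eqP.
  have := Fx xc yc s0 l; rewrite lamE Fws mxE sub0r normrN xl.
  by lra.
have [||z [zc _ z0]] := @degree_zero R (d + N) K (N + d) blk_sw m r (@cube R K)
    ti (compact_cube (K := K)) rD r_near g2 (fun=> 0) g2c (@cst_continuous _ _ 0).
- by move=> k v _; exists (r k v) => //; apply: ballxx; rewrite invr_gt0.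
- move=> n; exists (maxn n n1); first exact: leq_maxl.
  by apply/eqP; rewrite -[signs _ _ _ _ _]/(sgns2 _ _ _) -fg ?leq_maxr.
have /cube_xyw[xc yc _] := zc; exists (xpart z), (ypart z); split=> //.
  by apply/rowP => q; move/rowP/(_ (lshift d q)): z0; rewrite row_mxEl !mxE.
apply/rowP => q; move/rowP/(_ (rshift N q)): z0; rewrite row_mxEr !mxE.
by move/eqP; rewrite oppr_eq0 => /eqP.
Qed.

End Local.

(** * Moving the zero set to infinity *)

Lemma coord_le_norm (R : realType) n (x : 'rV[R]_n) i : `|x 0 i| <= `|x|.
Proof.
rewrite /Num.norm /= mx_normrE; exact: (@le_bigmax _ _ _ _ (fun ij => `|x ij.1 ij.2|) (0, i)).
Qed.

Lemma rV_norm_le (R : realType) n (x : 'rV[R]_n) c : 0 <= c ->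
  (forall i, `|x 0 i| <= c) -> `|x| <= c.
Proof.
move=> c0 xc; rewrite /Num.norm /= mx_normrE; apply/bigmax_leP; split=> // -[i j] _ /=.
by rewrite ord1.
Qed.

Lemma glue_continuous (X Y : topologicalType) (A B : set X) (f g : X -> Y) :
  closed A -> closed B -> (forall x, A x \/ B x) ->
  (forall x, A x -> B x -> f x = g x) -> continuous f -> continuous g ->
  continuous (fun x => if `[< A x >] then f x else g x).
Proof.
move=> cA cB AB fg /continuous_closedP fc /continuous_closedP gc.
apply/continuous_closedP => D cD.
rewrite (_ : _ @^-1` _ = (A `&` f @^-1` D) `|` (B `&` g @^-1` D)).
  by apply: closedU; apply: closedI => //; [exact: fc|exact: gc].
apply/seteqP; split=> x /=.
  case: asboolP => [Ax Dx|nA Dx]; [by left|right; split=> //].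
  by case: (AB x).
case: asboolP => [Ax [[]//|[Bx Dx]]|nA [[]//|[]//]].
by rewrite fg.
Qed.

Lemma unif_continuous_compact (R : realType) (X V : normedModType R) (D : set X)
    (f : X -> V) (e : R) : compact D -> continuous f -> 0 < e ->
  exists2 r, 0 < r & forall x x', D x -> D x' -> `|x - x'| < r -> `|f x - f x'| < e.
Proof.
move=> cD fc e0; apply: contrapT => nr.
have /choice[x /choice[x' xP]] : forall n, exists x x', [/\ D x, D x',
    `|x - x'| < n.+1%:R^-1 & e <= `|f x - f x'| ].
  move=> n; apply: contrapT => nx; apply: nr; exists n.+1%:R^-1; rewrite ?invr_gt0 //.
  move=> x x' Dx Dx' xx'; rewrite ltNge; apply/negP => le.
  by apply: nx; exists x, x'.
have [|p _ clp] := cluster_closed cD (a := x); first by move=> n; have [] := xP n.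
suff : e - `|f p - f p| <= 0 by rewrite subrr normr0 subr0 leNgt e0.
apply: (clp (fun q => e - `|f q.1 - f q.2|) x x').
- apply: sub_map_continuous; first exact: cst_continuous.
  apply: (comp_map_continuous (f := fun q : X * X => f q.1 - f q.2) _ (@norm_continuous _ _)).
  apply: sub_map_continuous.
    by apply: (comp_map_continuous _ fc) => q; exact: cvg_fst.
  by apply: (comp_map_continuous _ fc) => q; exact: cvg_snd.
- by move=> n; apply: ballxx; rewrite invr_gt0.
- by move=> n; have [_ _ xx' _] := xP n; rewrite -ball_normE.
- by move=> n /=; have [_ _ _ h] := xP n; rewrite subr_le0.
Qed.

Lemma finite_radius (R : realType) (T : finType) (P : T -> R -> Prop) :
  (forall i r r', r' <= r -> P i r -> P i r') ->
  (forall i, exists2 r, 0 < r & P i r) -> exists2 r, 0 < r & forall i, P i r.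
Proof.
move=> Pm Pi; have /choice[f fP] : forall i, exists r, 0 < r /\ P i r.
  by move=> i; have [r] := Pi i; exists r.
exists (\big[Order.min/1]_i f i).
  by apply: lt_bigmin => // i _; have [] := fP i.
by move=> i; have [_] := fP i; apply: Pm; exact: bigmin_le.
Qed.

(** The cube [-1, 1]^d in the domain of a chart. The coordinates [cc_inv] must be
    defined and continuous on M, so they are inverse to [cc_map] on a smaller
    cube only; [cc_depth], the distance to the boundary of the cube, tells where,
    and it is not positive outside. *)
Record coord_cube (R : realType) (d : nat) (M : topologicalType) := CoordCube {
  cc_map : 'rV[R]_d -> M;
  cc_inv : M -> 'rV[R]_d;
  cc_depth : M -> R;
  cc_map_continuous : continuous cc_map;
  cc_inv_continuous : continuous cc_inv;
  cc_depth_continuous : continuous cc_depth;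
  cc_mapK : forall x, `|x| <= 3 / 4 -> cc_inv (cc_map x) = x;
  cc_depth_map : forall x, `|x| <= 1 -> cc_depth (cc_map x) = 1 - `|x|;
  cc_depth_gt0 : forall m, 0 < cc_depth m ->
    exists2 x, `|x| = 1 - cc_depth m & m = cc_map x
}.

Section Transport.
Variables (R : realType) (d : nat) (M : topologicalType) (L : nat).
Variable cc : 'I_L -> coord_cube R d M.
Local Notation phi l := (cc_map (cc l)).
Local Notation h l := (cc_inv (cc l)).
Local Notation tau l := (cc_depth (cc l)).

Lemma cc_invK l m : 1 / 4 <= tau l m -> phi l (h l m) = m /\ `|h l m| = 1 - tau l m.
Proof.
move=> tm; have [|x xt ->] := @cc_depth_gt0 _ _ _ (cc l) m; first by lra.
have x1 : `|x| <= 3 / 4 by lra.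
have tx : tau l (phi l x) = 1 - `|x| by apply: cc_depth_map; lra.
by rewrite cc_mapK // tx; split=> //; lra.
Qed.

Definition nbox l (c : 'rV[R]_d) (r : R) : set M :=
  [set m | 1 / 4 < tau l m /\ `|h l m - c| < r].

Section Family.
Variables (N : nat) (blk : 'I_N -> nat).
Variables (s : M * 'rV[R]_N -> 'rV[R]_N) (lam : M * 'rV[R]_N -> 'rV[R]_d).
Hypotheses (sc : continuous s) (lamc : continuous lam).
Hypothesis equiv : equivariant blk setT s lam.

Definition fibre w m := exists y, [/\ cube y, s (m, y) = 0 & lam (m, y) = w].

(** This replaces the statement that the degree of (s, lam - w) over [O] is
    nonzero. Its advantage is that it can be transported without a theory of the
    degree on manifolds. *)
Definition essential (w : 'rV[R]_d) (O : set M) := forall s' lam',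
  continuous s' -> continuous lam' -> equivariant blk (@setT M) s' lam' ->
  (forall m y, ~ O m -> s' (m, y) = s (m, y) /\ lam' (m, y) = lam (m, y) - w) ->
  exists m y, [/\ cube y, s' (m, y) = 0 & lam' (m, y) = 0].

Lemma essentialW w (O O' : set M) : O' `<=` O -> essential w O -> essential w O'.
Proof.
move=> OO ess s' lam' s'c lam'c eq' ag; apply: ess => // m y nO.
by apply: ag => O'm; apply: nO; exact: OO.
Qed.

Lemma equiv_sub w : equivariant blk (@setT M) s (fun p => lam p - w).
Proof. by move=> i m y mT yc yb; have [-> ->] := equiv mT yc yb. Qed.

Lemma essential_fibre w O : essential w O -> exists m, fibre w m.
Proof.
move=> ess; have [|//|m [y [yc s0 l0]]] := ess s (fun p => lam p - w) sc _ (equiv_sub w).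
  exact: sub_map_continuous lamc (@cst_continuous _ _ w).
by exists m, y; split=> //; apply/eqP; rewrite -subr_eq0 l0.
Qed.

Lemma nbox_depth l c r m : `|c| <= 1 / 4 -> nbox l c r m -> 3 / 4 - r <= tau l m.
Proof.
move=> c4 [tm hm]; have [_ h1] := cc_invK (ltW tm).
have := ler_normD (h l m - c) c; rewrite subrK h1; lra.
Qed.

Lemma dist_continuous l c : continuous (fun m => `|h l m - c|).
Proof.
apply: (comp_map_continuous (f := fun m => h l m - c) _ (@norm_continuous _ _)).
apply: sub_map_continuous; first exact: cc_inv_continuous.
exact: cst_continuous.
Qed.

Lemma max_map_continuous (X : topologicalType) (f g : X -> R) :
  continuous f -> continuous g -> continuous (fun x => Num.max (f x) (g x)).
Proof. by move=> fc gc x; apply: continuous_max; [exact: fc|exact: gc]. Qed.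

Lemma min_map_continuous (X : topologicalType) (f g : X -> R) :
  continuous f -> continuous g -> continuous (fun x => Num.min (f x) (g x)).
Proof. by move=> fc gc x; apply: continuous_min; [exact: fc|exact: gc]. Qed.

Lemma fst_map_continuous (X Y Z : topologicalType) (f : X -> Z) :
  continuous f -> continuous (fun p : X * Y => f p.1).
Proof. by move=> fc; apply: (comp_map_continuous _ fc) => q; exact: cvg_fst. Qed.

Lemma scale_map_continuous (X : topologicalType) (V : normedModType R) (f : X -> R) (g : X -> V) :
  continuous f -> continuous g -> continuous (fun x => f x *: g x).
Proof. by move=> fc gc x; apply: cvgZ; [exact: fc|exact: gc]. Qed.

(** Along the segment from [w] to [w'] the fibres stay in the small box, so
    moving the value from [w] to [w'], by a cutoff [chi] that is 0 on the small
    box and 1 outside the large one, creates no zero between the boxes. *)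
Lemma essential_shift l c w w' :
  `|c| <= 1 / 4 ->
  (forall t m, 0 <= t <= 1 -> fibre (w' - t *: (w' - w)) m -> nbox l c (1 / 4) m) ->
  essential w (nbox l c (1 / 2)) -> essential w' (nbox l c (1 / 4)).
Proof.
move=> c4 fw ess s' lam' s'c lam'c eq' ag.
pose chi m := Num.min 1 (Num.max 0 (Num.max (4 * `|h l m - c| - 1) (2 - 4 * tau l m))).
have chic : continuous chi.
  apply: min_map_continuous; first exact: cst_continuous.
  apply: max_map_continuous; first exact: cst_continuous.
  apply: max_map_continuous; apply: sub_map_continuous; try exact: cst_continuous.
    by apply: mul_map_continuous; [exact: cst_continuous|exact: dist_continuous].
  by apply: mul_map_continuous; [exact: cst_continuous|exact: cc_depth_continuous].
have chi0 m : nbox l c (1 / 4) m -> chi m = 0.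
  move=> mb; have := nbox_depth c4 mb; case: mb => _ hm tm.
  rewrite /chi [Num.max 0 _]max_l; first by rewrite min_r.
  by rewrite ge_max; apply/andP; split; lra.
have chi1 m : ~ nbox l c (1 / 2) m -> chi m = 1.
  move=> mb; rewrite /chi min_l // !le_max; apply/orP; right.
  have [tm|tm] := leP (tau l m) (1 / 4); first by apply/orP; right; lra.
  have [hm|hm] := ltP `|h l m - c| (1 / 2); first by case: mb.
  by apply/orP; left; lra.
have chi01 m : 0 <= chi m <= 1.
  by rewrite /chi le_min ler01 le_max lexx ge_min lexx.
have [|||m [y [yc s0 l0]]] := ess s' (fun p => lam' p + chi p.1 *: (w' - w)) s'c.
- apply: add_map_continuous => //; apply: scale_map_continuous.
    exact: fst_map_continuous.
  exact: cst_continuous.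
- by move=> i m y mT yc yb; have [-> ->] := eq' _ _ _ mT yc yb.
- move=> m y nb; have [|-> ->] := ag m y.
    by move=> [tm hm]; apply: nb; split=> //; lra.
  by rewrite chi1 // scale1r addrA subrK.
have [mb|mb] := pselect (nbox l c (1 / 4) m).
  by exists m, y; split=> //; move: l0; rewrite chi0 // scale0r addr0.
exfalso; apply: (mb); apply: (fw (chi m)) => //; exists y.
have [s'E l'E] := ag m y mb; split=> //; first by rewrite -s'E.
apply/eqP; rewrite -subr_eq0 opprB [_ *: _ - _]addrC addrA; apply/eqP.
by move: l0; rewrite /= l'E.
Qed.

(** A modification over a large box is a modification over a small concentric
    box: shrink it radially to the box of radius r/2, and fill the gap between
    the radii r/2 and r with the values that [(s, lam - w)] takes between the
    boxes, where it has no zeros. *)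
Lemma essential_enlarge l c w r :
  `|c| <= 1 / 4 -> 0 < r <= 1 / 4 -> (forall m, fibre w m -> nbox l c r m) ->
  essential w (nbox l c r) -> essential w (nbox l c (1 / 2)).
Proof.
move=> c4 /andP[r0 r4] fw ess s' lam' s'c lam'c eq' ag.
(* [g] reverses the gap: it maps r/2 to the radius 1/2 of the large box, and r
   to itself. *)
pose g (t : R) := 1 / 2 - (t - r / 2) * (1 - 2 * r) / r.
pose kap (t : R) := g t / Num.max t (r / 2).
pose theta (m : M) := c + kap `|h l m - c| *: (h l m - c).
have mx0 t : 0 < Num.max t (r / 2) by rewrite lt_max; apply/orP; right; lra.
have kapc : continuous kap.
  apply: mul_map_continuous.
    apply: sub_map_continuous; first exact: cst_continuous.
    apply: mul_map_continuous; last exact: cst_continuous.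
    apply: mul_map_continuous; last exact: cst_continuous.
    by apply: sub_map_continuous; [move=> x; exact: cvg_id|exact: cst_continuous].
  move=> x; apply: (@cvgV _ _ (nbhs x) _ (fun t => Num.max t (r / 2))); first exact: lt0r_neq0.
  by apply: (max_map_continuous (f := id)); [move=> t; exact: cvg_id|exact: cst_continuous].
have thc : continuous theta.
  apply: add_map_continuous; first exact: cst_continuous.
  apply: scale_map_continuous; last first.
    by apply: sub_map_continuous; [exact: cc_inv_continuous|exact: cst_continuous].
  by apply: (comp_map_continuous (f := fun m => `|h l m - c|)) => //; exact: dist_continuous.
have kapE t : r / 2 <= t -> kap t * t = g t.
  move=> rt; rewrite /kap max_l // mulfVK //.
  by apply: lt0r_neq0; lra.
have gmid : g (r / 2) = 1 / 2 by rewrite /g subrr !mul0r subr0.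
have gr : g r = r by rewrite /g; field; exact: lt0r_neq0.
have gle t : r / 2 <= t <= r -> r <= g t <= 1 / 2.
  move=> /andP[t1 t2]; pose k := (1 - 2 * r) / r.
  have k0 : 0 <= k by rewrite divr_ge0 //; lra.
  have gE x : g x = 1 / 2 - (x - r / 2) * k by rewrite /g mulrA.
  by apply/andP; split; [rewrite -{1}gr|]; rewrite !gE; nra.
have thd m : r / 2 <= `|h l m - c| -> `|theta m - c| = `|g `|h l m - c| |.
  move=> rt; rewrite /theta addrAC subrr add0r normrZ -(kapE _ rt).
  by rewrite [RHS]normrM (ger0_norm (normr_ge0 (h l m - c))).
have th_in m : r / 2 <= `|h l m - c| <= r ->
    h l (phi l (theta m)) = theta m /\ r <= `|theta m - c|.
  move=> rt; have /andP[g1 g2] := gle _ rt; case/andP: rt => t1 t2.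
  rewrite thd // ger0_norm; last by lra.
  split=> //; apply: cc_mapK; have := ler_normD (theta m - c) c.
  by rewrite subrK thd // ger0_norm; lra.
have th_mid m y : `|h l m - c| = r / 2 -> s' (phi l (theta m), y) = s (phi l (theta m), y)
    /\ lam' (phi l (theta m), y) = lam (phi l (theta m), y) - w.
  move=> hm; apply: ag => -[_].
  have hr : r / 2 <= `|h l m - c| <= r by rewrite hm; apply/andP; split; lra.
  by have [-> _] := th_in m hr; rewrite thd hm // gmid ger0_norm; lra.
have th_far m : 1 / 4 <= tau l m -> `|h l m - c| = r -> phi l (theta m) = m.
  move=> tm hm; rewrite /theta hm.
  have -> : kap r = 1.
    by rewrite -[LHS](mulfK (lt0r_neq0 r0)) kapE ?gr ?divff ?lt0r_neq0 //; lra.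
  by rewrite scale1r addrC subrK; have [] := cc_invK tm.
pose far m := tau l m <= 1 / 4 \/ r <= `|h l m - c|.
pose nearby m := 1 / 4 <= tau l m /\ `|h l m - c| <= r.
have far_near m : far m -> nearby m -> 1 / 4 <= tau l m /\ `|h l m - c| = r.
  move=> fm [tm hm]; split=> //; apply/eqP; rewrite eq_le hm /=.
  case: fm => // tm'; have [_ hn] := cc_invK tm.
  by have := ler_normD (h l m - c) c; rewrite subrK hn; lra.
have closed_pre (f : M -> R) b : continuous f -> closed [set p : M * 'rV[R]_N | f p.1 <= b].
  move=> fc; apply: (@preimage_closed _ _ (fun p => f p.1) [set x | x <= b]).
    by move=> p _; exact: fst_map_continuous.
  exact: closed_le.
have closed_pre' (f : M -> R) b : continuous f -> closed [set p : M * 'rV[R]_N | b <= f p.1].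
  move=> fc; apply: (@preimage_closed _ _ (fun p => f p.1) [set x | b <= x]).
    by move=> p _; exact: fst_map_continuous.
  exact: closed_ge.
have dc : continuous (fun m => `|h l m - c|) by exact: dist_continuous.
have tc : continuous (tau l) by exact: cc_depth_continuous.
pose patch (V : Type) (f f' : M * 'rV[R]_N -> V) p := if `[< far p.1 >] then f p else
  if `[< `|h l p.1 - c| <= r / 2 >] then f' (phi l (theta p.1), p.2)
  else f (phi l (theta p.1), p.2).
have patchc (V : topologicalType) (f f' : M * 'rV[R]_N -> V) :
    continuous f -> continuous f' ->
    (forall m y, `|h l m - c| = r / 2 -> f' (phi l (theta m), y) = f (phi l (theta m), y)) ->
    continuous (patch V f f').
  move=> fc f'c ff.
  have thyc : continuous (fun p : M * 'rV[R]_N => (phi l (theta p.1), p.2)).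
    apply: pair_map_continuous; last by move=> p; exact: cvg_snd.
    apply: (fst_map_continuous (f := fun m => phi l (theta m))).
    by apply: comp_map_continuous thc _; exact: cc_map_continuous.
  apply: (@glue_continuous _ _ [set p | far p.1] [set p | nearby p.1] f).
  - exact: closedU (closed_pre _ _ tc) (closed_pre' _ _ dc).
  - exact: closedI (closed_pre' _ _ tc) (closed_pre _ _ dc).
  - move=> p; rewrite /far /nearby.
    have [tm|tm] := leP (tau l p.1) (1 / 4); first by left; left.
    have [hm|hm] := leP r `|h l p.1 - c|; first by left; right.
    by right; split; exact: ltW.
  - move=> [m y] /= fm nm; have [tm hm] := far_near _ fm nm.
    rewrite hm th_far //; case: asboolP => // hr; exfalso; lra.
  - exact: fc.
  - apply: (@glue_continuous _ _ [set p | `|h l p.1 - c| <= r / 2]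
      [set p | r / 2 <= `|h l p.1 - c|]).
    + exact: closed_pre _ _ dc.
    + exact: closed_pre' _ _ dc.
    + by move=> p; apply/orP; exact: le_total.
    + by move=> [m y] /= h1 h2; apply: ff; apply/eqP; rewrite eq_le h1.
    + exact: comp_map_continuous thyc f'c.
    + exact: comp_map_continuous thyc fc.
have lwc : continuous (fun p => lam p - w).
  exact: sub_map_continuous lamc (@cst_continuous _ _ w).
have [||||m [y [yc]]] := ess (patch _ s s') (patch _ (fun p => lam p - w) lam').
- by apply: patchc => // m y hm; have [] := th_mid m y hm.
- by apply: patchc => // m y hm; have [] := th_mid m y hm.
- move=> i m y mT yc yb; rewrite /patch /=.
  case: asboolP => _; first exact: (equiv_sub w mT yc yb).
  by case: asboolP => _; [exact: eq'|exact: (equiv_sub w _ yc yb)].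
- move=> m y nb; have fm : far m.
    have [tm|tm] := leP (tau l m) (1 / 4); first by left.
    by right; rewrite leNgt; apply/negP => hm; apply: nb; split.
  by rewrite /patch /=; case: asboolP.
rewrite /patch /=; case: asboolP => fm.
  move=> s0 /eqP; rewrite subr_eq0 => /eqP l0.
  have [|tm hm] := fw m; first by exists y.
  by case: fm; rewrite leNgt ?tm ?hm.
case: asboolP => hm s0 l0; first by exists (phi l (theta m)), y.
exfalso; have hr : r / 2 <= `|h l m - c| <= r.
  apply/andP; split; first by move/negP: hm; rewrite -ltNge => /ltW.
  by rewrite leNgt; apply/negP => hr; apply: fm; right; exact: ltW.
have [hE hge] := th_in m hr.
have [|_] := fw (phi l (theta m)).
  by exists y; split=> //; apply/eqP; rewrite -subr_eq0; apply/eqP.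
by rewrite hE ltNge hge.
Qed.

End Family.

Lemma compact_norm_le n (c : R) : compact [set x : 'rV[R]_n | `|x| <= c].
Proof.
have [c0|c0] := ltP c 0.
  rewrite (_ : [set _ | _] = set0); first exact: compact0.
  by apply/seteqP; split=> x //= /le_lt_trans/(_ c0); rewrite normr_lt0.
have := @rV_compact R n (fun=> `[- c, c]%classic) (fun=> @segment_compact _ _ _).
congr compact; apply/seteqP; split=> x /= xc.
  apply: rV_norm_le => // i; have := xc i; rewrite in_itv /= => ?.
  by rewrite ler_norml.
move=> i; rewrite in_itv /= -ler_norml; exact: le_trans (coord_le_norm _ _) xc.
Qed.

Lemma cubeE n (x : 'rV[R]_n) : cube x <-> `|x| <= 1.
Proof.
split=> [xc|x1 i]; first exact: rV_norm_le.
exact: le_trans (coord_le_norm _ _) x1.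
Qed.

Section Start.
Variables (N : nat) (blk : 'I_N -> nat).
Variables (s : M * 'rV[R]_N -> 'rV[R]_N) (lam : M * 'rV[R]_N -> 'rV[R]_d).
Hypotheses (sc : continuous s) (lamc : continuous lam).
Hypothesis equiv : equivariant blk setT s lam.
Hypothesis lam1 : forall m y, cube y -> forall j, `|lam (m, y) 0 j| < 1.
Variables (l : 'I_L) (F : 'rV[R]_d -> 'rV[R]_d) (e : R).
Hypotheses (Fc : continuous F) (e1 : e <= 1 / 64).
Hypothesis Fh : forall m y, cube y -> s (m, y) = 0 -> `|F (lam (m, y)) - h l m| <= e.

(** The coordinate cube of radius 1/2, rescaled, is a cube as in [local_zero]; a
    zero of F is a value at which h is small on the fibre. *)
Lemma essential_start : exists w p, [/\ fibre s lam w p, 3 / 4 < tau l p,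
  `|h l p| <= 1 / 16 & essential blk s lam w (nbox l 0 (1 / 2))].
Proof.
pose b (x : 'rV[R]_d) := phi l (2^-1 *: x).
have bc : continuous b.
  apply: (comp_map_continuous (f := fun x : 'rV[R]_d => 2^-1 *: x)).
    by apply: scale_map_continuous; [exact: cst_continuous|move=> x; exact: cvg_id].
  exact: cc_map_continuous.
have hb x : cube x -> `|2^-1 *: x| <= 1 / 2 /\ h l (b x) = 2^-1 *: x.
  move=> /cubeE x1; have x2 : `|2^-1 *: x| <= 1 / 2.
    by rewrite normrZ gtr0_norm //; lra.
  by split=> //; apply: cc_mapK; lra.
have byc : continuous (fun p : 'rV[R]_d * 'rV[R]_N => (b p.1, p.2)).
  apply: pair_map_continuous; last by move=> p; exact: cvg_snd.
  exact: fst_map_continuous.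
have comp (V : topologicalType) (f : M * 'rV[R]_N -> V) : continuous f ->
    continuous (fun p : 'rV[R]_d * 'rV[R]_N => f (b p.1, p.2)).
  by move=> fc; exact: comp_map_continuous byc fc.
have [||||w [Fw wP]] := @local_zero R d N blk _ _ (fun w => 2 *: F w)
    (comp _ _ sc) (comp _ _ lamc) _.
- by apply: scale_map_continuous; [exact: cst_continuous|exact: Fc].
- by move=> i x y _ yc yb; exact: (equiv _ yc yb).
- by move=> x y _ yc j; exact: lam1.
- move=> x y xc yc s0 j; have [_ hbx] := hb x xc.
  have := Fh yc s0; rewrite /= hbx => Fe.
  have := le_trans (coord_le_norm (F (lam (b x, y)) - 2^-1 *: x) j) Fe.
  rewrite /= !mxE !ler_norml; move: (F _ 0 j) (x 0 j) e1 => u v e64 /andP[h1 h2].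
  by apply/andP; split; lra.
have Fw0 : F w = 0 by apply: (scalerI (a := 2)); rewrite ?scaler0.
have ess : essential blk s lam w (nbox l 0 (1 / 2)).
  move=> s' lam' s'c lam'c eq' ag.
  have [||x [y [xc yc s0 l0]]] := wP _ _ (comp _ _ s'c) (comp _ _ lam'c).
  - by move=> i x y _ yc yb; exact: (eq' _ _ _ _ yc yb).
  - move=> x y xc yc [j xj]; apply: ag => -[_].
    have [_ ->] := hb x xc; rewrite subr0 => h2.
    have := le_lt_trans (coord_le_norm _ j) h2.
    by rewrite mxE normrM xj gtr0_norm //; lra.
  by exists (b x), y.
have lwc : continuous (fun p => lam p - w).
  exact: sub_map_continuous lamc (@cst_continuous _ _ w).
have [||x [y [xc yc s0 l0]]] := wP _ _ (comp _ _ sc) (comp _ _ lwc).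
- by move=> i x y _ yc yb; exact: (equiv_sub equiv w (I : setT (b x)) yc yb).
- by [].
have lw : lam (b x, y) = w by apply/eqP; rewrite -subr_eq0; apply/eqP.
have [x2 hbx] := hb x xc; have := Fh yc s0; rewrite lw Fw0 sub0r normrN => he.
have e64 := e1.
exists w, (b x); split=> //; [by exists y| |by lra].
have -> : tau l (b x) = 1 - `|h l (b x)| by rewrite hbx; apply: cc_depth_map; lra.
by move: he; move: `|_| => t ht; lra.
Qed.

End Start.

(** The values [w] at which (s, lam - w) is essential over a box around the fibre
    are unbounded: they can be moved by steps of a length [eta] given by the
    uniform continuity of the functions Fh and Ft. But lam is bounded. *)
Theorem no_separating_family (m0 : M) : (0 < d)%N ->
  (forall m, exists l, 3 / 4 < tau l m) ->
  exists2 e, 0 < e & forall (N : nat) (blk : 'I_N -> nat)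
    (s : M * 'rV[R]_N -> 'rV[R]_N) (lam : M * 'rV[R]_N -> 'rV[R]_d)
    (Fh : 'I_L -> 'rV[R]_d -> 'rV[R]_d) (Ft : 'I_L -> 'rV[R]_d -> R),
    continuous s -> continuous lam -> equivariant blk setT s lam ->
    (forall m y, cube y -> forall j, `|lam (m, y) 0 j| < 1) ->
    (forall l, continuous (Fh l)) -> (forall l, continuous (Ft l)) ->
    ~ forall m y, cube y -> s (m, y) = 0 -> forall l,
      `|Fh l (lam (m, y)) - h l m| <= e /\ `|Ft l (lam (m, y)) - tau l m| <= e.
Proof.
move=> d0 cover.
have [r0 r00 rP] : exists2 r, 0 < r & forall ll : 'I_L * 'I_L, forall x x',
    `|x| <= 3 / 4 -> `|x'| <= 3 / 4 -> `|x - x'| < r ->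
    `|h ll.1 (phi ll.2 x) - h ll.1 (phi ll.2 x')| < 1 / 16 /\
    `|tau ll.1 (phi ll.2 x) - tau ll.1 (phi ll.2 x')| < 1 / 16.
  apply: finite_radius => [ll r r' rr' P x x' x1 x'1 xx'|[l l']].
    by apply: P => //; exact: lt_le_trans xx' rr'.
  have c1 : continuous (fun x => h l (phi l' x)).
    exact: comp_map_continuous (@cc_map_continuous _ _ _ _) (@cc_inv_continuous _ _ _ _).
  have c2 : continuous (fun x => tau l (phi l' x)).
    exact: comp_map_continuous (@cc_map_continuous _ _ _ _) (@cc_depth_continuous _ _ _ _).
  have p16 : 0 < 1 / 16 :> R by lra.
  have [r1 r10 h1] := unif_continuous_compact (@compact_norm_le d (3 / 4)) c1 p16.
  have [r2 r20 h2] := unif_continuous_compact (V := R^o) (@compact_norm_le d (3 / 4)) c2 p16.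
  exists (Num.min r1 r2); first by rewrite lt_min r10.
  by move=> x x' x1 x'1; rewrite lt_min => /andP[xx1 xx2]; split; [exact: h1|exact: h2].
(* Points with coordinates closer than [r] in one cube have coordinates closer
   than 1/16 in all cubes; fibres have diameter at most 3 [e], which is smaller
   than [r]. *)
pose r := Num.min r0 (1 / 4); have r_gt0 : 0 < r by rewrite lt_min r00 /=; lra.
have r4 : r <= 1 / 4 by rewrite ge_min lexx orbT.
pose e := r / 64; exists e; first by rewrite divr_gt0.
have e64 : e <= 1 / 256 by rewrite /e; lra.
have er : 3 * e < r by rewrite /e; lra.
have e0 : 0 < e by rewrite divr_gt0.
move=> N blk s lam Fh Ft sc lamc equiv lam1 Fhc Ftc H.
have lam_le m y : cube y -> `|lam (m, y)| <= 1.
  by move=> yc; apply: rV_norm_le => // j; apply/ltW/lam1.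
have [eta eta0 etaP] : exists2 r, 0 < r & forall l x x',
    `|x| <= 1 -> `|x'| <= 1 -> `|x - x'| < r ->
    `|Fh l x - Fh l x'| < e /\ `|Ft l x - Ft l x'| < e.
  apply: finite_radius => [l r1 r2 rr' P x x' x1 x'1 xx'|l].
    by apply: P => //; exact: lt_le_trans xx' rr'.
  have [r1 r10 h1] := unif_continuous_compact (@compact_norm_le d 1) (Fhc l) e0.
  have [r2 r20 h2] := unif_continuous_compact (V := R^o) (@compact_norm_le d 1) (Ftc l) e0.
  exists (Num.min r1 r2); first by rewrite lt_min r10.
  by move=> x x' x1 x'1; rewrite lt_min => /andP[xx1 xx2]; split; [exact: h1|exact: h2].
have fib w m w' m' l : fibre s lam w m -> fibre s lam w' m' -> `|w - w'| < eta ->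
    `|h l m - h l m'| <= 3 * e /\ `|tau l m - tau l m'| <= 3 * e.
  move=> [y [yc s0 lw]] [y' [yc' s0' lw']] ww.
  have [] := etaP l w w' _ _ ww; rewrite -?lw -?lw'; [exact: lam_le|exact: lam_le|].
  have [h1 t1] := H _ _ yc s0 l; have [h2 t2] := H _ _ yc' s0' l.
  move=> h3 t3; split.
    have -> : h l m - h l m' = - (Fh l (lam (m, y)) - h l m) +
        (Fh l (lam (m, y)) - Fh l (lam (m', y'))) + (Fh l (lam (m', y')) - h l m').
      by rewrite opprB !addrA subrK subrK.
    apply: le_trans (ler_normD _ _) _; apply: (@le_trans _ _ (e + e + e)); last by lra.
    apply: lerD h2; apply: le_trans (ler_normD _ _) _; rewrite normrN.
    by apply: lerD h1 (ltW h3).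
  by move: t1 t2 (ltW t3); rewrite !ler_norml; lra.
(* [p] is a witness that the fibre is not empty and near the centre of the box;
   after a step the cube [l] is replaced by one in which the new fibre is deep. *)
pose good w := exists l p c, [/\ 3 / 4 < tau l p, fibre s lam w p, `|c| <= 1 / 4,
  `|h l p - c| <= 1 / 16 & essential blk s lam w (nbox l c (1 / 2))].
have stepg w w' : `|w' - w| < eta -> good w -> good w'.
  move=> ww [l [p [c [tp fp c4 hc ess]]]].
  have near_p w1 m : `|w - w1| < eta -> fibre s lam w1 m ->
      3 / 4 - 3 * e < tau l m /\ `|h l m - c| <= 3 * e + 1 / 16.
    move=> w1e fm; have [h1 t1] := fib _ _ _ _ l fp fm w1e; split.
      by move: t1; rewrite ler_norml; lra.
    rewrite -(subrKA (h l p)); apply: le_trans (ler_normD _ _) _.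
    by apply: lerD => //; rewrite distrC.
  have ess' : essential blk s lam w' (nbox l c (1 / 4)).
    apply: (essential_shift c4 _ ess) => t m t01 fm.
    have [|t1 h1] := near_p _ _ _ fm; last by split; lra.
    have -> : w - (w' - t *: (w' - w)) = (t - 1) *: (w' - w).
      by rewrite scalerBl scale1r opprB addrA addrAC [RHS]addrC opprB addrC addrA addrAC.
    apply: le_lt_trans ww; rewrite normrZ ler_piMl // ler_norml; lra.
  have [p' fp'] := essential_fibre sc lamc equiv ess'.
  have ww' : `|w - w'| < eta by rewrite distrC.
  have [tp' hp'] := near_p _ _ ww' fp'.
  have [l' tl'] := cover p'; have [pE hn] := @cc_invK l' p' ltac:(lra).
  exists l', p', (h l' p'); split=> //; [lra|by rewrite subrr normr0; lra|].
  apply: (essential_enlarge sc lamc equiv (r := r)); [lra|by rewrite r_gt0| |].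
    move=> m fm; have [|h1 t1] := fib _ _ _ _ l' fp' fm; first by rewrite subrr normr0.
    by split; [move: t1; rewrite ler_norml|rewrite distrC]; lra.
  apply: essentialW ess' => q [tq hq].
  have [qE hqn] := @cc_invK l' q (ltW tq).
  have [|||h1 t1] := rP (l, l') (h l' q) (h l' p').
  - lra.
  - lra.
  - by apply: lt_le_trans hq _; rewrite ge_min lexx.
  move: h1 t1 => /=; rewrite qE pE => h1 t1; split.
    by move: t1; rewrite ltr_norml; lra.
  rewrite -(subrKA (h l p')); apply: le_lt_trans (ler_normD _ _) _; lra.
have [l0 _] := cover m0.
have [|w0 [p0 [fp0 tp0 hp0 ess0]]] := essential_start (e := e) sc lamc equiv lam1 (Fhc l0) _
    (fun m y yc s0 => (H m y yc s0 l0).1); first by lra.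
pose w k : 'rV[R]_d := w0 + (k%:R * (eta / 2)) *: const_mx 1.
have good_w k : good (w k).
  elim: k => [|k IH].
    exists l0, p0, 0; rewrite /w mul0r scale0r addr0 normr0 subr0.
    by split=> //; lra.
  apply: stepg IH; rewrite /w opprD addrACA subrr add0r -scalerBl -mulrBl.
  rewrite -natrB ?leqnSn // subSnn mul1r normrZ gtr0_norm ?divr_gt0 //.
  apply: (@le_lt_trans _ _ (eta / 2 * 1)); last by lra.
  apply: ler_wpM2l; first by rewrite divr_ge0 // ltW.
  by apply: rV_norm_le => // j; rewrite mxE normr1.
have wlt k (j : 'I_d) : `|w k 0 j| < 1.
  by have [l [p [c [_ [y [yc _ <-]] _ _ _]]]] := good_w k; exact: lam1.
pose j0 := Ordinal d0; have e20 : 0 < eta / 2 by rewrite divr_gt0.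
have := archi_boundP (ltW (divr_gt0 (ltr0n R 2) e20)).
set k := Num.bound _; rewrite ltr_pdivrMr // => hk.
have := wlt 0%N j0; have := wlt k j0.
rewrite /w mul0r scale0r addr0 !mxE mulr1 !ltr_norml => /andP[_ h1] /andP[h2 _].
by move: h1 h2 hk; move: (w0 0 j0) (k%:R * (eta / 2)) => a b; lra.
Qed.

End Transport.

(** * Coordinate cubes of a manifold *)

Lemma locally_continuous (X Y : topologicalType) (f : X -> Y) :
  (forall x, exists U g, [/\ open U, U x, {for x, continuous g} &
     forall z, U z -> f z = g z]) -> continuous f.
Proof.
move=> h x A fA; have [U [g [oU Ux gx fg]]] := h x.
have gA : nbhs x (g @^-1` A) by apply: gx; rewrite -fg.
have Un : nbhs x U by exact: open_nbhs_nbhs.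
by apply: filterS (filterI gA Un) => z [gz Uz]; rewrite /= fg.
Qed.

Lemma comp_continuous_at (X Y Z : topologicalType) (f : X -> Y) (g : Y -> Z) x :
  {for x, continuous f} -> {for f x, continuous g} -> {for x, continuous (fun z => g (f z))}.
Proof. by move=> fx gx; apply: continuous_comp. Qed.

(** A small cube around the image of [m0] under the chart, with [cl] as the
    retraction of R^d to it. The coordinates are multiplied by a cutoff in order
    to extend them by zero; M must be Hausdorff for the image of the cube to be
    closed, so that these extensions are continuous. *)
Lemma coord_cube_at (R : realType) (d : nat) (M : topologicalType)
    (c : chart R M d) (m0 : M) : hausdorff_space M -> chart_dom c m0 ->
  exists k : coord_cube R d M, cc_depth k m0 = 1.
Proof.
move=> hM m0d; pose f := chart_fun c; pose g := chart_inv c; pose D := chart_dom c.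
have oD : open D := @chart_dom_open _ _ _ c.
have fc m : D m -> {for m, continuous f}.
  move=> Dm; have := @chart_fun_continuous _ _ _ c.
  by rewrite continuous_open_subspace // => /(_ m); apply; rewrite inE.
have oI : open (f @` D) := @chart_im_open _ _ _ c.
have gc u : (f @` D) u -> {for u, continuous g}.
  move=> Iu; have := @chart_inv_continuous _ _ _ c.
  by rewrite continuous_open_subspace // => /(_ u); apply; rewrite inE.
have gK m : D m -> g (f m) = m := @chart_funK _ _ _ c m.
pose a := f m0.
have [e e0 eI] : exists2 e, 0 < e & forall u, `|u - a| <= e -> (f @` D) u.
  have /nbhs_ballP[e /= e0 eI] : nbhs a (f @` D).
    by apply: open_nbhs_nbhs; split=> //; exists m0.
  exists (e / 2); first by rewrite divr_gt0.
  move=> u ue; apply: eI; rewrite -ball_normE /ball_ /= distrC.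
  by apply: le_lt_trans ue _; rewrite ltr_pdivrMr // ltr_pMr // ltr1n.
pose cl (x : 'rV[R]_d) : 'rV[R]_d := \row_i Num.min 1 (Num.max (-1) (x 0 i)).
have clc : continuous cl.
  apply: rV_continuous => j; under eq_fun do rewrite mxE.
  apply: min_map_continuous; first exact: cst_continuous.
  apply: max_map_continuous; first exact: cst_continuous.
  exact: coord_continuous.
have cl1 x : `|cl x| <= 1.
  apply: rV_norm_le => // i; rewrite mxE ler_norml le_min ge_min lexx /= andbT.
  by rewrite le_max lexx /=; lra.
have clE x : `|x| <= 1 -> cl x = x.
  move=> /cubeE x1; apply/rowP => i; rewrite mxE; have := x1 i.
  by rewrite ler_norml => /andP[x1i x2i]; rewrite max_r // min_r.
pose b x := g (a + e *: cl x).
have bI x : (f @` D) (a + e *: cl x).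
  apply: eI; rewrite addrAC subrr add0r normrZ gtr0_norm //.
  by rewrite -[leRHS]mulr1 ler_wpM2l // ltW.
have bc : continuous b.
  have ic : continuous (fun x => a + e *: cl x).
    apply: add_map_continuous; first exact: cst_continuous.
    by apply: scale_map_continuous; first exact: cst_continuous.
  by move=> x; exact: (comp_continuous_at (ic x) (gc _ (bI x))).
have fb x : f (b x) = a + e *: cl x /\ D (b x).
  by have [m Dm fm] := bI x; rewrite /b -fm gK.
pose B := b @` [set x | `|x| <= 1].
have cB : closed B.
  apply: compact_closed => //; apply: continuous_compact; last exact: compact_norm_le.
  exact: continuous_subspaceT.
pose t m := Num.max 0 (1 - e^-1 * `|f m - a|).
have tB m : D m -> ~ B m -> t m = 0.
  move=> Dm nB; apply/max_idPl; rewrite subr_le0 leNgt; apply/negP => lt1; apply: nB.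
  exists (e^-1 *: (f m - a)); first by rewrite /= normrZ gtr0_norm ?invr_gt0 // ltW.
  rewrite /b clE; last by rewrite normrZ gtr0_norm ?invr_gt0 // ltW.
  by rewrite scalerA divff ?lt0r_neq0 // scale1r addrC subrK gK.
have extc (V : normedModType R) (p : M -> V) : (forall m, D m -> {for m, continuous p}) ->
    (forall m, D m -> ~ B m -> p m = 0) ->
    continuous (fun m => if `[< D m >] then p m else 0).
  move=> pc p0; apply: locally_continuous => m.
  have [Dm|nD] := pselect (D m).
    exists D, p; split=> // [|z Dz]; first exact: pc.
    by rewrite asboolT.
  exists (~` B), (fun=> 0); split=> //.
  - exact: closed_openC.
  - by move=> [x _ xm]; apply: nD; rewrite -xm; exact: (fb x).2.
  - exact: cvg_cst.
  - by move=> z nB; case: asboolP => // Dz; exact: p0.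
have uc : continuous (fun u : 'rV[R]_d => u - a).
  by apply: sub_map_continuous; [move=> u; exact: cvg_id|exact: cst_continuous].
have Tc : continuous (fun u : 'rV[R]_d => Num.max 0 (1 - e^-1 * `|u - a|)).
  apply: max_map_continuous; first exact: cst_continuous.
  apply: sub_map_continuous; first exact: cst_continuous.
  apply: mul_map_continuous; first exact: cst_continuous.
  exact: (comp_map_continuous uc (@norm_continuous _ _)).
have tc m : D m -> {for m, continuous t}.
  by move=> Dm; exact: (comp_continuous_at (fc _ Dm) (Tc (f m))).
pose p m := Num.min 1 (4 * t m) *: (e^-1 *: (f m - a)).
have pc m : D m -> {for m, continuous p}.
  have Pc : continuous (fun u : 'rV[R]_d =>
      Num.min 1 (4 * Num.max 0 (1 - e^-1 * `|u - a|)) *: (e^-1 *: (u - a))).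
    apply: scale_map_continuous; last by apply: scale_map_continuous => //; exact: cst_continuous.
    apply: min_map_continuous; first exact: cst_continuous.
    by apply: mul_map_continuous; first exact: cst_continuous.
  by move=> Dm; exact: (comp_continuous_at (fc _ Dm) (Pc (f m))).
have pB m : D m -> ~ B m -> p m = 0.
  by move=> Dm nB; rewrite /p tB // mulr0 min_r // scale0r.
have bfE x : e^-1 *: (f (b x) - a) = cl x.
  by have [-> _] := fb x; rewrite addrAC subrr add0r scalerA mulVf ?lt0r_neq0 // scale1r.
have tb x : `|x| <= 1 -> t (b x) = 1 - `|x|.
  move=> x1; have := bfE x; rewrite /t clE // => h.
  have -> : e^-1 * `|f (b x) - a| = `|x|.
    by rewrite -[in RHS]h normrZ [`|e^-1|]gtr0_norm ?invr_gt0.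
  by rewrite max_r // subr_ge0.
pose h' m := if `[< D m >] then p m else 0.
pose t' m : R := if `[< D m >] then t m else 0.
have Db x : `[< D (b x) >] = true by apply: asboolT; exact: (fb x).2.
have hK x : `|x| <= 3 / 4 -> h' (b x) = x.
  move=> x1; rewrite /h' Db /p tb; last by lra.
  rewrite bfE clE; last by lra.
  by rewrite min_l ?scale1r //; lra.
have tK x : `|x| <= 1 -> t' (b x) = 1 - `|x| by move=> x1; rewrite /t' Db tb.
have t0 m : 0 < t' m -> exists2 x, `|x| = 1 - t' m & m = b x.
  rewrite /t'; case: asboolP => Dm; last by rewrite ltxx.
  rewrite /t lt_max ltxx /= => pos; exists (e^-1 *: (f m - a)).
    rewrite max_r; last exact: ltW.
    by rewrite normrZ gtr0_norm ?invr_gt0 // subKr.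
  rewrite /b clE; last by rewrite normrZ gtr0_norm ?invr_gt0 //; lra.
  by rewrite scalerA divff ?lt0r_neq0 // scale1r addrC subrK gK.
exists (@CoordCube R d M b h' t' bc (extc _ _ pc pB) (extc R^o t tc tB) hK tK t0).
by rewrite /= /t' asboolT // /t subrr normr0 mulr0 subr0 max_r.
Qed.

Lemma finite_coord_cubes (R : realType) (d : nat) (M : topologicalType)
    (At : set (chart R M d)) : smooth_manifold At -> compact [set: M] ->
  exists L (cc : 'I_L -> coord_cube R d M), forall m, exists l, 3 / 4 < cc_depth (cc l) m.
Proof.
move=> [hM _ [cov _]] cM.
have /choice[k kP] : forall m, exists k : coord_cube R d M, cc_depth k m = 1.
  by move=> m; have [c _ cm] := cov m; exact: coord_cube_at hM cm.
pose F : set_system (seq M) := fun A => exists s0 : seq M, forall s, {subset s0 <= s} -> A s.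
have FF : Filter F.
  split=> [|A B [s1 A1] [s2 B2]|A B AB [s1 A1]].
  - by exists [::].
  - exists (s1 ++ s2) => s ss; split; [apply: A1|apply: B2] => z zs; apply: ss.
      by rewrite mem_cat zs.
    by rewrite mem_cat zs orbT.
  - by exists s1 => s ss; apply: AB; exact: A1.
have [|s sP] := (compact_near_coveringP [set: M]).1 cM _ F
    (fun (s : seq M) z => exists2 m, m \in s & 3 / 4 < cc_depth (k m) z) FF.
  move=> m _; exists ([set z | 3 / 4 < cc_depth (k m) z], [set s : seq M | m \in s]) => /=.
    split; last by exists [:: m] => s ss /=; apply: ss; rewrite inE.
    apply: (@cc_depth_continuous _ _ _ (k m) m [set x | 3 / 4 < x]).
    by apply: open_nbhs_nbhs; split; [exact: open_gt|rewrite /= kP; lra].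
  by move=> [z s] /= [zm ms]; exists m.
exists (size s), (fun l => k (tnth (in_tuple s) l)) => m.
have [z zs zm] := sP s (fun _ => id) m I.
have ilt : (index z s < size s)%N by rewrite index_mem.
by exists (Ordinal ilt); rewrite (tnth_nth z) /= nth_index.
Qed.
(** * Contractivity of morphisms of C*-algebras *)

Section RealNorm.
Context {R : realType}.
Local Notation C := R[i].

(** Norms have values in R[i]; their real parts can be compared with linear
    arithmetic. *)
Definition nrm (V : normedModType C) (x : V) : R := complex.Re `|x|.

Lemma ge0_complexE (z : C) : 0 <= z -> z = (complex.Re z)%:C%C.
Proof. by case: z => a b; rewrite lecE /= => /andP[/eqP -> _]. Qed.

Lemma conj_realE (r : R) : (r%:C%C : C)^* = r%:C%C.
Proof. exact: conjc_real. Qed.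

Lemma ler_complexE (a b : R) : (a%:C%C <= b%:C%C :> C) = (a <= b).
Proof. by rewrite lecE /= eqxx. Qed.

Lemma ltr_complexE (a b : R) : (a%:C%C < b%:C%C :> C) = (a < b).
Proof. by rewrite ltcE /= eqxx. Qed.

Section Module.
Context {V : normedModType C}.
Implicit Types x y z : V.

Lemma normE x : `|x| = (nrm x)%:C%C.
Proof. exact: ge0_complexE. Qed.

Lemma nrm_ge0 x : 0 <= nrm x.
Proof. by rewrite -ler_complexE -normE; exact: normr_ge0. Qed.

Lemma nrmD x y : nrm (x + y) <= nrm x + nrm y.
Proof. by rewrite -ler_complexE rmorphD /= -!normE ler_normD. Qed.

Lemma nrmN x : nrm (- x) = nrm x.
Proof. by rewrite /nrm normrN. Qed.

Lemma nrmB x y : nrm (x - y) = nrm (y - x).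
Proof. by rewrite /nrm distrC. Qed.

Lemma nrm_triangle y x z : nrm (x - z) <= nrm (x - y) + nrm (y - z).
Proof. by apply: le_trans (nrmD _ _); rewrite addrA subrK. Qed.

Lemma nrm0 : nrm (0 : V) = 0.
Proof. by rewrite /nrm normr0. Qed.

Lemma nrm_eq0 x : nrm x = 0 -> x = 0.
Proof. by move=> x0; apply: normr0_eq0; rewrite normE x0. Qed.

Lemma nrmZ (c : C) x : nrm (c *: x) = complex.Re `|c| * nrm x.
Proof.
rewrite /nrm normrZ normE [`|c|]ge0_complexE //.
by rewrite -rmorphM.
Qed.

Lemma nrmZr (c : R) x : nrm (c%:C%C *: x) = `|c| * nrm x.
Proof. by rewrite nrmZ normc_def /= expr0n addr0 sqrtr_sqr. Qed.

Lemma nrm_small x (k : R) : (forall e, 0 < e -> nrm x <= k * e) -> x = 0.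
Proof.
move=> sx; apply: nrm_eq0; apply/eqP; rewrite eq_le nrm_ge0 andbT.
apply/ler_addgt0Pr => e e0; rewrite add0r.
have k0 : 0 < `|k| + 1 by rewrite ltr_wpDl.
have := sx (e / (`|k| + 1)) (divr_gt0 e0 k0) => /le_trans; apply.
have : k * (e / (`|k| + 1)) <= `|k| * (e / (`|k| + 1)).
  by rewrite ler_wpM2r ?ler_norm // ltW // divr_gt0.
move=> /le_trans; apply; rewrite mulrA ler_pdivrMr // mulrC ler_wpM2l ?(ltW e0) //.
by rewrite lerDl.
Qed.
End Module.

Lemma nrm_complete (V : completeNormedModType C) (u : nat -> V) :
  (forall e, 0 < e -> exists N, forall m n, (N <= m)%N -> (N <= n)%N ->
     nrm (u m - u n) <= e) ->
  exists l, forall e, 0 < e -> exists N, forall n, (N <= n)%N ->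
     nrm (u n - l) <= e.
Proof.
move=> uC.
have : cvgn u.
  apply/cauchy_cvgP; apply/cauchy_ballP => e e0.
  have eE : e = (complex.Re e)%:C%C by apply/ge0_complexE/ltW.
  have r0 : 0 < complex.Re e by rewrite -ltr_complexE -eE.
  have [N uN] := uC _ (divr_gt0 r0 (ltr0n _ 2)).
  exists (u @` [set n | (N <= n)%N], u @` [set n | (N <= n)%N]).
    by split; exists N => // n Nn; exists n.
  move=> [_ _] [/= [m Nm <-] [n Nn <-]]; rewrite -ball_normE /=.
  rewrite normE eE ltr_complexE (le_lt_trans (uN _ _ Nm Nn)) //.
  by rewrite ltr_pdivrMr // ltr_pMr // (ltr_nat _ 1 2).
move=> /cvg_ex[l /cvgrPdist_le ul]; exists l => e e0.
have [|N _ uN] := ul e%:C%C; first by rewrite -[0]/(0%:C%C) ltr_complexE.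
exists N => n Nn; rewrite nrmB -ler_complexE -normE.
exact: uN.
Qed.
End RealNorm.

Section Contractive.
Context {R : realType}.
Local Notation C := R[i].

Section Algebra.
Variable A : cstarAlgType C.
Implicit Types x y z h u : A.

Lemma smul0l x : smul 0 x = 0.
Proof. by rewrite -(scale0r x) smulZl !scale0r. Qed.
Lemma smul0r x : smul x 0 = 0.
Proof. by rewrite -(scale0r x) smulZr !scale0r. Qed.
Lemma smulNl x y : smul (- x) y = - smul x y.
Proof. by rewrite -(scaleN1r x) smulZl scaleN1r. Qed.
Lemma smulNr x y : smul x (- y) = - smul x y.
Proof. by rewrite -(scaleN1r y) smulZr scaleN1r. Qed.
Lemma smulBl x y z : smul (x - y) z = smul x z - smul y z.
Proof. by rewrite smulDl smulNl. Qed.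
Lemma smulBr x y z : smul x (y - z) = smul x y - smul x z.
Proof. by rewrite smulDr smulNr. Qed.
Lemma starN x : star (- x) = - star x.
Proof. by rewrite -(scaleN1r x) starZ rmorphN1 scaleN1r. Qed.
Lemma starB x y : star (x - y) = star x - star y.
Proof. by rewrite starD starN. Qed.
Lemma star1 : star (sone : A) = sone.
Proof. by rewrite -[LHS]smul1l -{1}[sone]starK -starM smul1l starK. Qed.

Lemma nrmM x y : nrm (smul x y) <= nrm x * nrm y.
Proof. by rewrite -ler_complexE rmorphM /= -!normE normr_smul_le. Qed.

Lemma nrm_star_smul x : nrm (smul (star x) x) = nrm x ^+ 2.
Proof. by apply: (@complexI R); rewrite rmorphXn /= -!normE normr_star_smul. Qed.

Lemma nrm_star_le x : nrm x <= nrm (star x).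
Proof.
have := nrm_ge0 x; rewrite le_eqVlt => /predU1P[<-|x0]; first exact: nrm_ge0.
by rewrite -(ler_pM2r x0) -expr2 -nrm_star_smul nrmM.
Qed.

Lemma nrm_star x : nrm (star x) = nrm x.
Proof. by apply/eqP; rewrite eq_le nrm_star_le -{2}[x]starK nrm_star_le. Qed.

Lemma nrm_isometry_le1 u : smul (star u) u = sone -> nrm u <= 1.
Proof.
have n1 : nrm (sone : A) <= 1.
  have := nrm_star_smul (sone : A); rewrite star1 smul1l => E.
  have := nrm_ge0 (sone : A); rewrite le_eqVlt => /predU1P[<- //|x0].
  by rewrite -(ler_pM2r x0) -expr2 mul1r -E.
move=> uu; have := nrm_star_smul u; rewrite uu => E.
by rewrite -(@expr_le1 _ 2) ?nrm_ge0 // -E.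
Qed.

(** For a self-adjoint h with |h| < 1, the square root of 1 - h^2 is 1 - y with
    y the fixed point of y |-> (h^2 + y^2) / 2, a contraction of the ball of
    radius |h|. *)
Lemma sqrt_one_sub_square h : star h = h -> nrm h < 1 ->
  exists k, [/\ star k = k, smul k h = smul h k
    & smul k k = sone - smul h h].
Proof.
move=> hs h1; set r := nrm h; set b := smul h h.
pose F (y : A) : A := (2^-1)%:C%C *: (b + smul y y).
pose u n := iter n F 0.
have two : `|2^-1 : R| = 2^-1 by rewrite ger0_norm // invr_ge0.
have r0 : 0 <= r := nrm_ge0 h.
have ur n : nrm (u n) <= r.
  elim: n => [|n IH] /=; first by rewrite nrm0.
  rewrite /F nrmZr two.
  have := nrmD b (smul (u n) (u n)); have := nrmM h h; have := nrmM (u n) (u n).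
  rewrite -/b -/r; have := nrm_ge0 (u n).
  move: (nrm (u n)) IH => t tr t0 H1 H2 H3.
  have : t * t <= r * r by rewrite ler_pM.
  have : r * r <= r by rewrite ler_piMr // ltW.
  by move: H1 H2 H3; rewrite /r; lra.
have us n : star (u n) = u n.
  elim: n => [|n IH] /=; first by rewrite -(scale0r (0 : A)) starZ rmorph0 !scale0r.
  rewrite /F starZ starD !starM hs -/(u n) IH; congr (_ *: _).
  by rewrite conj_realE.
have uh n : smul (u n) h = smul h (u n).
  elim: n => [|n IH] /=; first by rewrite smul0l smul0r.
  rewrite /F smulZl smulZr smulDl smulDr -/(u n) /b !smulA; congr (_ *: (_ + _)).
  by rewrite -smulA IH smulA IH.
have step m n : nrm (u m.+1 - u n.+1) <= r * nrm (u m - u n).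
  rewrite /= /F -scalerBr nrmZr two opprD addrACA subrr add0r -/(u m) -/(u n).
  have -> : smul (u m) (u m) - smul (u n) (u n) =
      smul (u m) (u m - u n) + smul (u m - u n) (u n).
    by rewrite smulBl smulBr addrA subrK.
  have := nrmD (smul (u m) (u m - u n)) (smul (u m - u n) (u n)).
  have := nrmM (u m) (u m - u n); have := nrmM (u m - u n) (u n).
  have := ur m; have := ur n; have := nrm_ge0 (u m - u n).
  move: (nrm (u m - u n)) (nrm (u m)) (nrm (u n)) => t a c t0 cr ar H1 H2 H3.
  have : t * c <= t * r by rewrite ler_wpM2l.
  have : a * t <= r * t by rewrite ler_wpM2r.
  by move: H1 H2 H3; lra.
have cau N a c : nrm (u (N + a)%N - u (N + c)%N) <= r ^+ N * (2 * r).
  elim: N => [|N IH].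
    rewrite !add0n expr0 mul1r; have := nrmD (u a) (- u c); rewrite nrmN.
    by have := ur a; have := ur c; lra.
  rewrite !addSn (le_trans (step _ _)) // exprS -mulrA.
  by rewrite ler_wpM2l.
have [l ul] : exists l, forall e, 0 < e -> exists N, forall n, (N <= n)%N ->
     nrm (u n - l) <= e.
  apply: nrm_complete => e e0.
  have : (r ^+ n * (2 * r)) @[n --> \oo] --> 0.
    rewrite -[X in _ --> X](mul0r (2 * r)); apply: cvgMl.
    by apply: cvg_expr; rewrite ger0_norm.
  move=> /cvgrPdist_le /(_ e e0)[N _ /(_ N (leqnn N))] /=.
  rewrite sub0r normrN ger0_norm; last by rewrite !mulr_ge0 // exprn_ge0.
  move=> rN; exists N => m n Nm Nn.
  by rewrite -(subnKC Nm) -(subnKC Nn) (le_trans (cau _ _ _)).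
have lr : nrm l <= r.
  apply/ler_addgt0Pr => e e0; have [N /(_ N (leqnn N)) uN] := ul e e0.
  have := nrmD (u N) (l - u N); rewrite addrC subrK nrmB.
  by have := ur N; lra.
have ls : star l = l.
  apply/eqP; rewrite -subr_eq0; apply/eqP; apply: (@nrm_small _ _ _ 2) => e e0.
  have [N /(_ N (leqnn N)) uN] := ul e e0.
  have := nrm_triangle (star (u N)) (star l) l.
  rewrite -starB nrm_star us [nrm (l - _)]nrmB; lra.
have lh : smul l h = smul h l.
  apply/eqP; rewrite -subr_eq0; apply/eqP; apply: (@nrm_small _ _ _ (2 * r)) => e e0.
  have [N /(_ N (leqnn N)) uN] := ul e e0.
  have := nrm_triangle (smul (u N) h) (smul l h) (smul h l).
  rewrite {2}uh -smulBl -smulBr.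
  have := nrmM (l - u N) h; have := nrmM h (u N - l); rewrite [nrm (l - _)]nrmB -/r.
  have : nrm (u N - l) * r <= e * r by rewrite ler_wpM2r.
  by lra.
have lF : l = F l.
  apply/eqP; rewrite -subr_eq0; apply/eqP; apply: (@nrm_small _ _ _ (1 + r)) => e e0.
  have [N uN] := ul e e0.
  have uN1 := uN N.+1 (leqnSn N); have {}uN := uN N (leqnn N).
  have := nrm_triangle (u N.+1) l (F l).
  rewrite [nrm (l - u _)]nrmB.
  rewrite [X in nrm (X - F l)]/= /F -scalerBr nrmZr two opprD addrACA subrr add0r -/(u N).
  have -> : smul (u N) (u N) - smul l l =
      smul (u N) (u N - l) + smul (u N - l) l.
    by rewrite smulBl smulBr addrA subrK.
  have := nrmD (smul (u N) (u N - l)) (smul (u N - l) l).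
  have := nrmM (u N) (u N - l); have := nrmM (u N - l) l.
  have := ur N; have := nrm_ge0 (u N - l); have := nrm_ge0 l; have := nrm_ge0 (u N).
  move: uN uN1 lr; move: (nrm (u N - l)) (nrm (u N.+1 - l)) (nrm (u N)) (nrm l) => t t' a c.
  move=> te te' cr a0 c0 t0 ar H1 H2 H3.
  have : t * c <= e * r by rewrite ler_pM.
  have : a * t <= r * e by rewrite ler_pM.
  by move: H1 H2 H3; lra.
exists (sone - l); split.
- by rewrite starB star1 ls.
- by rewrite smulBl smulBr lh smul1l smul1r.
- have ll : smul l l = l + l - b.
    have : (2%:R)%:C%C *: l = (2%:R)%:C%C *: F l by rewrite -lF.
    rewrite /F scalerA -rmorphM /= mulfV ?pnatr_eq0 // scale1r rmorph_nat scaler_nat.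
    by rewrite mulr2n => ->; rewrite addrAC subrr add0r.
  rewrite smulBl !smulBr !smul1l smul1r ll.
  by rewrite opprB [l + l - b - l]addrAC addrK addrA subrK.
Qed.

End Algebra.

Section Morphism.
Variables (A B : cstarAlgType C) (f : A -> B).
Hypothesis fm : star_morphism f.

Let fD x y : f (x + y) = f x + f y.
Proof. by have [fl _ _ _] := fm; have := fl 1 x y; rewrite !scale1r. Qed.
Let f0 : f 0 = 0.
Proof. by apply: (addIr (f 0)); rewrite -fD !add0r. Qed.
Let fZ c x : f (c *: x) = c *: f x.
Proof. by have [fl _ _ _] := fm; have := fl c x 0; rewrite f0 !addr0. Qed.

(** A self-adjoint h with |h| < 1 is the real part of the unitary
    h + i sqrt(1 - h^2), and a morphism maps unitaries to unitaries, which have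
    norm at most 1. *)
Lemma selfadjoint_contractive h : star h = h -> nrm h < 1 -> nrm (f h) <= 1.
Proof.
move=> hs h1; have [k [ks kh kk]] := sqrt_one_sub_square hs h1.
have [_ fM f1 fs] := fm.
have uni (c : C) : c^* = - c -> c * c = -1 -> nrm (f (h + c *: k)) <= 1.
  move=> cN cc; apply: nrm_isometry_le1; rewrite -fs -fM -f1; congr f.
  rewrite starD starZ hs ks cN smulDl !smulDr !smulZl !smulZr kh kk.
  rewrite scalerA mulNr cc opprK scale1r !scaleNr addrACA.
  by rewrite addrA subrK addrC subrK.
have u1 := uni 'i (conjCi _) (etrans (esym (expr2 _)) (sqrCi _)).
have u2 : nrm (f (h + (- 'i : C) *: k)) <= 1.
  by apply: uni; [rewrite rmorphN; congr (- _); exact: conjCi|rewrite mulrNN -expr2 sqrCi].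
have E : f (h + 'i *: k) + f (h + - 'i *: k) = (2%:R : R)%:C%C *: f h.
  by rewrite -fD -fZ scaleNr addrACA subrr addr0 -mulr2n rmorph_nat scaler_nat.
have := nrmD (f (h + 'i *: k)) (f (h + - 'i *: k)).
by rewrite E nrmZr ger0_norm //; lra.
Qed.

(** The C*-identity reduces the claim to self-adjoint elements. *)
Lemma star_morphism_contractive a : nrm (f a) <= nrm a.
Proof.
have [_ fM _ fs] := fm.
have sa h : star h = h -> nrm (f h) <= nrm h.
  move=> hs; apply/ler_addgt0Pr => e e0; set r := nrm h + e.
  have r0 : 0 < r by rewrite /r; have := nrm_ge0 h; lra.
  have ri : `|r^-1| = r^-1 by rewrite ger0_norm // invr_ge0 ltW.
  have := @selfadjoint_contractive ((r^-1)%:C%C *: h).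
  rewrite starZ conj_realE hs => /(_ erefl).
  rewrite fZ !nrmZr ri ![r^-1 * _]mulrC ltr_pdivrMr // ler_pdivrMr // !mul1r.
  by apply; rewrite /r ltrDl.
rewrite -(@ler_pXn2r _ 2) ?nnegrE ?nrm_ge0 // -!nrm_star_smul -fs -fM.
by apply: sa; rewrite starM starK.
Qed.
End Morphism.
End Contractive.
(** * Bounded sequences modulo null sequences *)

(** [nf_bnd c a] says that the norm of [a] is at most [c]. With bounds instead of
    a norm, no supremum over the points of a space has to be taken in the
    application. *)
Record normed_family (R : realType) := NormedFamily {
  nf_alg :> nat -> starAlgType R[i];
  nf_bnd : forall n, R -> nf_alg n -> Prop;
  nf_bnd_ge0 : forall n c (a : nf_alg n), nf_bnd c a -> 0 <= c;
  nf_bnd_mono : forall n c c' (a : nf_alg n), c <= c' ->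
    nf_bnd c a -> nf_bnd c' a;
  nf_bnd0 : forall n, nf_bnd 0 (0 : nf_alg n);
  nf_bnd1 : forall n, nf_bnd 1 (sone : nf_alg n);
  nf_bndD : forall n c c' (a b : nf_alg n), nf_bnd c a -> nf_bnd c' b ->
    nf_bnd (c + c') (a + b);
  nf_bndZ : forall n c (k : R[i]) (a : nf_alg n), nf_bnd c a ->
    nf_bnd (complex.Re `|k| * c) (k *: a);
  nf_bndM : forall n c c' (a b : nf_alg n), nf_bnd c a -> nf_bnd c' b ->
    nf_bnd (c * c') (smul a b);
  nf_bnd_star : forall n c (a : nf_alg n), nf_bnd c a -> nf_bnd c (star a);
  nf_bnd_cstar : forall n c (a : nf_alg n), 0 <= c ->
    nf_bnd (c ^+ 2) (smul (star a) a) -> nf_bnd c a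
}.
Arguments nf_bnd {R} F {n} c a : rename.

Section BoundedSequences.
Context {R : realType} (F : normed_family R).
Local Notation C := R[i].

Record bounded_seq := BoundedSeq {
  bs_fun :> forall n, F n;
  bs_bound : exists c, \forall n \near \oo, nf_bnd F c (bs_fun n)
}.

HB.instance Definition _ := gen_eqMixin bounded_seq.
HB.instance Definition _ := gen_choiceMixin bounded_seq.

Implicit Types a b : bounded_seq.

Lemma bs0_subproof : exists c, \forall n \near \oo, nf_bnd F c (0 : F n).
Proof. by exists 0; apply: nearW => n; exact: nf_bnd0. Qed.
Lemma bs1_subproof : exists c, \forall n \near \oo, nf_bnd F c (sone : F n).
Proof. by exists 1; apply: nearW => n; exact: nf_bnd1. Qed.
Lemma bsD_subproof a b :
  exists c, \forall n \near \oo, nf_bnd F c (a n + b n).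
Proof.
have [ca Ha] := bs_bound a; have [cb Hb] := bs_bound b; exists (ca + cb).
by near=> n; apply: nf_bndD; near: n.
Unshelve. all: by end_near. Qed.
Lemma bsZ_subproof (k : C) a :
  exists c, \forall n \near \oo, nf_bnd F c (k *: a n).
Proof.
have [ca Ha] := bs_bound a; exists (complex.Re `|k| * ca).
by near=> n; apply: nf_bndZ; near: n.
Unshelve. all: by end_near. Qed.
Lemma bsM_subproof a b :
  exists c, \forall n \near \oo, nf_bnd F c (smul (a n) (b n)).
Proof.
have [ca Ha] := bs_bound a; have [cb Hb] := bs_bound b; exists (ca * cb).
by near=> n; apply: nf_bndM; near: n.
Unshelve. all: by end_near. Qed.
Lemma bs_star_subproof a : exists c, \forall n \near \oo, nf_bnd F c (star (a n)).
Proof.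
have [ca Ha] := bs_bound a; exists ca.
by near=> n; apply: nf_bnd_star; near: n.
Unshelve. all: by end_near. Qed.

Definition bs0 := BoundedSeq bs0_subproof.
Definition bs1 := BoundedSeq bs1_subproof.
Definition bsD a b := BoundedSeq (bsD_subproof a b).
Definition bsZ k a := BoundedSeq (bsZ_subproof k a).
Definition bsM a b := BoundedSeq (bsM_subproof a b).
Definition bs_star a := BoundedSeq (bs_star_subproof a).
Definition bsN a := bsZ (-1) a.

Lemma nf_bndN n c (x : F n) : nf_bnd F c x -> nf_bnd F c (- x).
Proof. by move=> /(nf_bndZ (-1)); rewrite normrN1 mul1r scaleN1r. Qed.

Lemma nf_bndB n (c c' : R) (x z : F n) (y : F n) :
  nf_bnd F c (x - y) -> nf_bnd F c' (y - z) -> nf_bnd F (c + c') (x - z).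
Proof. by move=> /nf_bndD h /h; rewrite addrA subrK. Qed.

Definition asymp : rel bounded_seq := fun a b =>
  `[< forall e, 0 < e -> \forall n \near \oo, nf_bnd F e (a n - b n) >].

Lemma asymp_eq a b : (\forall n \near \oo, a n = b n) -> asymp a b.
Proof.
move=> ab; apply/asboolP => e e0; near=> n.
have -> : a n = b n by near: n.
by rewrite subrr; apply: (nf_bnd_mono (ltW e0)); exact: nf_bnd0.
Unshelve. all: by end_near. Qed.

Lemma asymp_refl : reflexive asymp.
Proof. by move=> a; apply: asymp_eq; exact: nearW. Qed.
Lemma asymp_sym : symmetric asymp.
Proof.
have s a b : asymp a b -> asymp b a.
  move=> /asboolP ab; apply/asboolP => e e0; near=> n.
  by rewrite -opprB; apply: nf_bndN; near: n; exact: ab.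
by move=> a b; apply/idP/idP; exact: s.
Unshelve. all: by end_near. Qed.
Lemma asymp_trans : transitive asymp.
Proof.
move=> b a c /asboolP ab /asboolP bc; apply/asboolP => e e0.
have e2 : 0 < e / 2 by rewrite divr_gt0.
near=> n; rewrite [e]splitr; apply: (@nf_bndB _ _ _ _ _ (b n)).
  by near: n; exact: ab.
by near: n; exact: bc.
Unshelve. all: by end_near. Qed.

Definition asymp_equiv := EquivRel asymp asymp_refl asymp_sym asymp_trans.

Definition limit_alg : Type := {eq_quot asymp_equiv}%qT.
HB.instance Definition _ := Choice.on limit_alg.

Definition cls (a : bounded_seq) : limit_alg := \pi_({eq_quot asymp_equiv})%qT a.
Definition rep (x : limit_alg) : bounded_seq := repr (x : {eq_quot asymp_equiv}%qT).

Lemma repK x : cls (rep x) = x.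
Proof. exact: reprK. Qed.

Lemma clsP a b : reflect (cls a = cls b) (asymp a b).
Proof.
by apply: (iffP idP) => [ab|/eqmodP//]; apply/eqmodP.
Qed.

Lemma rep_cls a : asymp (rep (cls a)) a.
Proof. by apply/clsP; rewrite repK. Qed.

Lemma limit_ind (P : limit_alg -> Prop) : (forall a, P (cls a)) -> forall x, P x.
Proof. by move=> Pc x; rewrite -(repK x). Qed.

Lemma asympD a a' b b' : asymp a a' -> asymp b b' -> asymp (bsD a b) (bsD a' b').
Proof.
move=> /asboolP aa /asboolP bb; apply/asboolP => e e0.
have e2 : 0 < e / 2 by rewrite divr_gt0.
near=> n; rewrite [e]splitr /= opprD addrACA; apply: nf_bndD.
  by near: n; exact: aa.
by near: n; exact: bb.
Unshelve. all: by end_near. Qed.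

Lemma asympZ k a a' : asymp a a' -> asymp (bsZ k a) (bsZ k a').
Proof.
move=> /asboolP aa; apply/asboolP => e e0.
have k0 : 0 <= complex.Re `|k| by rewrite -ler_complexE -ge0_complexE ?normr_ge0.
have k1 : 0 < complex.Re `|k| + 1 by rewrite ltr_wpDl.
have e2 : 0 < e / (complex.Re `|k| + 1) by rewrite divr_gt0.
near=> n; apply: (@nf_bnd_mono _ _ _ (complex.Re `|k| * (e / (complex.Re `|k| + 1)))).
  by rewrite mulrA ler_pdivrMr // mulrC ler_wpM2l ?(ltW e0) // lerDl.
by rewrite -scalerBr; apply: nf_bndZ; near: n; exact: aa.
Unshelve. all: by end_near. Qed.

Lemma asympM a a' b b' : asymp a a' -> asymp b b' -> asymp (bsM a b) (bsM a' b').
Proof.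
move=> /asboolP aa /asboolP bb; apply/asboolP => e e0.
have [ca Ha] := bs_bound a'; have [cb Hb] := bs_bound b.
have c1 : 0 < `|ca| + `|cb| + 1 by rewrite ltr_wpDl // addr_ge0.
have e2 : 0 < e / (`|ca| + `|cb| + 1) by rewrite divr_gt0.
near=> n.
apply: (@nf_bnd_mono _ _ _ (e / (`|ca| + `|cb| + 1) * cb + ca * (e / (`|ca| + `|cb| + 1)))).
  rewrite [ca * _]mulrC -mulrDr mulrAC ler_pdivrMr // ler_wpM2l ?(ltW e0) //.
  by have := ler_norm ca; have := ler_norm cb; lra.
apply: (@nf_bndB _ _ _ _ _ (smul (a' n) (b n))).
  rewrite -[X in nf_bnd _ _ (_ - X)]scale1r -scaleNr -smulZl scaleN1r -smulDl.
  by apply: nf_bndM; near: n => //; exact: aa.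
rewrite -scaleN1r -smulZr scaleN1r -smulDr.
by apply: nf_bndM; near: n => //; exact: bb.
Unshelve. all: by end_near. Qed.

Lemma asymp_star a a' : asymp a a' -> asymp (bs_star a) (bs_star a').
Proof.
move=> /asboolP aa; apply/asboolP => e e0; near=> n.
have -> : star (a n) - star (a' n) = star (a n - a' n).
  by rewrite starD -scaleN1r -[- a' n]scaleN1r starZ rmorphN1.
by apply: nf_bnd_star; near: n; exact: aa.
Unshelve. all: by end_near. Qed.

Definition laD x y := cls (bsD (rep x) (rep y)).
Definition laZ k x := cls (bsZ k (rep x)).
Definition laM x y := cls (bsM (rep x) (rep y)).
Definition la_star x := cls (bs_star (rep x)).

Lemma clsD a b : laD (cls a) (cls b) = cls (bsD a b).
Proof. by apply/clsP/asympD; exact: rep_cls. Qed.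
Lemma clsZ k a : laZ k (cls a) = cls (bsZ k a).
Proof. by apply/clsP/asympZ; exact: rep_cls. Qed.
Lemma clsM a b : laM (cls a) (cls b) = cls (bsM a b).
Proof. by apply/clsP/asympM; exact: rep_cls. Qed.
Lemma cls_star a : la_star (cls a) = cls (bs_star a).
Proof. by apply/clsP/asymp_star; exact: rep_cls. Qed.

Lemma cls_ext a b : (forall n, a n = b n) -> cls a = cls b.
Proof. by move=> ab; apply/clsP/asymp_eq; exact: nearW. Qed.

Lemma laDA : associative laD.
Proof.
elim/limit_ind=> a; elim/limit_ind=> b; elim/limit_ind=> c.
by rewrite !clsD; apply: cls_ext => n /=; rewrite addrA.
Qed.
Lemma laDC : commutative laD.
Proof.
elim/limit_ind=> a; elim/limit_ind=> b.
by rewrite !clsD; apply: cls_ext => n /=; rewrite addrC.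
Qed.
Lemma la0D : left_id (cls bs0) laD.
Proof. by elim/limit_ind=> a; rewrite clsD; apply: cls_ext => n /=; rewrite add0r. Qed.
Lemma laND : left_inverse (cls bs0) (laZ (-1)) laD.
Proof.
elim/limit_ind=> a; rewrite clsZ clsD; apply: cls_ext => n /=.
by rewrite scaleN1r addNr.
Qed.

HB.instance Definition _ := GRing.isZmodule.Build limit_alg laDA laDC la0D laND.

Lemma laZA k l x : laZ k (laZ l x) = laZ (k * l) x.
Proof. by elim/limit_ind: x => a; rewrite !clsZ; apply: cls_ext => n /=; rewrite scalerA. Qed.
Lemma la1Z : left_id 1 laZ.
Proof. by elim/limit_ind=> a; rewrite !clsZ; apply: cls_ext => n /=; rewrite scale1r. Qed.
Lemma laZDr : right_distributive laZ +%R.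
Proof.
move=> k; elim/limit_ind=> a; elim/limit_ind=> b.
change (laZ k (laD (cls a) (cls b)) = laD (laZ k (cls a)) (laZ k (cls b))).
by rewrite !(clsD, clsZ); apply: cls_ext => n /=; rewrite scalerDr.
Qed.
Lemma laZDl x : {morph laZ^~ x : k l / k + l}.
Proof.
elim/limit_ind: x => a k l; rewrite !clsZ.
by rewrite [RHS]clsD; apply: cls_ext => n /=; rewrite scalerDl.
Qed.
HB.instance Definition _ :=
  GRing.Zmodule_isLmodule.Build C limit_alg laZA la1Z laZDr laZDl.

Definition bound_set a : set R := [set c | \forall n \near \oo, nf_bnd F c (a n)].
Definition lim_sup_norm a : R := inf (bound_set a).

Lemma bound_set_has_inf a : has_inf (bound_set a).
Proof.
split; first by have [c] := bs_bound a; exists c.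
exists 0 => c [N _ /(_ N (leqnn N))]; exact: nf_bnd_ge0.
Qed.

Lemma lim_sup_norm_ge0 a : 0 <= lim_sup_norm a.
Proof.
apply: lb_le_inf; first by have [] := @bound_set_has_inf a.
by move=> c [N _ /(_ N (leqnn N))]; exact: nf_bnd_ge0.
Qed.

Lemma lim_sup_norm_le a c : (\forall n \near \oo, nf_bnd F c (a n)) ->
  lim_sup_norm a <= c.
Proof. by move=> ac; apply: ge_inf => //; have [] := @bound_set_has_inf a. Qed.

Lemma lim_sup_norm_lt a c : lim_sup_norm a < c ->
  \forall n \near \oo, nf_bnd F c (a n).
Proof.
move=> /inf_lt[]; first by have [] := @bound_set_has_inf a.
by move=> c' ac' cc'; apply: filterS ac' => n; apply: nf_bnd_mono; exact: ltW.
Qed.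

Lemma lim_sup_norm_asymp_le a b : asymp a b -> lim_sup_norm a <= lim_sup_norm b.
Proof.
move=> /asboolP ab; apply/ler_addgt0Pr => e e0.
have e2 : 0 < e / 2 by rewrite divr_gt0.
apply: lim_sup_norm_le; near=> n.
rewrite [e]splitr addrA -[a n](subrK (b n)) [a n - _ + _]addrC; apply: nf_bndD.
  by near: n; apply: lim_sup_norm_lt; rewrite ltrDl.
by near: n; exact: ab.
Unshelve. all: by end_near. Qed.

Definition la_norm (x : limit_alg) : C := (lim_sup_norm (rep x))%:C%C.

Lemma la_norm_cls a : la_norm (cls a) = (lim_sup_norm a)%:C%C.
Proof.
congr (_%:C%C); apply/eqP.
rewrite eq_le !lim_sup_norm_asymp_le //; first by rewrite asymp_sym rep_cls.
exact: rep_cls.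
Qed.

Lemma lim_sup_normP a b (c : R) :
  (forall e, lim_sup_norm a < e -> lim_sup_norm b <= c * e) -> 0 <= c ->
  lim_sup_norm b <= c * lim_sup_norm a.
Proof.
move=> H c0; apply/ler_addgt0Pr => e e0.
have c1 : 0 < c + 1 by rewrite ltr_wpDl.
have e2 : 0 < e / (c + 1) by rewrite divr_gt0.
have /H/le_trans-> // : lim_sup_norm a < lim_sup_norm a + e / (c + 1).
  by rewrite ltrDl.
rewrite mulrDr lerD2l mulrA ler_pdivrMr // mulrC ler_wpM2l ?(ltW e0) // lerDl.
exact: ler01.
Qed.

Lemma la_normD x y : la_norm (x + y) <= la_norm x + la_norm y.
Proof.
elim/limit_ind: x => a; elim/limit_ind: y => b.
rewrite [_ + _ in leLHS]clsD !la_norm_cls -rmorphD ler_complexE.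
apply/ler_addgt0Pr => e e0; have e2 : 0 < e / 2 by rewrite divr_gt0.
rewrite [e]splitr addrACA; apply: lim_sup_norm_le; near=> n; apply: nf_bndD.
  by near: n; apply: lim_sup_norm_lt; rewrite ltrDl.
by near: n; apply: lim_sup_norm_lt; rewrite ltrDl.
Unshelve. all: by end_near. Qed.

Lemma lim_sup_normZ_le k a :
  lim_sup_norm (bsZ k a) <= complex.Re `|k| * lim_sup_norm a.
Proof.
apply: lim_sup_normP => [e ae|]; last by rewrite -ler_complexE -ge0_complexE ?normr_ge0.
apply: lim_sup_norm_le; near=> n; apply: nf_bndZ; near: n.
exact: lim_sup_norm_lt.
Unshelve. all: by end_near. Qed.

Lemma la_normZ k x : la_norm (k *: x) = `|k| * la_norm x.
Proof.
elim/limit_ind: x => a; rewrite [_ *: _]clsZ !la_norm_cls.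
rewrite [`|k|]ge0_complexE ?normr_ge0 // -rmorphM; congr (_%:C%C).
apply/eqP; rewrite eq_le lim_sup_normZ_le andTb.
have [->|k0] := eqVneq k 0.
  by rewrite normr0 mul0r lim_sup_norm_ge0.
have kk : 0 < complex.Re `|k|.
  by rewrite -ltr_complexE -ge0_complexE ?normr_ge0 ?normr_gt0.
rewrite -ler_pdivlMl //.
have -> : (complex.Re `|k|)^-1 = complex.Re `|k^-1|.
  apply: (@complexI R); rewrite fmorphV -!ge0_complexE ?normr_ge0 //.
  by rewrite normfV.
rewrite (le_trans _ (lim_sup_normZ_le _ _)) //.
apply: lim_sup_norm_asymp_le; apply: asymp_eq; apply: nearW => n /=.
by rewrite scalerA mulVf // scale1r.
Qed.

Lemma la_norm_eq0 x : la_norm x = 0 -> x = 0.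
Proof.
elim/limit_ind: x => a; rewrite la_norm_cls => /(@complexI R) a0.
apply/clsP/asboolP => e e0; rewrite -a0 in e0.
near=> n; rewrite /= subr0; near: n; exact: lim_sup_norm_lt.
Unshelve. all: by end_near. Qed.

HB.instance Definition _ :=
  Lmodule_isNormed.Build C limit_alg la_normD la_normZ la_norm_eq0.

Lemma laM_A : associative laM.
Proof.
elim/limit_ind=> a; elim/limit_ind=> b; elim/limit_ind=> c.
by rewrite !clsM; apply: cls_ext => n /=; rewrite smulA.
Qed.
Lemma la1M : left_id (cls bs1) laM.
Proof. by elim/limit_ind=> a; rewrite clsM; apply: cls_ext => n /=; rewrite smul1l. Qed.
Lemma laM1 : right_id (cls bs1) laM.
Proof. by elim/limit_ind=> a; rewrite clsM; apply: cls_ext => n /=; rewrite smul1r. Qed.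
Lemma laMDl : left_distributive laM +%R.
Proof.
elim/limit_ind=> a; elim/limit_ind=> b; elim/limit_ind=> c.
rewrite [_ + _]clsD !clsM [RHS]clsD.
by apply: cls_ext => n /=; rewrite smulDl.
Qed.
Lemma laMDr : right_distributive laM +%R.
Proof.
elim/limit_ind=> a; elim/limit_ind=> b; elim/limit_ind=> c.
rewrite [_ + _]clsD !clsM [RHS]clsD.
by apply: cls_ext => n /=; rewrite smulDr.
Qed.
Lemma laMZl (k : C) x y : laM (k *: x) y = k *: laM x y.
Proof.
elim/limit_ind: x => a; elim/limit_ind: y => b.
rewrite [_ *: _]clsZ !clsM [RHS]clsZ.
by apply: cls_ext => n /=; rewrite smulZl.
Qed.
Lemma laMZr (k : C) x y : laM x (k *: y) = k *: laM x y.
Proof.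
elim/limit_ind: x => a; elim/limit_ind: y => b.
rewrite [_ *: _]clsZ !clsM [RHS]clsZ.
by apply: cls_ext => n /=; rewrite smulZr.
Qed.
Lemma la_starK : involutive la_star.
Proof. by elim/limit_ind=> a; rewrite !cls_star; apply: cls_ext => n /=; rewrite starK. Qed.
Lemma la_starD : {morph la_star : x y / x + y}.
Proof.
elim/limit_ind=> a; elim/limit_ind=> b.
rewrite [_ + _]clsD !cls_star [RHS]clsD.
by apply: cls_ext => n /=; rewrite starD.
Qed.
Lemma la_starZ (k : C) x : la_star (k *: x) = k^* *: la_star x.
Proof.
elim/limit_ind: x => a; rewrite [k *: _]clsZ !cls_star [RHS]clsZ.
by apply: cls_ext => n /=; rewrite starZ.
Qed.
Lemma la_starM x y : la_star (laM x y) = laM (la_star y) (la_star x).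
Proof.
elim/limit_ind: x => a; elim/limit_ind: y => b; rewrite clsM !cls_star clsM.
by apply: cls_ext => n /=; rewrite starM.
Qed.

HB.instance Definition _ := Lmodule_isStarAlgebra.Build C limit_alg
  laM_A la1M laM1 laMDl laMDr laMZl laMZr la_starK la_starD la_starZ la_starM.

Lemma lim_sup_normM a b :
  lim_sup_norm (bsM a b) <= lim_sup_norm a * lim_sup_norm b.
Proof.
apply: lim_sup_normP (lim_sup_norm_ge0 _) => c bc; rewrite mulrC.
have c0 : 0 <= c by rewrite (le_trans (lim_sup_norm_ge0 b)) // ltW.
apply: lim_sup_normP c0 => c' ac'.
apply: lim_sup_norm_le; near=> n; rewrite mulrC; apply: nf_bndM; near: n;
  exact: lim_sup_norm_lt.
Unshelve. all: by end_near. Qed.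

Lemma la_normM_le (x y : limit_alg) : `|smul x y| <= `|x| * `|y|.
Proof.
elim/limit_ind: x => a; elim/limit_ind: y => b.
change (la_norm (laM (cls a) (cls b)) <= la_norm (cls a) * la_norm (cls b)).
by rewrite clsM !la_norm_cls -rmorphM ler_complexE lim_sup_normM.
Qed.

Lemma lim_sup_norm_star a : lim_sup_norm (bs_star a) <= lim_sup_norm a.
Proof.
rewrite -[leRHS]mul1r; apply: lim_sup_normP ler01 => c ac; rewrite mul1r.
apply: lim_sup_norm_le; near=> n; apply: nf_bnd_star; near: n.
exact: lim_sup_norm_lt.
Unshelve. all: by end_near. Qed.

Lemma la_norm_star_smul (x : limit_alg) : `|smul (star x) x| = `|x| ^+ 2.
Proof.
elim/limit_ind: x => a.
change (la_norm (laM (la_star (cls a)) (cls a)) = la_norm (cls a) ^+ 2).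
rewrite cls_star clsM !la_norm_cls -rmorphXn; congr (_%:C%C).
apply/eqP; rewrite eq_le (le_trans (lim_sup_normM _ _)) ?andTb; last first.
  by rewrite expr2 ler_wpM2r ?lim_sup_norm_ge0 ?lim_sup_norm_star.
apply/ler_addgt0Pr => e e0.
set N2 := lim_sup_norm (bsM _ _).
have N0 : 0 <= N2 + e by rewrite addr_ge0 ?lim_sup_norm_ge0 // ltW.
rewrite -[leRHS]sqr_sqrtr // ler_pXn2r ?nnegrE ?lim_sup_norm_ge0 ?sqrtr_ge0 //.
apply: lim_sup_norm_le; near=> n; apply: nf_bnd_cstar; first exact: sqrtr_ge0.
rewrite sqr_sqrtr //; near: n.
by apply: (@lim_sup_norm_lt (bsM (bs_star a) a)); rewrite ltrDl.
Unshelve. all: by end_near. Qed.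

Lemma nrm_cls_lt a (c : R) : nrm (cls a) < c -> \forall n \near \oo, nf_bnd F c (a n).
Proof.
move=> ac; apply: lim_sup_norm_lt; move: ac.
by rewrite -!ltr_complexE -normE [`|_|]la_norm_cls.
Qed.

Lemma nrm_cls_le a (c : R) : (\forall n \near \oo, nf_bnd F c (a n)) -> nrm (cls a) <= c.
Proof.
move=> ac; rewrite -ler_complexE -normE [`|_|]la_norm_cls ler_complexE.
exact: lim_sup_norm_le.
Qed.

Lemma clsB a b : cls a - cls b = cls (bsD a (bsN b)).
Proof. by rewrite [- _]clsZ [LHS]clsD. Qed.

(** For a given n, the largest k up to m such that all thresholds n_j with j < k
    have been passed. *)
Lemma last_admissible (n_ : nat -> nat) n m : exists k,
  (forall j, (j < k)%N -> (n_ j <= n)%N) /\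
  (forall k', (k' <= m)%N -> (forall j, (j < k')%N -> (n_ j <= n)%N) -> (k' <= k)%N).
Proof.
elim: m => [|m [k [k1 k2]]].
  by exists 0%N; split=> // k'; rewrite leqn0 => /eqP->.
have [H|H] := pselect (forall j, (j < m.+1)%N -> (n_ j <= n)%N).
  by exists m.+1.
exists k; split=> // k'; rewrite leq_eqVlt => /predU1P[->//|]; exact: k2.
Qed.

(** Completeness comes from the freedom of the representatives: the diagonal
    sequence follows the k-th term of a fast Cauchy sequence only from the index
    on where its distance to the next term is realised. *)
Lemma fast_cauchy_limit (x : nat -> limit_alg) :
  (forall k, nrm (x k - x k.+1) < 2^-1 ^+ k) ->
  exists l, forall k, nrm (x k - l) <= 2 * 2^-1 ^+ k.
Proof.
move=> xC; pose p k := rep (x k).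
have bP k : exists N, forall n, (N <= n)%N -> nf_bnd F (2^-1 ^+ k) (p k n - p k.+1 n).
  have := xC k; rewrite -(repK (x k)) -(repK (x k.+1)) clsB => /nrm_cls_lt[N _ HN].
  by exists N => n /HN /=; rewrite scaleN1r.
(* The limit follows the sequence p_k with the largest k for which all the
   bounds on p_j - p_(j+1) with j < k hold at n. *)
pose n_ k := projT1 (cid (bP k)).
have n_P k n : (n_ k <= n)%N -> nf_bnd F (2^-1 ^+ k) (p k n - p k.+1 n).
  exact: (projT2 (cid (bP k))).
pose K n := projT1 (cid (last_admissible n_ n n)).
have K1 n j : (j < K n)%N -> (n_ j <= n)%N.
  by have [+ _] := projT2 (cid (last_admissible n_ n n)); exact.
have K2 n k : (k <= n)%N -> (forall j, (j < k)%N -> (n_ j <= n)%N) -> (k <= K n)%N.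
  by have [_] := projT2 (cid (last_admissible n_ n n)); exact.
have tele n k m : (forall j, (j < k + m)%N -> (n_ j <= n)%N) ->
    nf_bnd F (2 * 2^-1 ^+ k - 2 * 2^-1 ^+ (k + m)) (p k n - p (k + m)%N n).
  elim: m => [|m IH] H; first by rewrite addn0 !subrr; exact: nf_bnd0.
  have -> : 2 * 2^-1 ^+ k - 2 * 2^-1 ^+ (k + m.+1) =
      2 * 2^-1 ^+ k - 2 * 2^-1 ^+ (k + m) + 2^-1 ^+ (k + m) :> R.
    by rewrite addnS exprS; field.
  apply: (@nf_bndB _ _ _ _ _ (p (k + m)%N n)).
    by apply: IH => j jm; apply: H; rewrite addnS ltnS ltnW.
  by rewrite addnS; apply: n_P; apply: H; rewrite addnS.
have close k : \forall n \near \oo, nf_bnd F (2 * 2^-1 ^+ k) (p k n - p (K n) n).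
  exists (k + \sum_(j < k) n_ j)%N => // n /= kn.
  have kK : (k <= K n)%N.
    apply: K2 => [|j jk]; first exact: leq_trans (leq_addr _ _) kn.
    rewrite (leq_trans _ (leq_trans (leq_addl _ _) kn)) //.
    by rewrite (bigD1 (Ordinal jk)) //= leq_addr.
  apply: nf_bnd_mono (_ : nf_bnd F (2 * 2^-1 ^+ k - 2 * 2^-1 ^+ K n) _).
    by rewrite lerBlDr lerDl mulr_ge0 // exprn_ge0 // invr_ge0.
  by rewrite -(subnKC kK); apply: tele => j; rewrite subnKC //; exact: K1.
have bb : exists c, \forall n \near \oo, nf_bnd F c (p (K n) n).
  have [c0 Hc] := bs_bound (p 0%N); exists (2 * 2^-1 ^+ 0 + c0).
  near=> n; rewrite -[p (K n) n](subrK (p 0%N n)); apply: nf_bndD.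
    by rewrite -opprB; apply: nf_bndN; near: n; exact: close.
  by near: n.
exists (cls (BoundedSeq bb)) => k.
rewrite -[x k]repK clsB; apply: nrm_cls_le.
by apply: filterS (close k) => n /=; rewrite scaleN1r.
Unshelve. all: by end_near. Qed.

Lemma la_complete (G : set_system limit_alg) : ProperFilter G -> cauchy G -> cvg G.
Proof.
move=> GF /cauchyP GC.
have half k : 0 < (2^-1 ^+ k : R) by rewrite exprn_gt0 // invr_gt0.
have halfC k : 0 < ((2^-1 ^+ k : R)%:C%C : C) by rewrite -[0]/(0%:C%C) ltr_complexE.
have xP k : exists x, G (ball x (2^-1 ^+ k.+2 : R)%:C%C) by apply: GC.
pose x k := projT1 (cid (xP k)).
have Gx k : G (ball (x k) (2^-1 ^+ k.+2 : R)%:C%C) by exact: (projT2 (cid (xP k))).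
have ballE (u v : limit_alg) (e : R) : ball u e%:C%C v <-> nrm (u - v) < e.
  by rewrite -ball_normE /ball_ /= normE ltr_complexE.
have xC k : nrm (x k - x k.+1) < 2^-1 ^+ k.
  have [z [/ballE kz /ballE k1z]] := filter_ex (filterI (Gx k) (Gx k.+1)).
  have := nrm_triangle z (x k) (x k.+1); rewrite [nrm (z - _)]nrmB.
  move: kz k1z (half k); rewrite !exprS; lra.
have [l xl] := fast_cauchy_limit xC.
apply/cvg_ex; exists l; apply/cvg_ballP => e e0.
have eE : e = (complex.Re e)%:C%C by apply/ge0_complexE/ltW.
have r0 : 0 < complex.Re e by rewrite -ltr_complexE -eE.
have : (2^-1 : R) ^+ n @[n --> \oo] --> 0.
  by apply: cvg_expr; rewrite ger0_norm ?invr_ge0 // invf_lt1 // ltr1n.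
move=> /cvgrPdist_lt /(_ (complex.Re e / 3)) [|N _ /(_ N (leqnn N))].
  by rewrite divr_gt0.
rewrite sub0r normrN ger0_norm; last exact: ltW (half N).
move=> eN; apply: filterS (Gx N) => z /ballE Nz; rewrite eE; apply/ballE.
have := nrm_triangle (x N) l z; rewrite [nrm (l - x N)]nrmB.
have := xl N; have := half N; move: Nz eN; rewrite !exprS; lra.
Qed.

HB.instance Definition _ := Uniform_isComplete.Build limit_alg la_complete.

HB.instance Definition _ :=
  StarAlgebra_isCStarAlgebra.Build C limit_alg la_normM_le la_norm_star_smul.

End BoundedSequences.
(** * Norm bounds of matrices acting on row vectors *)

Section RowNorm.
Context {R : realType}.
Local Notation C := R[i].

Lemma realcM (a b : R) : (a * b)%:C%C = a%:C%C * b%:C%C :> C.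
Proof. exact: rmorphM. Qed.
Lemma realcD (a b : R) : (a + b)%:C%C = a%:C%C + b%:C%C :> C.
Proof. exact: rmorphD. Qed.
Lemma realcX (a : R) k : (a ^+ k)%:C%C = a%:C%C ^+ k :> C.
Proof. exact: rmorphXn. Qed.
Lemma realc_sum (I : finType) (f : I -> R) :
  (\sum_i f i)%:C%C = \sum_i (f i)%:C%C :> C.
Proof. exact: rmorph_sum. Qed.

(** Locked, to keep unification away from the definition of complex roots. *)
Definition rnorm : forall n, 'rV[C]_n -> R :=
  locked (fun n (v : 'rV[C]_n) => complex.Re (sqrtC (dotmx v v))).

Section Basics.
Context {n : nat}.
Implicit Types u v : 'rV[C]_n.

Lemma dotmx_ge0 v : 0 <= dotmx v v.
Proof. exact: dnorm_ge0. Qed.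

Lemma sqrt_dotmxE v : sqrtC (dotmx v v) = (rnorm v)%:C%C.
Proof. by rewrite /rnorm -lock -ge0_complexE // sqrtC_ge0 dotmx_ge0. Qed.

Lemma dotmx_sqr v : dotmx v v = (rnorm v ^+ 2)%:C%C.
Proof. by rewrite realcX -sqrt_dotmxE sqrtCK. Qed.

Lemma rnorm_ge0 v : 0 <= rnorm v.
Proof. by rewrite -ler_complexE -sqrt_dotmxE sqrtC_ge0 dotmx_ge0. Qed.

Let le_of_real (x y z : R) (op : C -> C -> C) (opr : R -> R -> R) (X Y Z : C) :
  (forall s t, op s%:C%C t%:C%C = (opr s t)%:C%C) ->
  X = x%:C%C -> Y = y%:C%C -> Z = z%:C%C -> X <= op Y Z -> x <= opr y z.
Proof. by move=> E -> -> ->; rewrite E ler_complexE. Qed.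

Lemma rnormD u v : rnorm (u + v) <= rnorm u + rnorm v.
Proof.
apply: (@le_of_real _ _ _ +%R +%R) (sqrt_dotmxE _) (sqrt_dotmxE _) (sqrt_dotmxE _) _.
  by move=> s t; rewrite realcD.
exact: (triangle_lerif (@dotmx C n) u v).
Qed.

Lemma dotmx_le u v : complex.Re `|dotmx u v| <= rnorm u * rnorm v.
Proof.
apply: (@le_of_real _ _ _ *%R *%R) (ge0_complexE (normr_ge0 _))
  (sqrt_dotmxE _) (sqrt_dotmxE _) _.
  by move=> s t; rewrite realcM.
exact: (CauchySchwarz_sqrt (@dotmx C n) u v).
Qed.

Lemma rnormZ (k : C) v : rnorm (k *: v) = complex.Re `|k| * rnorm v.
Proof.
apply: (@complexI R); rewrite realcM -!sqrt_dotmxE -ge0_complexE ?normr_ge0 //.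
have -> : dotmx (k *: v) (k *: v) = `|k| ^+ 2 * dotmx v v.
  by rewrite (dnormZ (@dotmx C n)).
by rewrite rootCMl ?exprn_ge0 ?normr_ge0 // sqrCK ?normr_ge0.
Qed.

Lemma rnorm0 : rnorm (0 : 'rV[C]_n) = 0.
Proof. by rewrite -(scale0r (0 : 'rV_n)) rnormZ normr0 mul0r. Qed.

Lemma rnormN v : rnorm (- v) = rnorm v.
Proof. by rewrite -scaleN1r rnormZ normrN1 mul1r. Qed.
End Basics.

Lemma dotmx_mulr m n (u : 'rV[C]_m) (a : 'M[C]_(m, n)) (v : 'rV[C]_n) :
  dotmx (u *m a) v = dotmx u (v *m a^t*).
Proof. by rewrite !dotmxE trmxC_mul trmxCK mulmxA. Qed.

Definition mx_bound m n (c : R) (a : 'M[C]_(m, n)) : Prop :=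
  0 <= c /\ forall v, rnorm (v *m a) <= c * rnorm v.

Lemma mx_bound_mono m n c c' (a : 'M[C]_(m, n)) : c <= c' ->
  mx_bound c a -> mx_bound c' a.
Proof.
move=> cc [c0 H]; split=> [|v]; first exact: le_trans cc.
by rewrite (le_trans (H v)) // ler_wpM2r ?rnorm_ge0.
Qed.

Lemma mx_bound0 m n : mx_bound 0 (0 : 'M[C]_(m, n)).
Proof. by split=> // v; rewrite mulmx0 rnorm0 mul0r. Qed.

Lemma mx_boundD m n c c' (a b : 'M[C]_(m, n)) : mx_bound c a -> mx_bound c' b ->
  mx_bound (c + c') (a + b).
Proof.
move=> [c0 H] [c0' H']; split=> [|v]; first exact: addr_ge0.
by rewrite mulmxDr (le_trans (rnormD _ _)) // mulrDl lerD.
Qed.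

Lemma mx_boundZ m n c (k : C) (a : 'M[C]_(m, n)) : mx_bound c a ->
  mx_bound (complex.Re `|k| * c) (k *: a).
Proof.
have k0 : 0 <= complex.Re `|k| by rewrite -ler_complexE -ge0_complexE ?normr_ge0.
move=> [c0 H]; split=> [|v]; first by rewrite mulr_ge0.
by rewrite -scalemxAr rnormZ -mulrA ler_wpM2l.
Qed.

Lemma mx_boundM m n p c c' (a : 'M[C]_(m, n)) (b : 'M[C]_(n, p)) :
  mx_bound c a -> mx_bound c' b -> mx_bound (c * c') (a *m b).
Proof.
move=> [c0 H] [c0' H']; split=> [|v]; first exact: mulr_ge0.
by rewrite mulmxA (le_trans (H' _)) // [c * c']mulrC -mulrA ler_wpM2l.
Qed.

(** For w = v a^*, one has |w|^2 = <w a, v> <= c |w| |v|. *)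
Lemma mx_bound_star m n c (a : 'M[C]_(m, n)) : mx_bound c a -> mx_bound c (a^t*).
Proof.
move=> [c0 H]; split=> // v; set w := v *m _.
have := rnorm_ge0 w; rewrite le_eqVlt => /predU1P[<-|w0].
  by rewrite mulr_ge0 ?rnorm_ge0.
rewrite -(ler_pM2l w0) -expr2.
have -> : rnorm w ^+ 2 = complex.Re `|dotmx (w *m a) v|.
  by rewrite dotmx_mulr -/w dotmx_sqr ger0_norm // -dotmx_sqr dotmx_ge0.
by rewrite (le_trans (dotmx_le _ _)) // mulrA ler_wpM2r ?rnorm_ge0 // mulrC.
Qed.

(** For w = v a^*, one has |w|^2 = <w a, v> <= c^2 |v|^2. *)
Lemma mx_bound_cstar m n c (a : 'M[C]_(m, n)) : 0 <= c ->
  mx_bound (c ^+ 2) (a^t* *m a) -> mx_bound c a.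
Proof.
move=> c0 [_ H]; rewrite -[a]trmxCK; apply: mx_bound_star; split=> // v.
set w := v *m _.
rewrite -(@ler_pXn2r _ 2) ?nnegrE ?mulr_ge0 ?rnorm_ge0 //.
have -> : rnorm w ^+ 2 = complex.Re `|dotmx (w *m a) v|.
  by rewrite dotmx_mulr -/w dotmx_sqr ger0_norm // -dotmx_sqr dotmx_ge0.
rewrite (le_trans (dotmx_le _ _)) // exprMn expr2 -[_ * _ * rnorm v ^+ 2]mulrA.
by rewrite [rnorm v ^+ 2]expr2 !mulrA -expr2 ler_wpM2r ?rnorm_ge0 // /w -mulmxA.
Qed.

Lemma mx_bound_proj n (p : 'M[C]_n) : p *m p = p -> p^t* = p -> mx_bound 1 p.
Proof.
move=> pp ps; apply: mx_bound_cstar => //; rewrite expr1n ps pp.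
split=> // v; rewrite mul1r; set w := v *m _.
have := rnorm_ge0 w; rewrite le_eqVlt => /predU1P[<-|w0]; first exact: rnorm_ge0.
rewrite -(ler_pM2l w0) -expr2.
have -> : rnorm w ^+ 2 = complex.Re `|dotmx w v|.
  have -> : dotmx w v = dotmx w w by rewrite /w -{1}pp mulmxA dotmx_mulr ps.
  by rewrite dotmx_sqr ger0_norm // -dotmx_sqr dotmx_ge0.
exact: dotmx_le.
Qed.

Lemma rnorm_row_mx m n (u : 'rV[C]_m) (v : 'rV[C]_n) :
  rnorm (row_mx u v) ^+ 2 = rnorm u ^+ 2 + rnorm v ^+ 2.
Proof.
apply: (@complexI R); rewrite realcD -!dotmx_sqr !dotmxE tr_row_mx.
by rewrite map_col_mx mul_row_col mxE.
Qed.

Lemma mx_bound_block m1 n1 m2 n2 c (a : 'M[C]_(m1, n1)) (b : 'M[C]_(m2, n2)) :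
  mx_bound c a -> mx_bound c b -> mx_bound c (block_mx a 0 0 b).
Proof.
move=> [c0 H] [_ H']; split=> // v; rewrite -(hsubmxK v) mul_row_block.
rewrite !mulmx0 add0r addr0.
rewrite -(@ler_pXn2r _ 2) ?nnegrE ?mulr_ge0 ?rnorm_ge0 //.
rewrite exprMn !rnorm_row_mx mulrDr -!exprMn.
by rewrite lerD // ler_pXn2r ?nnegrE ?mulr_ge0 ?rnorm_ge0.
Qed.

(** A vector of C^m tensor C^k is seen as k vectors of C^m. *)
Definition slice m k (v : 'rV[C]_(m * k)) (j : 'I_k) : 'rV[C]_m :=
  \row_i v 0 (mxtens_index (i, j)).

Lemma sum_mxtens (V : nmodType) m k (f : 'I_(m * k) -> V) :
  \sum_i f i = \sum_j \sum_i f (mxtens_index (i, j)).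
Proof.
rewrite exchange_big /= pair_big /= (reindex (@mxtens_index m k)) /=.
  by apply: eq_bigr => -[].
by exists (@mxtens_unindex m k) => ? _; rewrite ?mxtens_indexK ?mxtens_unindexK.
Qed.

Lemma rnorm_slice m k (v : 'rV[C]_(m * k)) :
  rnorm v ^+ 2 = \sum_j rnorm (slice v j) ^+ 2.
Proof.
apply: (@complexI R); rewrite realc_sum -dotmx_sqr dotmxE mxE sum_mxtens.
apply: eq_bigr => j _; rewrite -dotmx_sqr dotmxE mxE.
by apply: eq_bigr => i _; rewrite !mxE.
Qed.

Lemma slice_tens m n k (v : 'rV[C]_(m * k)) (a : 'M[C]_(m, n)) j :
  slice (v *m tensmx a (1%:M : 'M[C]_k)) j = slice v j *m a.
Proof.
apply/rowP => i; rewrite !mxE sum_mxtens exchange_big /=; apply: eq_bigr => i' _.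
rewrite (bigD1 j) //= big1 ?addr0 => [|j' /negbTE jj]; last first.
  by rewrite tensmxE mxE jj mulr0 mulr0.
by rewrite tensmxE !mxE eqxx mulr1.
Qed.

Lemma mx_bound_tens m n k c (a : 'M[C]_(m, n)) (q : 'M[C]_k) :
  q *m q = q -> q^t* = q -> mx_bound c a -> mx_bound c (tensmx a q).
Proof.
move=> qq qs [c0 H].
have -> : tensmx a q = tensmx a 1%:M *m tensmx 1%:M q.
  by rewrite tensmx_mul mulmx1 mul1mx.
rewrite -[c]mulr1; apply: mx_boundM; last first.
  apply: mx_bound_proj; first by rewrite tensmx_mul mulmx1 qq.
  by rewrite trmxC_tens qs trmx1 map_mx1.
split=> // v.
rewrite -(@ler_pXn2r _ 2) ?nnegrE ?mulr_ge0 ?rnorm_ge0 //.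
rewrite exprMn !rnorm_slice mulr_sumr ler_sum // => j _.
by rewrite slice_tens -exprMn ler_pXn2r ?nnegrE ?mulr_ge0 ?rnorm_ge0.
Qed.

(** The square of the Hilbert-Schmidt norm. *)
Definition frob m n (a : 'M[C]_(m, n)) : R :=
  \sum_j rnorm (row j (a^t*)) ^+ 2.

Lemma mx_bound_frob m n (a : 'M[C]_(m, n)) c : frob a <= c -> mx_bound (1 + c) a.
Proof.
move=> ac; have f0 : 0 <= frob a by rewrite sumr_ge0 // => j _; rewrite exprn_ge0 // rnorm_ge0.
have c0 : 0 <= c := le_trans f0 ac.
split=> [|v]; first by rewrite addr_ge0.
rewrite -(@ler_pXn2r _ 2) ?nnegrE ?mulr_ge0 ?rnorm_ge0 ?addr_ge0 //.
have : rnorm (v *m a) ^+ 2 <= frob a * rnorm v ^+ 2.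
  rewrite -ler_complexE -dotmx_sqr dotmxE mxE /frob mulr_suml realc_sum.
  apply: ler_sum => j _; rewrite !mxE -normCK.
  have -> : \sum_k v 0 k * a k j = dotmx v (row j (a^t*)).
    by rewrite dotmxE mxE; apply: eq_bigr => k _; rewrite !mxE conjCK.
  rewrite [`|_|]ge0_complexE ?normr_ge0 // -realcX ler_complexE -exprMn.
  rewrite ler_pXn2r ?nnegrE ?mulr_ge0 ?rnorm_ge0 //.
    by rewrite mulrC dotmx_le.
  by rewrite -ler_complexE -ge0_complexE ?normr_ge0.
move=> /le_trans; apply; rewrite exprMn ler_wpM2r ?exprn_ge0 ?rnorm_ge0 //.
by nra.
Qed.
End RowNorm.
(** * Cells of complex projective space *)

Section ComplexMaps.
Context {R : realType}.
Local Notation C := (R[i] : numClosedFieldType).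

Lemma realc_continuous : continuous (fun x : R => x%:C%C : C).
Proof.
move=> x A /nbhs_ballP[e /= e0 sA].
have eE : e = (complex.Re e)%:C%C by apply/ge0_complexE/ltW.
apply/nbhs_ballP; exists (complex.Re e) => [|y xy] /=.
  by rewrite -ltr_complexE -eE.
apply: sA; rewrite -ball_normE /ball_ /= eE -rmorphB /= normc_def /=.
by rewrite expr0n addr0 sqrtr_sqr ltr_complexE.
Qed.

Lemma Re_norm_le (z : C) : `|complex.Re z| <= complex.Re `|z|.
Proof.
case: z => a b; rewrite normc_def /= -sqrtr_sqr ler_wsqrtr // lerDl.
exact: sqr_ge0.
Qed.

Lemma Im_norm_le (z : C) : `|complex.Im z| <= complex.Re `|z|.
Proof.
case: z => a b; rewrite normc_def /= -sqrtr_sqr ler_wsqrtr // lerDr.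
exact: sqr_ge0.
Qed.

Lemma lipschitz_Re (f : C -> R) : (forall z w, f z - f w = f (z - w)) ->
  (forall z, `|f z| <= complex.Re `|z|) -> continuous f.
Proof.
move=> fB fn z A /nbhs_ballP[e /= e0 sA].
apply/nbhs_ballP; exists e%:C%C => [|w zw] /=.
  by rewrite /= -[0]/(0%:C%C) ltr_complexE.
apply: sA; rewrite -ball_normE /ball_ /= fB.
rewrite (le_lt_trans (fn _)) // -ltr_complexE -ge0_complexE ?normr_ge0 //.
Qed.

Lemma Re_continuous : continuous (fun z : C => complex.Re z).
Proof. by apply: lipschitz_Re => [z w|z]; [case: z w => ? ? []|exact: Re_norm_le]. Qed.

Lemma Im_continuous : continuous (fun z : C => complex.Im z).
Proof. by apply: lipschitz_Re => [z w|z]; [case: z w => ? ? []|exact: Im_norm_le]. Qed.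

Lemma Complex_continuous (X : topologicalType) (f g : X -> R) :
  continuous f -> continuous g -> continuous (fun x => Complex (f x) (g x) : C).
Proof.
move=> fc gc; rewrite (_ : (fun _ => _) = fun x => (f x)%:C%C + 'i%C * (g x)%:C%C).
  apply: add_map_continuous.
    exact: comp_map_continuous fc realc_continuous.
  apply: mul_map_continuous; first exact: cst_continuous.
  exact: comp_map_continuous gc realc_continuous.
by apply/funext => x; rewrite [LHS]complexE.
Qed.
End ComplexMaps.

Section CellMap.
Context {R : realType} (D : nat).
Local Notation C := (R[i] : numClosedFieldType).

(** Every line of C^(D+1) contains a vector whose last coordinate is the
    nonnegative real 1 - |r|, r being the vector of the real and imaginary
    parts of the other coordinates: a cell with cube shape, whose boundary is
    mapped to the hyperplane at infinity antipodally. *)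
Definition cell_vec (r : 'rV[R]_(D + D)) : 'cV[C]_D.+1 :=
  \col_j (if unlift ord_max j is Some k
          then Complex (r 0 (lshift D k)) (r 0 (rshift D k)) else (1 - `|r|)%:C%C).

Lemma cell_vec_last r : cell_vec r ord_max 0 = (1 - `|r|)%:C%C.
Proof. by rewrite mxE unlift_none. Qed.

Lemma cell_vec_lift r k :
  cell_vec r (lift ord_max k) 0 = Complex (r 0 (lshift D k)) (r 0 (rshift D k)).
Proof. by rewrite mxE liftK. Qed.

Lemma cell_vec_neq0 r : cell_vec r != 0.
Proof.
apply/eqP => r0; have E j : cell_vec r j 0 = 0 by rewrite r0 mxE.
have rn0 : r = 0.
  apply/rowP => q; rewrite mxE; case: (split_ordP q) => k ->.
    by have := E (lift ord_max k); rewrite cell_vec_lift => -[].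
  by have := E (lift ord_max k); rewrite cell_vec_lift => -[].
have := E ord_max; rewrite cell_vec_last rn0 normr0 subr0 => -[] /eqP.
by rewrite oner_eq0.
Qed.

Lemma cell_vec_continuous : continuous cell_vec.
Proof.
apply: continuous_mx => i j; rewrite ord1.
have idc : continuous (id : 'rV[R]_(D + D) -> 'rV[R]_(D + D)) by move=> x; exact: cvg_id.
case: (unliftP ord_max i) => [k ->|->].
  rewrite (_ : (fun _ => _) = fun r : 'rV_(D + D) =>
    Complex (r 0 (lshift D k)) (r 0 (rshift D k))); last first.
    by apply/funext => r; rewrite cell_vec_lift.
  by apply: Complex_continuous; apply: rV_coord_continuous.
rewrite (_ : (fun _ => _) = fun r : 'rV[R]_(D + D) => (1 - `|r|)%:C%C); last first.
  by apply/funext => r; rewrite cell_vec_last.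
apply: comp_map_continuous (@realc_continuous R).
by apply: sub_map_continuous; [exact: cst_continuous|exact: norm_continuous].
Qed.

Lemma cell_vec_antipode r : `|r| = 1 -> cell_vec (- r) = - cell_vec r.
Proof.
move=> r1; apply/colP => i; case: (unliftP ord_max i) => [k ->|->].
  by rewrite [RHS]mxE !cell_vec_lift !mxE.
by rewrite [RHS]mxE !cell_vec_last normrN r1 subrr oppr0.
Qed.

Lemma cell_vec_surj (z : 'cV[C]_D.+1) : z != 0 ->
  exists r c, [/\ `|r| <= 1, c != 0 & cell_vec r = c *: z].
Proof.
move=> z0.
have [p [p0 [t [t0 pt]]]] : exists p, p != 0 /\
    exists t : R, 0 <= t /\ p * z ord_max 0 = t%:C%C.
  have [l0|l0] := eqVneq (z ord_max 0) 0.
    by exists 1; split; [exact: oner_neq0|exists 0; rewrite l0 mulr0].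
  exists (z ord_max 0)^*; split; first by rewrite conjC_eq0.
  exists (complex.Re (`|z ord_max 0| ^+ 2)).
  have n0 : 0 <= `|z ord_max 0| ^+ 2 by rewrite exprn_ge0 ?normr_ge0.
  split; first by rewrite -ler_complexE -ge0_complexE.
  by rewrite -ge0_complexE // normCK mulrC.
pose w : 'rV[R]_(D + D) := row_mx (\row_k complex.Re (p * z (lift ord_max k) 0))
   (\row_k complex.Im (p * z (lift ord_max k) 0)).
have wl (k : 'I_D) : w 0 (lshift D k) = complex.Re (p * z (lift ord_max k) 0).
  by rewrite row_mxEl mxE.
have wr (k : 'I_D) : w 0 (rshift D k) = complex.Im (p * z (lift ord_max k) 0).
  by rewrite row_mxEr mxE.
have s0 : 0 < t + `|w|.
  rewrite lt_def addr_ge0 ?normr_ge0 // andbT; apply/eqP => /eqP.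
  rewrite paddr_eq0 ?normr_ge0 // normr_eq0 => /andP[/eqP t00 /eqP w0].
  move/eqP: z0; apply; apply/colP => i; rewrite mxE.
  apply: (mulfI p0); rewrite mulr0.
  case: (unliftP ord_max i) => [k ->|->]; last by rewrite pt t00.
  have := wl k; have := wr k; rewrite w0 !mxE.
  by case: (p * _) => a b /= <- <-.
set s := (t + `|w|)^-1; have si : 0 < s by rewrite invr_gt0.
have rn : `|s *: w| = 1 - s * t.
  by rewrite normrZ gtr0_norm // /s; field; exact: lt0r_neq0.
exists (s *: w), (s%:C%C * p); split.
- by rewrite rn gerBl mulr_ge0 // ltW.
- by rewrite mulf_neq0 // -[0]/(0%:C%C) (inj_eq (@complexI R)) gt_eqF.
- apply/colP => i; rewrite [RHS]mxE -mulrA.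
  case: (unliftP ord_max i) => [k ->|->]; last first.
    by rewrite cell_vec_last rn opprB addrC subrK pt -rmorphM.
  rewrite cell_vec_lift [(s *: w) 0 _]mxE wl [(s *: w) 0 _]mxE wr; case: (p * _) => a b.
  by apply/eqP; rewrite eq_complex /= !mul0r subr0 addr0 !eqxx.
Qed.

Definition CP_of (z : 'cV[C]_D.+1) (z0 : z != 0) : CP C D :=
  \pi_({eq_quot same_line_equiv C D})%qT (exist _ z (mem_set z0) : nonzero_vec C D).

Lemma CP_of_eq z w (z0 : z != 0) (w0 : w != 0) c : c != 0 -> w = c *: z ->
  CP_of z0 = CP_of w0.
Proof. by move=> c0 E; apply/eqmodP; apply/asboolP; exists c. Qed.

Lemma CP_surj (x : CP C D) : exists z (z0 : z != 0), x = CP_of z0.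
Proof.
rewrite -[x](@reprK _ ({eq_quot same_line_equiv C D}%qT)).
case: (repr _) => z zP; exists z, (set_mem zP); congr (\pi_({eq_quot same_line_equiv C D})%qT _).
exact: val_inj.
Qed.

Lemma taut_CP_of z (z0 : z != 0) : taut C D (CP_of z0) = line_proj z.
Proof.
rewrite /= /taut_fun /=.
set w := repr _; have : same_line (exist _ z (mem_set z0) : nonzero_vec C D) w.
  by apply/(@eqmodP _ (same_line_equiv C D)); rewrite reprK.
by move=> /asboolP[c c0 ->]; rewrite line_projZ.
Qed.

Lemma CP_of_continuous (X : topologicalType) (f : X -> 'cV[C]_D.+1)
    (f0 : forall x, f x != 0) :
  continuous f -> continuous (fun x => CP_of (f0 x)).
Proof.
move=> fc.
apply: (comp_map_continuous (f := fun x => (exist _ (f x) (mem_set (f0 x)) : nonzero_vec C D)));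
  last exact: pi_continuous.
exact: (@continuous_comp_initial _ _ _ (set_val : nonzero_vec C D -> _)).
Qed.
End CellMap.
(** * Cube coordinates on the spaces of the tower *)

Section Geometry.
Context {R : realType} {M : topologicalType}.
Local Notation C := (R[i] : numClosedFieldType).

Fixpoint pdim n : nat :=
  if n is n'.+1 then (pdim n' + (2 ^ n'.+1 + 2 ^ n'.+1))%N else 0%N.

Fixpoint pmap n : M * 'rV[R]_(pdim n) -> vspace C M n :=
  match n return M * 'rV[R]_(pdim n) -> vspace C M n with
  | 0 => fun p => p.1
  | n'.+1 => fun p =>
    (@pmap n' (p.1, lsubmx p.2), CP_of (cell_vec_neq0 (rsubmx p.2)))
  end.

(** The step at which a coordinate was added. *)
Fixpoint pblk n : 'I_(pdim n) -> nat :=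
  match n return 'I_(pdim n) -> nat with
  | 0 => fun=> 0%N
  | n'.+1 => fun q => match fintype.split q with inl q' => @pblk n' q' | inr _ => n' end
  end.

Lemma pblk_lshift n (q : 'I_(pdim n)) : pblk (n := n.+1) (lshift _ q) = pblk q.
Proof. by rewrite /= (unsplitK (inl q)). Qed.

Lemma pblk_rshift n (q : 'I_(2 ^ n.+1 + 2 ^ n.+1)) :
  pblk (n := n.+1) (rshift (pdim n) q) = n.
Proof. by rewrite /= (unsplitK (inr q)). Qed.

Lemma pblk_lt n (q : 'I_(pdim n)) : (pblk q < n)%N.
Proof.
elim: n q => [|n IH] q; first by case: q.
case: (split_ordP (q : 'I_(pdim n + _))) => k ->; last by rewrite pblk_rshift.
by rewrite pblk_lshift ltnW // ltnS IH.
Qed.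

Local Notation anti := (antipode (@pblk _)).

Lemma antipode_out n i (r : 'rV[R]_(pdim n)) : (n <= i)%N -> anti i r = r.
Proof.
move=> ni; apply/rowP => q; rewrite mxE ltn_eqF //.
exact: leq_trans (pblk_lt q) ni.
Qed.

Lemma lsubmx_antipode n i (r : 'rV[R]_(pdim n.+1)) :
  lsubmx (anti i r : 'rV_(pdim n + _)) = anti i (lsubmx (r : 'rV_(pdim n + _))).
Proof. by apply/rowP => q; rewrite !mxE pblk_lshift. Qed.

Lemma rsubmx_antipode n i (r : 'rV[R]_(pdim n.+1)) :
  rsubmx (anti i r : 'rV_(pdim n + _)) =
  if n == i then - rsubmx (r : 'rV_(pdim n + _)) else rsubmx (r : 'rV_(pdim n + _)).
Proof.
by apply/rowP => q; rewrite mxE mxE pblk_rshift; case: ifP => _; rewrite !mxE.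
Qed.

Lemma cube_lsubmx n (r : 'rV[R]_(pdim n.+1)) :
  cube r -> cube (lsubmx (r : 'rV_(pdim n + _))).
Proof. by move=> rc q; rewrite mxE. Qed.

Lemma cube_rsubmx n (r : 'rV[R]_(pdim n.+1)) :
  cube r -> cube (rsubmx (r : 'rV_(pdim n + _))).
Proof. by move=> rc q; rewrite mxE. Qed.

Lemma block_bdry_last n (r : 'rV[R]_(pdim n.+1)) : cube r ->
  block_bdry (@pblk n.+1) n r -> `|rsubmx (r : 'rV_(pdim n + _))| = 1.
Proof.
move=> rc [q qn q1]; apply/eqP; rewrite eq_le.
have /cubeE-> := cube_rsubmx rc; move: qn q1.
case: (split_ordP (q : 'I_(pdim n + _))) => k -> kn k1 /=.
  by move: kn (pblk_lt k); rewrite pblk_lshift => ->; rewrite ltnn.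
have -> : 1 = `|rsubmx (r : 'rV_(pdim n + _)) 0 k| by rewrite mxE.
exact: coord_le_norm.
Qed.

Lemma block_bdry_init n i (r : 'rV[R]_(pdim n.+1)) : n != i ->
  block_bdry (@pblk n.+1) i r -> block_bdry (@pblk n) i (lsubmx (r : 'rV_(pdim n + _))).
Proof.
move=> ni [q]; case: (split_ordP (q : 'I_(pdim n + _))) => k ->; last first.
  by rewrite pblk_rshift => /eqP; rewrite (negbTE ni).
by rewrite pblk_lshift => ki k1; exists k; rewrite // mxE.
Qed.

Lemma pmap_antipode n i m (r : 'rV[R]_(pdim n)) : cube r ->
  block_bdry (@pblk n) i r -> pmap (m, anti i r) = pmap (m, r).
Proof.
elim: n r => [|n IH] r rc ri //=.
rewrite lsubmx_antipode rsubmx_antipode.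
have [ni|ni] := eqVneq n i; last first.
  by rewrite IH //; [exact: cube_lsubmx|exact: block_bdry_init].
move: ri; rewrite -ni => ri; rewrite antipode_out //; congr (_, _).
apply: (@CP_of_eq _ _ _ _ _ _ (-1)); first by rewrite oppr_eq0 oner_eq0.
have r1 : `|rsubmx (r : 'rV_(pdim n + _))| = 1.
  exact: block_bdry_last.
by rewrite cell_vec_antipode // scaleN1r opprK.
Qed.

Lemma pmap_surj n (x : vspace C M n) : exists m r, cube r /\ pmap (m, r) = x.
Proof.
elim: n x => [|n IH] x; first by exists x, 0; split=> // -[].
case: x => x z; have [m [r [rc <-]]] := IH x.
have [w [w0 ->]] := CP_surj z; have [r' [c [r'1 c0 E]]] := cell_vec_surj w0.
exists m, (row_mx r r'); split.
  move=> q; case: (split_ordP (q : 'I_(pdim n + _))) => k ->.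
    by rewrite row_mxEl.
  by rewrite row_mxEr; move: k; apply/cubeE.
rewrite /= row_mxKl row_mxKr; congr (_, _).
apply: (@CP_of_eq _ _ _ _ _ _ c^-1); first by rewrite invr_eq0.
by rewrite E scalerA mulVf // scale1r.
Qed.

Lemma lsubmx_continuous (X : topologicalType) (K : numFieldType) a b
    (f : X -> 'rV[K]_(a + b)) : continuous f -> continuous (fun x => lsubmx (f x)).
Proof.
move=> fc; apply: rV_continuous => j.
rewrite (_ : (fun _ => _) = fun x => f x 0 (lshift b j)).
  exact: rV_coord_continuous.
by apply/funext => x; rewrite mxE.
Qed.

Lemma rsubmx_continuous (X : topologicalType) (K : numFieldType) a b
    (f : X -> 'rV[K]_(a + b)) : continuous f -> continuous (fun x => rsubmx (f x)).
Proof.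
move=> fc; apply: rV_continuous => j.
rewrite (_ : (fun _ => _) = fun x => f x 0 (rshift a j)).
  exact: rV_coord_continuous.
by apply/funext => x; rewrite mxE.
Qed.

Lemma pmap_continuous n : continuous (@pmap n).
Proof.
elim: n => [|n IH]; first by move=> p; exact: cvg_fst.
have sc : continuous (@snd M 'rV[R]_(pdim n + (2 ^ n.+1 + 2 ^ n.+1))).
  by move=> p; exact: cvg_snd.
apply: pair_map_continuous.
  apply: (comp_map_continuous (f := fun p : M * 'rV[R]_(pdim n.+1) => (p.1, lsubmx p.2))) IH.
  apply: pair_map_continuous; first by move=> p; exact: cvg_fst.
  exact: lsubmx_continuous.
apply: CP_of_continuous; apply: comp_map_continuous (@cell_vec_continuous _ _).
exact: rsubmx_continuous.
Qed.

End Geometry.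
(** * The obstruction to lying in the trivial summand *)

Section Reducing.
Context {R : realType} {M : topologicalType}.
Local Notation C := (R[i] : numClosedFieldType).
Variable y : forall n, vspace C M n.
Local Notation p := (unit_proj y).

(** The dimensions m * 1 and m are not convertible; the summand added to a vector
    by a tensor product with the trivial line has dimension m * 1. *)
Definition unslice m (v : 'rV[C]_m) : 'rV[C]_(m * 1) :=
  \row_i v 0 (mxtens_unindex i).1.

Lemma unsliceK m (v : 'rV[C]_m) : slice (unslice v) 0 = v.
Proof. by apply/rowP => i; rewrite !mxE mxtens_indexK. Qed.

Lemma slice_inj m (u v : 'rV[C]_(m * 1)) : slice u 0 = slice v 0 -> u = v.
Proof.
move=> /rowP uv; apply/rowP => i; rewrite -(mxtens_unindexK i).
case: (mxtens_unindex i) => j k; have := uv j; rewrite !mxE.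
by rewrite (ord1 k).
Qed.

Lemma unslice_tens m n (v : 'rV[C]_m) (a : 'M[C]_(m, n)) :
  unslice v *m tensmx a (1%:M : 'M[C]_1) = unslice (v *m a).
Proof. by apply: slice_inj; rewrite slice_tens !unsliceK. Qed.

Lemma unsliceZ m (c : C) (v : 'rV[C]_m) : unslice (c *: v) = c *: unslice v.
Proof. by apply/rowP => i; rewrite !mxE. Qed.

Fixpoint evec n : 'rV[C]_(vdim n) :=
  match n return 'rV[C]_(vdim n) with
  | 0 => const_mx 1
  | n'.+1 => row_mx (unslice (evec n')) 0
  end.

Lemma evec_proj n x : evec n *m p n x = evec n.
Proof.
elim: n x => [|n IH] x /=; first by rewrite mulmx1.
by rewrite /diag_fun mul_row_block !mulmx0 mul0mx !addr0 unslice_tens IH.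
Qed.

Lemma rnorm_evec n : rnorm (evec n) = 1.
Proof.
suff E : rnorm (evec n) ^+ 2 = 1.
  by apply/eqP; rewrite -(@eqrXn2 _ 2) ?rnorm_ge0 // E expr1n.
elim: n => [|n IH] /=.
  apply: (@complexI R); rewrite -dotmx_sqr dotmxE mxE big_ord1 !mxE.
  by rewrite rmorph1 mulr1.
by rewrite rnorm_row_mx rnorm0 expr0n addr0 rnorm_slice big_ord1 unsliceK.
Qed.

Fixpoint rdim n : nat := if n is n'.+1 then (rdim n' * 1 + rdim n' * 1)%N else 1%N.

Lemma rdimE n : rdim n = (2 ^ n)%N.
Proof. by elim: n => //= n ->; rewrite muln1 addnn -mul2n -expnS. Qed.

(** The bundle of p_n is a sum of 2^n line bundles. *)
Lemma proj_factor n x : exists (L : 'M[C]_(vdim n, rdim n)) B, p n x = L *m B.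
Proof.
elim: n x => [|n IH] x; first by exists 1%:M, 1%:M; rewrite mulmx1.
have [L [B E]] := IH x.1; have [L' [B' E']] := IH (y n).
have [z [z0 zE]] := CP_surj x.2; have tE := taut_CP_of z0; rewrite -zE in tE.
exists (block_mx (tensmx L 1%:M) 0 0 (tensmx L' z)),
  (block_mx (tensmx B 1%:M) 0 0 (tensmx B' (((z^t* *m z) 0 0)^-1 *: z^t*))).
rewrite mulmx_block_diag !tensmx_mul /= /diag_fun /= -E -E' mulmx1.
congr (block_mx _ _ _ (tensmx _ _)).
by rewrite -scalemxAr; exact: tE.
Qed.

Lemma proj_pair_factor n x : exists (L : 'M[C]_(vdim n + vdim n, 2 ^ n.+1)) B,
  block_mx (p n x) 0 0 (p n x) = L *m B.
Proof.
have [L [B E]] := proj_factor x.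
have <- : (rdim n + rdim n = 2 ^ n.+1)%N by rewrite rdimE addnn -mul2n -expnS.
exists (block_mx L 0 0 L), (block_mx B 0 0 B).
by rewrite mulmx_block_diag E.
Qed.

(** Coordinates on the range of two copies of p_n(y_n): a vector v of the range
    is zero as soon as v L is. *)
Definition Lfac n : 'M[C]_(vdim n + vdim n, 2 ^ n.+1) :=
  projT1 (cid (proj_pair_factor (y n))).

Lemma Lfac_inj n (u v : 'rV[C]_(vdim n)) :
  row_mx u v *m Lfac n = 0 -> u *m p n (y n) = 0 /\ v *m p n (y n) = 0.
Proof.
rewrite /Lfac; case: cid => L /= [B E] L0.
have : row_mx u v *m block_mx (p n (y n)) 0 0 (p n (y n)) = 0.
  by rewrite E mulmxA L0 mul0mx.
rewrite mul_row_block !mulmx0 addr0 add0r -[X in _ = X -> _]row_mx0.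
by move=> /eq_row_mx.
Qed.

(** For v = u tensor z^*, this is |z|^2 u. *)
Definition fibre_coord n (z : 'cV[C]_(2 ^ n.+1).+1)
    (v : 'rV[C]_(vdim n * (2 ^ n.+1).+1)) : 'rV[C]_(vdim n) :=
  slice (v *m tensmx (1%:M : 'M[C]_(vdim n)) z) 0.

(** The obstruction to the equality of v and v' with multiples of [evec n], for
    v and v' in the fibre of p_n. On the summand added at step n+1 the fibre is
    that of p_n(y_n) tensor the line of z, and the coordinates along z are
    linear in z: this is where the sign of the antipode comes from. There are
    2^n complex coordinates for each of v and v', hence as many real ones as
    the cell of CP^(2^(n+1)) has dimensions. *)
Fixpoint obstr n : 'rV[R]_(pdim n) -> 'rV[C]_(vdim n) -> 'rV[C]_(vdim n) ->
    'rV[R]_(pdim n) :=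
  match n return 'rV[R]_(pdim n) -> 'rV[C]_(vdim n) -> 'rV[C]_(vdim n) ->
    'rV[R]_(pdim n) with
  | 0 => fun r _ _ => 0
  | n'.+1 => fun r v v' =>
    let z := cell_vec (rsubmx r) in
    let w := row_mx (fibre_coord z (rsubmx v)) (fibre_coord z (rsubmx v')) *m Lfac n' in
    row_mx (@obstr n' (lsubmx r) (slice (lsubmx v) 0) (slice (lsubmx v') 0))
      (row_mx (\row_j complex.Re (w 0 j)) (\row_j complex.Im (w 0 j)))
  end.

Lemma fibre_coord0 n (z : 'cV[C]_(2 ^ n.+1).+1) x v : z != 0 ->
  v *m tensmx (p n x) (line_proj z) = v -> fibre_coord z v *m p n x = 0 -> v = 0.
Proof.
move=> z0 vE f0; rewrite -vE.
have -> : tensmx (p n x) (line_proj z) = tensmx 1%:M z *m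
    (tensmx (p n x) 1%:M *m tensmx 1%:M (((z^t* *m z) 0 0)^-1 *: z^t*)).
  by rewrite !tensmx_mul !mul1mx mulmx1 -scalemxAr.
rewrite !mulmxA (_ : v *m _ *m _ = 0) ?mul0mx //.
by apply: slice_inj; rewrite slice_tens f0; apply/rowP => i; rewrite !mxE.
Qed.

Lemma obstr0P n m (r : 'rV[R]_(pdim n)) v v' :
  v *m p n (pmap (m, r)) = v -> v' *m p n (pmap (m, r)) = v' ->
  obstr r v v' = 0 -> exists c c' : C, v = c *: evec n /\ v' = c' *: evec n.
Proof.
elim: n r v v' => [|n IH] r v v' vE v'E.
  move=> _; exists (v 0 0), (v' 0 0).
  by split; apply/rowP => i; rewrite !mxE mulr1 (ord1 i).
move=> /=; set z := cell_vec _; set w := row_mx _ _ *m _.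
rewrite -[X in _ = X -> _]row_mx0 => /eq_row_mx [G1].
rewrite -[X in _ = X -> _]row_mx0 => /eq_row_mx [wR wI].
have w0 : w = 0.
  apply/rowP => j; move/rowP/(_ j): wR; move/rowP/(_ j): wI; rewrite !mxE.
  by case: (\sum_(_ < _) _) => a b /= -> ->.
have [f0 f0'] := Lfac_inj w0.
have split_fix u : u *m p n.+1 (pmap (m, r)) = u ->
    slice (lsubmx u) 0 *m p n (pmap (m, lsubmx r)) = slice (lsubmx u) 0 /\
    rsubmx u *m tensmx (p n (y n)) (line_proj z) = rsubmx u.
  rewrite -{1 2}(hsubmxK u) /= /diag_fun mul_row_block !mulmx0 addr0 add0r.
  move=> /eq_row_mx [E1 E2]; split.
    by rewrite -slice_tens E1.
  by rewrite -{2}E2 /= -(taut_CP_of (cell_vec_neq0 (rsubmx r))).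
have [vl vr] := split_fix v vE; have [v'l v'r] := split_fix v' v'E.
have [c [c' [E E']]] := IH _ _ _ vl v'l G1.
exists c, c'; split; rewrite /= scale_row_mx scaler0 -unsliceZ -1?E -1?E'.
  rewrite -[LHS]hsubmxK (fibre_coord0 (cell_vec_neq0 _) vr f0).
  by congr row_mx; apply: slice_inj; rewrite unsliceK.
rewrite -[LHS]hsubmxK (fibre_coord0 (cell_vec_neq0 _) v'r f0').
by congr row_mx; apply: slice_inj; rewrite unsliceK.
Qed.

Lemma fibre_coordN n (z : 'cV[C]_(2 ^ n.+1).+1) v :
  fibre_coord (- z) v = - fibre_coord z v.
Proof.
rewrite /fibre_coord (_ : tensmx _ (- z) = - tensmx 1%:M z).
  by apply/rowP => i; rewrite mulmxN !mxE.
by apply/matrixP => i j; rewrite !mxE mulrN.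
Qed.

Lemma obstr_antipode n i (r : 'rV[R]_(pdim n)) v v' : cube r ->
  block_bdry (@pblk n) i r ->
  obstr (antipode (@pblk n) i r) v v' = antipode (@pblk n) i (obstr r v v').
Proof.
elim: n r v v' => [|n IH] r v v' rc ri; first by apply/rowP => -[].
have row_ext (a b : 'rV[R]_(pdim n + (2 ^ n.+1 + 2 ^ n.+1))) :
    lsubmx a = lsubmx b -> rsubmx a = rsubmx b -> a = b.
  by move=> E E'; rewrite -(hsubmxK a) E E' hsubmxK.
have ol (r' : 'rV[R]_(pdim n.+1)) : lsubmx (obstr (n := n.+1) r' v v' : 'rV_(pdim n + _)) =
    obstr (lsubmx r') (slice (lsubmx v) 0) (slice (lsubmx v') 0) by exact: row_mxKl.
have or (r' : 'rV[R]_(pdim n.+1)) : rsubmx (obstr (n := n.+1) r' v v' : 'rV_(pdim n + _)) =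
    let w := row_mx (fibre_coord (cell_vec (rsubmx r')) (rsubmx v))
      (fibre_coord (cell_vec (rsubmx r')) (rsubmx v')) *m Lfac n in
    row_mx (\row_j complex.Re (w 0 j)) (\row_j complex.Im (w 0 j)) by exact: row_mxKr.
apply: row_ext.
  rewrite ol [RHS]lsubmx_antipode ol lsubmx_antipode.
  have [ni|ni] := eqVneq n i; first by rewrite -ni !antipode_out.
  by rewrite IH //; [exact: cube_lsubmx|exact: block_bdry_init].
rewrite or [RHS]rsubmx_antipode or rsubmx_antipode.
have [ni|//] := eqVneq n i; move: ri; rewrite -ni => ri.
rewrite cell_vec_antipode; last exact: block_bdry_last.
rewrite !fibre_coordN -opp_row_mx mulNmx /= opp_row_mx.
by congr row_mx; apply/rowP => j; rewrite !mxE; case: (\sum_(_ < _) _).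
Qed.

Lemma slice_continuous (X : topologicalType) m k (f : X -> 'rV[C]_(m * k)) j :
  continuous f -> continuous (fun x => slice (f x) j : 'rV[C]_m).
Proof.
move=> fc; apply: rV_continuous => i.
rewrite (_ : (fun _ => _) = fun x => f x 0 (mxtens_index (i, j))).
  exact: rV_coord_continuous.
by apply/funext => x; rewrite mxE.
Qed.

Lemma obstr_continuous (X : topologicalType) n (r : X -> 'rV[R]_(pdim n))
    (v v' : X -> 'rV[C]_(vdim n)) :
  continuous r -> continuous v -> continuous v' ->
  continuous (fun x => obstr (r x) (v x) (v' x)).
Proof.
elim: n r v v' => [|n IH] r v v' rc vc v'c; first exact: cst_continuous.
have zc : continuous (fun x => cell_vec (rsubmx (r x : 'rV_(pdim n + _)))).
  by apply: comp_map_continuous (@cell_vec_continuous _ _); exact: rsubmx_continuous.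
have fc (u : X -> 'rV[C]_(vdim n.+1)) : continuous u -> continuous (fun x =>
    fibre_coord (cell_vec (rsubmx (r x : 'rV_(pdim n + _))))
      (rsubmx (u x : 'rV_(vdim n * 1 + _)))).
  move=> uc; apply: slice_continuous; apply: continuous_mulmx.
    exact: rsubmx_continuous.
  by apply: continuous_tensmx; [exact: cst_continuous|exact: zc].
have lc (u : X -> 'rV[C]_(vdim n * 1 + vdim n * (2 ^ n.+1).+1)) : continuous u ->
    continuous (fun x => slice (lsubmx (u x)) 0 : 'rV[C]_(vdim n)).
  by move=> uc; apply: (@slice_continuous _ _ 1); exact: lsubmx_continuous.
have wc : continuous (fun x =>
    row_mx (fibre_coord (cell_vec (rsubmx (r x : 'rV_(pdim n + _))))
             (rsubmx (v x : 'rV_(vdim n * 1 + _))))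
           (fibre_coord (cell_vec (rsubmx (r x : 'rV_(pdim n + _))))
             (rsubmx (v' x : 'rV_(vdim n * 1 + _)))) *m Lfac n).
  apply: continuous_mulmx; last exact: cst_continuous.
  apply: rV_continuous => j; case: (split_ordP j) => k ->.
    rewrite (_ : (fun _ => _) = fun x => fibre_coord (cell_vec (rsubmx (r x : 'rV_(pdim n + _))))
             (rsubmx (v x : 'rV_(vdim n * 1 + _))) 0 k).
      by apply: rV_coord_continuous; exact: fc.
    by apply/funext => x; rewrite row_mxEl.
  rewrite (_ : (fun _ => _) = fun x => fibre_coord (cell_vec (rsubmx (r x : 'rV_(pdim n + _))))
             (rsubmx (v' x : 'rV_(vdim n * 1 + _))) 0 k).
    by apply: rV_coord_continuous; exact: fc.
  by apply/funext => x; rewrite row_mxEr.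
apply: row_mx_continuous.
  have lrc := @lsubmx_continuous X R (pdim n) _ r rc.
  have lvc := lc v vc; have lv'c := lc v' v'c.
  exact: IH lrc lvc lv'c.
apply: row_mx_continuous; apply: rV_continuous => j.
  under eq_fun do rewrite mxE.
  by apply: comp_map_continuous (@Re_continuous R); exact: rV_coord_continuous.
under eq_fun do rewrite mxE.
by apply: comp_map_continuous (@Im_continuous R); exact: rV_coord_continuous.
Qed.
End Reducing.
(** * Norm bounds on the algebras of the tower *)

Section Family.
Context {R : realType} {M : topologicalType}.
Local Notation C := (R[i] : numClosedFieldType).
Variable y : forall n, vspace C M n.

Definition corner_bound n (c : R) (a : villadsen_alg y n) : Prop :=
  0 <= c /\ forall x, mx_bound c (a x).

Definition villadsen_family : normed_family R.
Proof.
refine (@NormedFamily R (villadsen_alg y) corner_bound _ _ _ _ _ _ _ _ _).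
- by move=> n c a [].
- move=> n c c' a cc [c0 H]; split=> [|x]; first exact: le_trans cc.
  exact: mx_bound_mono (H x).
- by move=> n; split=> // x; exact: mx_bound0.
- move=> n; split=> // x; apply: mx_bound_proj; first exact: proj_idem.
  exact: proj_adj.
- move=> n c c' a b [c0 H] [c0' H']; split=> [|x]; first exact: addr_ge0.
  exact: (mx_boundD (H x) (H' x)).
- move=> n c k a [c0 H]; split=> [|x]; last exact: (mx_boundZ _ (H x)).
  by rewrite mulr_ge0 // -ler_complexE -ge0_complexE ?normr_ge0.
- move=> n c c' a b [c0 H] [c0' H']; split=> [|x]; first exact: mulr_ge0.
  exact: (mx_boundM (H x) (H' x)).
- by move=> n c a [c0 H]; split=> // x; exact: (mx_bound_star (H x)).
- by move=> n c a c0 [_ H]; split=> // x; exact: (mx_bound_cstar c0 (H x)).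
Defined.

Local Notation F := villadsen_family.
Local Notation phi := (villadsen_map y).

(** The two blocks are tensor products with projections. *)
Lemma villadsen_map_bound n c (a : F n) : nf_bnd F c a -> nf_bnd F c (phi n a : F n.+1).
Proof.
move=> [c0 H]; split=> // x.
apply: (@mx_bound_block R).
  by apply: mx_bound_tens; rewrite ?mulmx1 ?trmx1 ?map_mx1.
by apply: mx_bound_tens => //; [exact: taut_idem|exact: taut_adj].
Qed.

Hypothesis Mc : compact [set: M].

Lemma corner_bounded n (a : F n) : exists c, nf_bnd F c a.
Proof.
pose f (x : vspace C M n) : R := frob (a x).
have fE x : f x = complex.Re (\sum_j ((a x)^t* *m a x) j j).
  apply: (@complexI R); rewrite -ge0_complexE; last first.
    apply: sumr_ge0 => j _; rewrite mxE; apply: sumr_ge0 => k _.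
    by rewrite !mxE mulrC -normCK exprn_ge0 ?normr_ge0.
  rewrite /f /frob realc_sum; apply: eq_bigr => j _.
  by rewrite -dotmx_sqr dotmxE !mxE; apply: eq_bigr => k _; rewrite !mxE conjCK.
have fc : continuous (fun p : M * 'rV[R]_(pdim n) => f (pmap p)).
  apply: comp_map_continuous (@pmap_continuous R M n) _.
  have -> : f = fun x => complex.Re (\sum_j ((a x)^t* *m a x) j j).
    by apply/funext.
  apply: comp_map_continuous (@Re_continuous R) => x.
  apply: (@cvg_big _ _ +%R) => [|j _]; first exact: add_continuous.
  apply: (@continuous_entry _ _ _ _ (fun x => (a x)^t* *m a x)).
  apply: continuous_mulmx; last exact: corner_continuous.
  exact/continuous_trmxC/corner_continuous.
have Kc : compact ([set: M] `*` @cube R (pdim n)).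
  by apply: compact_setX => //; exact: compact_cube.
have [B fB] : exists B, forall p, ([set: M] `*` @cube R (pdim n)) p -> f (pmap p) <= B.
  have /compact_bounded[B [_ HB]] := continuous_compact (continuous_subspaceT fc) Kc.
  exists (B + 1) => p Kp; rewrite (le_trans (ler_norm _)) //.
  by apply: HB; [rewrite ltrDl|exists p].
exists (1 + `|B|); split=> [|x]; first by rewrite addr_ge0.
have [m [r [rc <-]]] := pmap_surj x.
apply: mx_bound_frob; rewrite (le_trans _ (ler_norm _)) //.
exact: (fB (m, r)).
Qed.
End Family.
(** * Tower algebras in the algebra of bounded sequences *)

Section Trail.
Context {R : realType} (F : normed_family R).
Local Notation C := R[i].
Variable phi : forall n, F n -> F n.+1.
Hypothesis phi_morphism : forall n, star_morphism (@phi n).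
Hypothesis phi_bound : forall n c (a : F n), nf_bnd F c a -> nf_bnd F c (phi a).
Hypothesis F_bounded : forall n (a : F n), exists c, nf_bnd F c a.

Definition at_level n (a : F n) k (b : F k) : F k :=
  match @eqP _ n k with ReflectT e => eq_rect n (fun j => F j : Type) a k e | ReflectF _ => b end.

(** The images of [a] at the later stages. The values at the indices below n, which
    are 0, are irrelevant for the class of the sequence. *)
Fixpoint trail n (a : F n) k : F k :=
  at_level a (match k return F k with 0 => 0 | k'.+1 => phi (trail a k') end).

Lemma trail_diag n (a : F n) : trail a n = a.
Proof.
have E (b : F n) : at_level a b = a.
  by rewrite /at_level; case: eqP => // e; rewrite (eq_irrelevance e erefl).
by case: n a E => [|n] a E; exact: E.
Qed.

Lemma trail_succ n (a : F n) k : (n <= k)%N -> trail a k.+1 = phi (trail a k).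
Proof.
move=> nk /=; rewrite /at_level; case: eqP => // e.
by exfalso; move: nk; rewrite {1}e ltnn.
Qed.

Lemma trail_bound n (a : F n) : exists c, \forall k \near \oo, nf_bnd F c (trail a k).
Proof.
have [c ac] := F_bounded a; exists c; exists n => // k /= /subnKC <-.
elim: (k - n)%N => [|j IH]; first by rewrite addn0 trail_diag.
by rewrite addnS trail_succ ?leq_addr //; exact: phi_bound.
Qed.

Definition limit_map n (a : F n) : limit_alg F := cls (BoundedSeq (trail_bound a)).

Lemma trail_ind n k (P : forall k, F k -> Prop) (a : F n) : P n a ->
  (forall k b, P k b -> P k.+1 (phi b)) -> (n <= k)%N -> P k (trail a k).
Proof.
move=> P0 PS /subnKC <-; elim: (k - n)%N => [|j IH]; first by rewrite addn0 trail_diag.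
by rewrite addnS trail_succ ?leq_addr //; exact: PS.
Qed.

Lemma limit_map_eq n (a : F n) (s : bounded_seq F) :
  s n = a -> (forall k, (n <= k)%N -> s k.+1 = phi (s k)) -> limit_map a = cls s.
Proof.
move=> sn sS; apply/clsP/asymp_eq; exists n => // k /= /subnKC <-.
elim: (k - n)%N => [|j IH]; first by rewrite addn0 trail_diag.
by rewrite addnS trail_succ ?leq_addr // sS ?leq_addr // IH.
Qed.

Lemma limit_map_morphism n : star_morphism (@limit_map n).
Proof.
split=> [c a b|a b||a].
- change (limit_map (c *: a + b) = laD (laZ c (limit_map a)) (limit_map b)).
  rewrite clsZ clsD; apply: limit_map_eq => [|k nk].
    by rewrite /= !trail_diag.
  by have [H _ _ _] := phi_morphism k; rewrite [RHS]H -!trail_succ.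
- rewrite [RHS]clsM; apply: limit_map_eq => [|k nk].
    by rewrite /= !trail_diag.
  by have [_ H _ _] := phi_morphism k; rewrite [RHS]H -!trail_succ.
- by apply: limit_map_eq => // k nk; have [_ _ H _] := phi_morphism k; rewrite [RHS]H.
- rewrite [RHS]cls_star; apply: limit_map_eq => [|k nk].
    by rewrite /= !trail_diag.
  by have [_ _ _ H] := phi_morphism k; rewrite [RHS]H -!trail_succ.
Qed.

Lemma limit_map_phi n (a : F n) : limit_map (phi a) = limit_map a.
Proof.
apply: limit_map_eq => [|k nk].
  by change (trail a n.+1 = phi a); rewrite trail_succ // trail_diag.
by apply: trail_succ; exact: ltnW.
Qed.
End Trail.

(** * Functions of the eigenvalue *)

Section ApproximateEigen.
Context {R : realType} {N : nat} (e : 'rV[R[i]]_N).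
Local Notation C := R[i].
Hypothesis e1 : rnorm e = 1.

(** Both conditions are needed: the algebra acts on the rows from the right, and
    without the second one approximate eigenvectors would not be stable under
    adjoints. *)
Definition near_eigen (t : R) (a : 'M[C]_N) (c : C) : Prop :=
  rnorm (e *m a - c *: e) <= t /\ rnorm (e *m a^t* - c^* *: e) <= t.

Lemma near_eigen_mono t t' a c : t <= t' -> near_eigen t a c -> near_eigen t' a c.
Proof. by move=> tt [h1 h2]; split; exact: le_trans tt. Qed.

Lemma near_eigenD t t' a b c d : near_eigen t a c -> near_eigen t' b d ->
  near_eigen (t + t') (a + b) (c + d).
Proof.
have E (u v : 'M[C]_N) (k l : C) : e *m (u + v) - (k + l) *: e =
    (e *m u - k *: e) + (e *m v - l *: e).
  by rewrite mulmxDr scalerDl opprD addrACA.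
move=> [h1 h2] [h1' h2']; split.
  by rewrite E; exact: le_trans (rnormD _ _) (lerD h1 h1').
have -> : (a + b)^t* = a^t* + b^t* by rewrite linearD /= map_mxD.
by rewrite rmorphD E; exact: le_trans (rnormD _ _) (lerD h2 h2').
Qed.

Lemma near_eigenZ t a c (k : C) : near_eigen t a c ->
  near_eigen (complex.Re `|k| * t) (k *: a) (k * c).
Proof.
have k0 : 0 <= complex.Re `|k| by rewrite -ler_complexE -ge0_complexE ?normr_ge0.
have E (u : 'M[C]_N) (l m : C) : rnorm (e *m (l *: u) - (l * m) *: e) =
    complex.Re `|l| * rnorm (e *m u - m *: e).
  by rewrite -scalemxAr -scalerA -scalerBr rnormZ.
move=> [h1 h2]; split; first by rewrite (E a k c) (ler_wpM2l k0 h1).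
have -> : (k *: a)^t* = k^* *: a^t* by rewrite linearZ /= map_mxZ.
by rewrite rmorphM (E (a^t*) k^* c^*) norm_conjC (ler_wpM2l k0 h2).
Qed.

Lemma near_eigen_star t a c : near_eigen t a c -> near_eigen t (a^t*) c^*.
Proof. by move=> [h1 h2]; split; [exact: h2|rewrite trmxCK conjCK; exact: h1]. Qed.

Lemma near_eigen_bound t a c K : near_eigen t a c -> mx_bound K a ->
  complex.Re `|c| <= K + t.
Proof.
move=> [h1 _] [_ H]; have := rnormD (e *m a) (- (e *m a - c *: e)).
rewrite rnormN opprB addrC subrK rnormZ e1 mulr1 => /le_trans; apply.
by rewrite lerD // (le_trans (H e)) // e1 mulr1.
Qed.

Lemma near_eigenM t a b c d K : near_eigen t a c -> near_eigen t b d ->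
  mx_bound K a -> mx_bound K b ->
  near_eigen ((K + K + t) * t) (a *m b) (c * d).
Proof.
have half u v c' d' : rnorm (e *m u - c' *: e) <= t -> rnorm (e *m v - d' *: e) <= t ->
    complex.Re `|c'| <= K + t -> mx_bound K v ->
    rnorm (e *m (u *m v) - (c' * d') *: e) <= (K + K + t) * t.
  move=> hu hv hc [K0 Hv].
  have -> : e *m (u *m v) - (c' * d') *: e =
      (e *m u - c' *: e) *m v + c' *: (e *m v - d' *: e).
    by rewrite mulmxBl mulmxA -scalemxAl scalerBr scalerA addrA subrK.
  rewrite (le_trans (rnormD _ _)) // rnormZ -addrA mulrDl lerD //.
    by rewrite (le_trans (Hv _)) // ler_wpM2l.
  rewrite ler_pM ?rnorm_ge0 //.
  by rewrite -ler_complexE -ge0_complexE ?normr_ge0.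
move=> ha hb Ka Kb; have ca := near_eigen_bound ha Ka.
have cb := near_eigen_bound hb Kb.
case: ha hb => [h1 h2] [h1' h2']; split; first exact: half.
rewrite trmxC_mul rmorphM /= mulrC.
have cb' : complex.Re `|d^*| <= K + t by rewrite norm_conjC.
exact: half h2' h2 cb' (mx_bound_star Ka).
Qed.
End ApproximateEigen.
Section Governed.
Context {R : realType} {M : topologicalType}.
Local Notation C := (R[i] : numClosedFieldType).
Variable y : forall n, vspace C M n.
Local Notation F := (villadsen_family y).
Local Notation e := (@evec R).

Section Generator.
Variable g : bounded_seq F.

Definition reducing n (x : vspace C M n) (lambda : C) : Prop :=
  e n *m (g n : villadsen_alg y n) x = lambda *: e n /\
  e n *m ((g n : villadsen_alg y n) x)^t* = lambda^* *: e n.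

(** In the limit of large n, [a] acts on the trivial summand at the reducing
    points of [g] by a function of the eigenvalue of [g]. *)
Definition governed (a : bounded_seq F) : Prop := forall t, 0 < t ->
  exists2 f : C -> C, continuous f & \forall n \near \oo,
    forall x lambda, reducing x lambda ->
      near_eigen (e n) t ((a n : villadsen_alg y n) x) (f lambda).

Lemma near_eigen_close n (a b : villadsen_alg y n) t t' x c :
  nf_bnd F t (a - b : F n) -> near_eigen (e n) t' (b x) c ->
  near_eigen (e n) (t + t') (a x) c.
Proof.
move=> [t0 H] h; rewrite -[c]add0r -[a x](subrK (b x)); apply: near_eigenD => //.
have E (u : 'M[C]_(vdim n)) : mx_bound t u -> rnorm (e n *m u - 0 *: e n) <= t.
  by move=> [_ Hu]; rewrite scale0r subr0 (le_trans (Hu _)) // rnorm_evec mulr1.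
have Hx : mx_bound t (a x - b x) := H x.
by split; [exact: E|rewrite conjC0; apply: E; exact: mx_bound_star].
Qed.

(** In particular, the condition depends on the class of the sequence only. *)
Lemma governed_closed (a : bounded_seq F) :
  (forall t, 0 < t -> exists b, governed b /\
     \forall n \near \oo, nf_bnd F t (a n - b n)) -> governed a.
Proof.
move=> H t t0; have t2 : 0 < t / 2 by rewrite divr_gt0.
have [b [/(_ _ t2)[f fc bf] ab]] := H _ t2; exists f => //.
apply: filterS2 ab bf => n ha hb x l rl; rewrite [t]splitr.
exact: near_eigen_close ha (hb x l rl).
Qed.

Lemma governed_asymp a b : asymp a b -> governed b -> governed a.
Proof.
by move=> /asboolP ab gb; apply: governed_closed => t t0; exists b; split=> //; exact: ab.
Qed.

Lemma governed0 : governed (bs0 F).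
Proof.
move=> t t0; exists (fun=> 0); first exact: cst_continuous.
apply: nearW => n x l _; split.
  by rewrite scale0r subr0 [X in _ *m X](_ : _ = 0) // mulmx0 rnorm0 ltW.
rewrite conjC0 scale0r subr0 [X in _ *m X](_ : _ = 0) ?mulmx0 ?rnorm0 ?ltW //.
by apply/matrixP => i j; rewrite !mxE conjC0.
Qed.

Lemma governed1 : governed (bs1 F).
Proof.
move=> t t0; exists (fun=> 1); first exact: cst_continuous.
apply: nearW => n x l _.
have -> : (bs1 F n : villadsen_alg y n) x = unit_proj y n x by [].
split; rewrite ?proj_adj evec_proj ?rmorph1 scale1r subrr rnorm0; exact: ltW.
Qed.

Lemma governed_generator : governed g.
Proof.
move=> t t0; exists id; first by move=> x; exact: cvg_id.
apply: nearW => n x l [E1 E2]; split; rewrite ?E1 ?E2 subrr rnorm0; exact: ltW.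
Qed.

Lemma governedD a b : governed a -> governed b -> governed (bsD a b).
Proof.
move=> ga gb t t0; have t2 : 0 < t / 2 by rewrite divr_gt0.
have [f fc af] := ga _ t2; have [f' fc' bf] := gb _ t2.
exists (fun z => f z + f' z); first by move=> z; exact: (@cvgD C C^o C (nbhs z) _ f f' (f z) (f' z) (fc z) (fc' z)).
apply: filterS2 af bf => n ha hb x l rl; rewrite [t]splitr.
exact: near_eigenD (ha x l rl) (hb x l rl).
Qed.

Lemma governedZ k a : governed a -> governed (bsZ k a).
Proof.
move=> ga t t0.
have k0 : 0 <= complex.Re `|k| by rewrite -ler_complexE -ge0_complexE ?normr_ge0.
have k1 : 0 < complex.Re `|k| + 1 by rewrite ltr_wpDl.
have [|f fc af] := ga (t / (complex.Re `|k| + 1)); first by rewrite divr_gt0.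
exists (fun z => k * f z).
  by move=> z; exact: (cvgM (@cst_continuous C C k z) (fc z)).
apply: filterS af => n ha x l rl.
apply: (@near_eigen_mono _ _ _ (complex.Re `|k| * (t / (complex.Re `|k| + 1)))).
  by rewrite mulrA ler_pdivrMr // mulrC ler_wpM2l ?(ltW t0) // lerDl.
exact: near_eigenZ (ha x l rl).
Qed.

Lemma governed_star a : governed a -> governed (bs_star a).
Proof.
move=> ga t t0; have [f fc af] := ga _ t0; exists (fun z => (f z)^*).
  exact: comp_map_continuous fc (@continuous_conjC C).
apply: filterS af => n ha x l rl; exact: near_eigen_star (ha x l rl).
Qed.

Lemma governedM a b : governed a -> governed b -> governed (bsM a b).
Proof.
move=> ga gb t t0.
have [ca Ha] := bs_bound a; have [cb Hb] := bs_bound b.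
pose K := `|ca| + `|cb|; have K0 : 0 <= K by rewrite addr_ge0.
have K1 : 0 < K + K + 1 by rewrite ltr_wpDl // addr_ge0.
pose s := Num.min 1 (t / (K + K + 1)).
have s0 : 0 < s by rewrite lt_min ltr01 divr_gt0.
have [f fc af] := ga _ s0; have [f' fc' bf] := gb _ s0.
exists (fun z => f z * f' z); first by move=> z; exact: (cvgM (fc z) (fc' z)).
apply: filterS2 (filterI Ha Hb) (filterI af bf) => n [[_ ka] [_ kb]] [ha hb] x l rl.
apply: (@near_eigen_mono _ _ _ ((K + K + s) * s)).
  have s1 : s <= 1 by rewrite ge_min lexx.
  have st : s <= t / (K + K + 1) by rewrite ge_min lexx orbT.
  rewrite (@le_trans _ _ ((K + K + 1) * s)) ?ler_wpM2r ?lerD2l ?(ltW s0) //.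
  by rewrite mulrC -ler_pdivlMr.
apply: (near_eigenM (@rnorm_evec R n) (ha x l rl) (hb x l rl)).
  by apply: mx_bound_mono (ka x); rewrite (le_trans (ler_norm _)) // lerDl.
by apply: mx_bound_mono (kb x); rewrite (le_trans (ler_norm _)) // lerDr.
Qed.
End Generator.

(** The elements of A with this property form a sub-C*-algebra; it is closed
    because [f] is contractive. *)
Lemma governed_generated (A : cstarAlgType C) (f : A -> limit_alg F) (g a : A) :
  star_morphism f -> cstar_generated [set sone; g] a ->
  governed (rep (f g)) (rep (f a)).
Proof.
move=> fm; have [fl fM f1 fs] := fm.
have fD u v : f (u + v) = f u + f v by have := fl 1 u v; rewrite !scale1r.
have f0 : f 0 = 0 by apply: (addIr (f 0)); rewrite -fD !add0r.
have fZ c u : f (c *: u) = c *: f u by have := fl c u 0; rewrite f0 !addr0.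
have fN u : f (- u) = - f u by rewrite -scaleN1r fZ scaleN1r.
pose T a := governed (rep (f g)) (rep (f a)).
have Tcls u b : f u = cls b -> governed (rep (f g)) b -> T u.
  by move=> E; apply: governed_asymp; rewrite E; exact: rep_cls.
move=> /(_ T); apply; split; last first.
  move=> u [->|->]; last exact: governed_generator.
  by apply: (@Tcls _ (bs1 F)); [rewrite f1|exact: governed1].
split.
- move=> u uT; apply: governed_closed => t t0.
  have [|v [Tv uv]] := uT (ball u t%:C%C).
    by apply: nbhsx_ballx; rewrite -[0]/(0%:C%C) ltr_complexE.
  exists (rep (f v)); split; first exact: Tv.
  have : nrm (f u - f v) < t.
    rewrite -fN -fD (le_lt_trans (star_morphism_contractive fm _)) //.
    by move: uv; rewrite -ball_normE /ball_ /= normE ltr_complexE.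
  rewrite -[f u]repK -[f v]repK clsB => /nrm_cls_lt.
  by apply: filterS => n /=; rewrite scaleN1r !repK.
- by apply: (@Tcls _ (bs0 F)); [rewrite f0|exact: governed0].
- move=> u v Tu Tv; apply: (@Tcls _ (bsD (rep (f u)) (rep (f v)))).
    by rewrite fD.
  exact: (governedD Tu Tv).
- move=> c u Tu; apply: (@Tcls _ (bsZ c (rep (f u)))); first by rewrite fZ.
  exact: (governedZ c Tu).
- split=> [u v Tu Tv|u Tu].
    apply: (@Tcls _ (bsM (rep (f u)) (rep (f v)))); first by rewrite fM.
    exact: (governedM Tu Tv).
  apply: (@Tcls _ (bs_star (rep (f u)))); first by rewrite fs.
  exact: (governed_star Tu).
Qed.

(** On the trivial summand the connecting maps are the pullbacks along the
    projections of the tower. *)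
Lemma trail_evec (h : F 0) n m (r : 'rV[R]_(pdim n)) :
  e n *m (@trail R F (villadsen_map y) 0 h n : villadsen_alg y n) (pmap (m, r)) =
  (h : villadsen_alg y 0) m 0 0 *: e n.
Proof.
pose P n (b : F n) := forall m (r : 'rV[R]_(pdim n)),
  e n *m (b : villadsen_alg y n) (pmap (m, r)) = (h : villadsen_alg y 0) m 0 0 *: e n.
have H : P n (@trail R F (villadsen_map y) 0 h n); last exact: H.
apply: (trail_ind (P := P)) => // {m r}.
  move=> m r; apply/rowP => i; rewrite !mxE big_ord1 !mxE mul1r mulr1.
  by rewrite !ord1.
move=> {}n b IH m r.
change (row_mx (unslice (e n)) 0 *m diag_fun fst (cst (y n)) (proj1 C _ 1)
  (xi_bundle C M n) (b : villadsen_alg y n) (pmap (n := n.+1) (m, r)) =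
  (h : villadsen_alg y 0) m 0 0 *: row_mx (unslice (e n)) 0).
rewrite /diag_fun mul_row_block !mulmx0 mul0mx !addr0 unslice_tens.
by rewrite scale_row_mx scaler0 -unsliceZ IH.
Qed.
End Governed.
(** * A finite set that no element generates *)

Section Compression.
Context {R : realType} {M : topologicalType} {d : nat}.
Local Notation C := (R[i] : numClosedFieldType).
Variable y : forall n, vspace C M n.
Local Notation F := (villadsen_family y).
Local Notation e := (@evec R).
Variables (n : nat) (a : villadsen_alg y n) (B : R).

Definition eigen_obstr (q : M * 'rV[R]_(pdim n)) : 'rV[R]_(pdim n) :=
  obstr y q.2 (e n *m a (pmap q)) (e n *m (a (pmap q))^t*).

Definition eigen_value (q : M * 'rV[R]_(pdim n)) : C :=
  dotmx (e n *m a (pmap q)) (e n).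

(** The eigenvalue as a vector of R^d, the plane being contained in R^d, and
    divided by a bound. *)
Definition eigen_row (q : M * 'rV[R]_(pdim n)) : 'rV[R]_d :=
  \row_j (if j == 0%N :> nat then complex.Re (eigen_value q) / B
          else if j == 1%N :> nat then complex.Im (eigen_value q) / B else 0).

Lemma a_pmap_continuous : continuous (fun q : M * 'rV[R]_(pdim n) => a (pmap q)).
Proof. exact: comp_map_continuous (@pmap_continuous R M n) (corner_continuous (a:=a)). Qed.

Lemma eigen_obstr_continuous : continuous eigen_obstr.
Proof.
apply: obstr_continuous; first by move=> q; exact: cvg_snd.
  by apply: continuous_mulmx; [exact: cst_continuous|exact: a_pmap_continuous].
apply: continuous_mulmx; first exact: cst_continuous.
exact: continuous_trmxC a_pmap_continuous.
Qed.

Lemma eigen_value_continuous : continuous eigen_value.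
Proof.
rewrite (_ : eigen_value = fun q => (e n *m a (pmap q) *m (e n)^t*) 0 0); last first.
  by apply/funext => q; rewrite /eigen_value dotmxE.
apply: continuous_entry; apply: continuous_mulmx; last exact: cst_continuous.
by apply: continuous_mulmx; [exact: cst_continuous|exact: a_pmap_continuous].
Qed.

Lemma eigen_row_continuous : continuous eigen_row.
Proof.
have rc := comp_map_continuous eigen_value_continuous (@Re_continuous R).
have ic := comp_map_continuous eigen_value_continuous (@Im_continuous R).
apply: rV_continuous => j.
have fE (h : M * 'rV[R]_(pdim n) -> R) : (forall q, eigen_row q 0 j = h q) ->
    continuous h -> continuous (fun q => eigen_row q 0 j).
  by move=> /funext ->.
have [j0|j0] := eqVneq (j : nat) 0%N.
  apply: (fE (fun q => complex.Re (eigen_value q) / B)).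
    by move=> q; rewrite mxE j0 eqxx.
  by apply: mul_map_continuous => //; exact: cst_continuous.
have [j1|j1] := eqVneq (j : nat) 1%N.
  apply: (fE (fun q => complex.Im (eigen_value q) / B)).
    by move=> q; rewrite mxE j1.
  by apply: mul_map_continuous => //; exact: cst_continuous.
apply: (fE (fun=> 0)); last exact: cst_continuous.
by move=> q; rewrite mxE (negbTE j0) (negbTE j1).
Qed.

Lemma eigen_equivariant : equivariant (@pblk n) setT eigen_obstr eigen_row.
Proof.
move=> i m r _ rc ri; rewrite /eigen_obstr /eigen_row /eigen_value /=.
by rewrite pmap_antipode // obstr_antipode.
Qed.

Lemma eigen_row_lt K m r : mx_bound K (a (pmap (m, r))) -> K < B ->
  forall j, `|eigen_row (m, r) 0 j| < 1.
Proof.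
move=> [K0 H] KB j; have B0 : 0 < B := le_lt_trans K0 KB.
have v1 : complex.Re `|eigen_value (m, r)| < B.
  rewrite (le_lt_trans (dotmx_le _ _)) // rnorm_evec mulr1.
  by rewrite (le_lt_trans (H _)) // rnorm_evec mulr1.
have small x : `|x| <= complex.Re `|eigen_value (m, r)| -> `|x / B| < 1.
  move=> xv; rewrite normrM normfV (gtr0_norm B0) ltr_pdivrMr // mul1r.
  exact: le_lt_trans v1.
rewrite mxE; case: ifP => _; first by apply: small; exact: Re_norm_le.
case: ifP => _; first by apply: small; exact: Im_norm_le.
by rewrite normr0.
Qed.

Lemma dotmx_evec (c : C) : dotmx (c *: e n) (e n) = c.
Proof.
have e1 : dotmx (e n) (e n) = 1 by rewrite dotmx_sqr rnorm_evec expr1n.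
by rewrite dotmxE -scalemxAl mxE -dotmxE e1 mulr1.
Qed.

Lemma eigen_obstr0 m r : eigen_obstr (m, r) = 0 ->
  e n *m a (pmap (m, r)) = eigen_value (m, r) *: e n /\
  e n *m (a (pmap (m, r)))^t* = (eigen_value (m, r))^* *: e n.
Proof.
move=> /(@obstr0P R M y n m r) [||c [c' [E E']]].
- by rewrite -mulmxA corner_mulr.
- by rewrite -mulmxA; congr (_ *m _); exact: (corner_mulr (corner_star a)).
have cE : eigen_value (m, r) = c by rewrite /eigen_value E dotmx_evec.
have c'E : (eigen_value (m, r))^* = c'.
  rewrite -[RHS]dotmx_evec -E' dotmx_mulr trmxCK /eigen_value !dotmxE !mxE.
  rewrite rmorph_sum; apply: eq_bigr => j _.
  by rewrite ![(_^t*) _ _]mxE ![(_^T) _ _]mxE rmorphM /= conjCK mulrC.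
by split; [rewrite cE E|rewrite c'E E'].
Qed.

End Compression.

Section FiniteSet.
Context {R : realType} {M : topologicalType} {d : nat}.
Local Notation C := (R[i] : numClosedFieldType).
Variables (At : set (chart R M d)) (y : forall n, vspace C M n).
Variables (A : cstarAlgType C) (mu : forall n, villadsen_alg y n -> A).
Hypotheses (d2 : (2 <= d)%N) (Mm : smooth_manifold At) (Mc : compact [set: M]).
Hypothesis limA : is_inductive_limit (villadsen_map y) mu.
Local Notation F := (villadsen_family y).

Section RealFunction.
Variables (h : M -> R) (hc : continuous h).

Lemma real_corner_subproof :
  (fun m => ((h m)%:C%C)%:M : 'M[C]_1) \in in_corner (unit_proj y 0).
Proof.
apply/in_cornerP; split=> [|m]; last by rewrite /= mul1mx mulmx1.
apply: continuous_mx => i j.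
rewrite (_ : (fun _ => _) = fun m => (h m)%:C%C).
  exact: comp_map_continuous hc (@realc_continuous R).
by apply/funext => m; rewrite !ord1 mxE eqxx mulr1n.
Qed.

Definition real_corner : villadsen_alg y 0 := Corner real_corner_subproof.
End RealFunction.

(** The set consists of the coordinates and depths of finitely many coordinate
    cubes that cover M. *)
Lemma missing_finite_set : exists E : set A,
  finite_set E /\ forall g : A, ~ (E `<=` cstar_generated [set sone; g]).
Proof.
have [L [cc ccT]] := finite_coord_cubes Mm Mc.
have d0 : (0 < d)%N by exact: ltnW.
have [t t0 no_sep] := no_separating_family (y 0%N : M) d0 ccT.
pose Ix : finType := ('I_L * option 'I_d)%type.
pose h (i : Ix) m : R := if i.2 is Some j then cc_inv (cc i.1) m 0 j else cc_depth (cc i.1) m.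
have hc i : continuous (h i).
  case: i => l [j|]; last exact: cc_depth_continuous.
  by apply: rV_coord_continuous; exact: cc_inv_continuous.
pose hA i := mu (real_corner (hc i)).
exists (range hA); split; first by apply: finite_image; exact: finite_finset.
move=> g Eg.
pose nu n : villadsen_alg y n -> limit_alg F := @limit_map R F (villadsen_map y)
  (@villadsen_map_bound R M y) (corner_bounded Mc) n.
have [_ _ /(_ (limit_alg F) nu)] := limA.
case=> [n|n a|f [[fm fE] _]].
- apply: (@limit_map_morphism R F (villadsen_map y)) => k.
  exact: villadsen_map_morphism.
- exact: (@limit_map_phi R F (villadsen_map y)).
set gg := rep (f g).
pose tr i : bounded_seq F := BoundedSeq (trail_bound (@villadsen_map_bound R M y)
    (corner_bounded Mc) (real_corner (hc i))).
have gov i : governed gg (tr i).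
  have gi := governed_generated fm (Eg _ (imageT hA i)).
  apply: governed_asymp gi; rewrite asymp_sym; apply/clsP; rewrite repK.
  exact: fE.
have /choice[ff ffP] : forall i, exists f : C -> C, continuous f /\
    \forall n \near \oo, forall x lambda, reducing gg x lambda ->
      near_eigen (evec n) t ((tr i n : villadsen_alg y n) x) (f lambda).
  by move=> i; have [k kc kP] := gov i _ t0; exists k.
have [n nP] : exists n, forall i x lambda, reducing gg x lambda ->
      near_eigen (@evec R n) t ((tr i n : villadsen_alg y n) x) (ff i lambda).
  have /filter_ex : \forall n \near \oo, forall i x lambda, reducing gg x lambda ->
      near_eigen (@evec R n) t ((tr i n : villadsen_alg y n) x) (ff i lambda).
    by apply: filter_forall => i; have [_] := ffP i.
  exact.
pose a : villadsen_alg y n := gg n.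
have [K [K0 aK]] := corner_bounded Mc a.
pose B := K + 1; have B0 : 0 < B by rewrite ltr_wpDl.
pose j0 := Ordinal d0; pose j1 := Ordinal d2.
pose back (w : 'rV[R]_d) : C := Complex (B * w 0 j0) (B * w 0 j1).
have backc : continuous back.
  by apply: Complex_continuous; apply: mul_map_continuous;
    try exact: cst_continuous; apply: rV_coord_continuous => w; exact: cvg_id.
have backE q : back (eigen_row (d := d) a B q) = eigen_value a q.
  rewrite /back !mxE /= !mulrA ![B * _]mulrC !mulfK ?lt0r_neq0 //.
  by case: (eigen_value a q).
pose Fh l w : 'rV[R]_d := \row_j complex.Re (ff (l, Some j) (back w)).
pose Ft l w : R := complex.Re (ff (l, None) (back w)).
have ffc i : continuous (fun w : 'rV[R]_d => complex.Re (ff i (back w))).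
  apply: comp_map_continuous (@Re_continuous R).
  by apply: comp_map_continuous backc _; have [] := ffP i.
apply: (no_sep (pdim n) (@pblk n) (eigen_obstr a) (eigen_row a B) Fh Ft).
- exact: eigen_obstr_continuous.
- exact: eigen_row_continuous.
- exact: eigen_equivariant.
- by move=> m r _; apply: eigen_row_lt (aK _) _; rewrite ltrDl.
- move=> l; apply: rV_continuous => j.
  rewrite (_ : (fun _ => _) = fun w => complex.Re (ff (l, Some j) (back w))).
    exact: ffc.
  by apply/funext => w; rewrite mxE.
- by move=> l; exact: ffc.
- move=> m r _ s0.
  have hb i : `|complex.Re (ff i (back (eigen_row a B (m, r)))) - h i m| <= t.
    rewrite backE; have [H _] := nP i _ _ (eigen_obstr0 s0).
    have hE : (real_corner (hc i) : villadsen_alg y 0) m 0 0 = (h i m)%:C%C.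
      by rewrite /= mxE eqxx mulr1n.
    move: H; rewrite trail_evec hE -scalerBl rnormZ rnorm_evec mulr1.
    apply: le_trans; set z := ff i _.
    have -> : complex.Re z - h i m = - complex.Re ((h i m)%:C%C - z).
      by case: z => u v /=; rewrite opprB.
    by rewrite normrN Re_norm_le.
  move=> l; split; last exact: (hb (l, None)).
  apply: rV_norm_le (ltW t0) _ => j; rewrite !mxE.
  exact: (hb (l, Some j)).
Qed.
End FiniteSet.

Theorem theorem3p1 (R : realType) (d : nat) (M : topologicalType)
    (At : set (chart R M d)) (y : forall n, vspace R[i] M n)
    (A : cstarAlgType R[i]) (mu : forall n, villadsen_alg y n -> A) :
  (2 <= d)%N ->
  smooth_manifold At -> compact [set: M] -> orientable At ->
  tower_dense y ->
  is_inductive_limit (villadsen_map y) mu ->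
  (forall g : A, cstar_generated [set sone; g] <> [set: A]) /\
  (exists E : set A,
    finite_set E /\ forall g : A, ~ (E `<=` cstar_generated [set sone; g])).
Proof.
move=> d2 Mm Mc _ _ limA.
have [E [Ef EP]] := missing_finite_set d2 Mm Mc limA.
split; last by exists E.
by move=> g gA; apply: (EP g); rewrite gA.
Qed.
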